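(* Let $k\ge0$ be an integer and assume that $\dfrac{2\|\boldsymbol\beta\|_{\infty,\Omega}^2}{\nu\sigma}<1$. Then the DG method defines a unique approximate solution, i.e. there exists a unique $(\boldsymbol u_h,\boldsymbol\omega_h,p_h)\in\widetilde{\mathrm H}_h\times\widetilde{\mathrm Z}_h\times\widetilde{\mathrm Q}_h$ such that $$\begin{aligned}a(\boldsymbol u_h,\boldsymbol v_h)+\tilde b_1(\boldsymbol v_h,\boldsymbol\omega_h)+\tilde b_2(\boldsymbol v_h,p_h)+c(\boldsymbol\omega_h,\boldsymbol v_h)+j(\boldsymbol u_h,\boldsymbol v_h)&=\widetilde F(\boldsymbol v_h)&&\forall\boldsymbol v_h\in\widetilde{\mathrm H}_h,\\ d(\boldsymbol\omega_h,\boldsymbol\theta_h)-\tilde b_1(\boldsymbol u_h,\boldsymbol\theta_h)&=\widetilde G(\boldsymbol\theta_h)&&\forall\boldsymbol\theta_h\in\widetilde{\mathrm Z}_h,\\ e(p_h,q_h)-\tilde b_2(\boldsymbol u_h,q_h)&=\widetilde L(q_h)&&\forall q_h\in\widetilde{\mathrm Q}_h.\end{aligned}$$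
   Context: $\Omega\subset\mathbb R^3$ is a bounded polyhedral domain with Lipschitz boundary, with a disjoint partition $\partial\Omega=\Gamma\cup\Sigma$; $\boldsymbol n$ is the outward unit normal. $\nu,\sigma>0$ are constants, $\boldsymbol\beta\in L^\infty(\Omega)^3$ (usual norm $\|\cdot\|_{\infty,\Omega}$), $\boldsymbol f\in L^2(\Omega)^3$; $p_\Sigma$ and $\boldsymbol u_\Sigma$ are boundary data on $\Sigma$ (regular enough, e.g. square integrable, that the integrals below make sense). Mesh: $\mathcal T_h$ belongs to a shape-regular family of (conforming) partitions of $\bar\Omega$ into tetrahedra $T$ of diameter $h_T$, compatible with $\Gamma$ and $\Sigma$. $\mathcal E_h$ is the set of internal faces, $\mathcal F_h^\Sigma$ and $\mathcal F_h^\Gamma$ the sets of boundary faces on $\Sigma$ and $\Gamma$. On an internal face shared by $T^\pm$ with outward unit normals $\boldsymbol n^\pm$ and traces $\pm$ from $T^\pm$: $[\![\boldsymbol v]\!]_T=\boldsymbol v^+\times\boldsymbol n^++\boldsymbol v^-\times\boldsymbol n^-$, $[\![\boldsymbol v]\!]_N=\boldsymbol v^+\cdot\boldsymbol n^++\boldsymbol v^-\cdot\boldsymbol n^-$, $[\![q]\!]=q^+\boldsymbol n^++q^-\boldsymbol n^-$, $\{\!\{\boldsymbol v\}\!\}=\frac12(\boldsymbol v^++\boldsymbol v^-)$, $\{\!\{q\}\!\}=\frac12(q^++q^-)$; on boundary faces $[\![\boldsymbol v]\!]_T=\boldsymbol v\times\boldsymbol n$, $[\![\boldsymbol v]\!]_N=\boldsymbol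 v\cdot\boldsymbol n$, $[\![q]\!]=q\boldsymbol n$, $\{\!\{\boldsymbol v\}\!\}=\boldsymbol v$, $\{\!\{q\}\!\}=q$. Discrete spaces ($\mathcal P_m(T)$: polynomials of total degree $\le m$): $\widetilde{\mathrm Z}_h=\{\boldsymbol\theta_h\in L^2(\Omega)^3:\boldsymbol\theta_h|_T\in\mathcal P_k(T)^3\ \forall T\}$, $\widetilde{\mathrm H}_h=\{\boldsymbol v_h\in L^2(\Omega)^3:\boldsymbol v_h|_T\in\mathcal P_{k+1}(T)^3\ \forall T\}$, $\widetilde{\mathrm Q}_h=\{q_h\in L^2(\Omega):q_h|_T\in\mathcal P_k(T)\ \forall T\}$ (with zero mean if $\Sigma$ has zero measure). Stabilisation parameters, with fixed constants $c_{11},a_{11},d_{11}>0$: on an internal face shared by $T^+,T^-$, $C_{11}=c_{11}\max\{h_{T^+}^{-1},h_{T^-}^{-1}\}$, $A_{11}=a_{11}\max\{h_{T^+}^{-1},h_{T^-}^{-1}\}$, $D_{11}=d_{11}\max\{h_{T^+},h_{T^-}\}$; on $\partial T\cap\Sigma$, $C_{11}=c_{11}h_T^{-1}$, $D_{11}=d_{11}h_T$; on $\partial T\cap\Gamma$, $A_{11}=a_{11}h_T^{-1}$. Forms: $a(\boldsymbol u,\boldsymbol v)=\sigma\int_\Omega\boldsymbol u\cdot\boldsymbol v$, $d(\boldsymbol\omega,\boldsymbol\theta)=\int_\Omega\boldsymbol\omega\cdot\boldsymbol\theta$, $c(\boldsymbol\theta,\boldsymbol v)=\nu^{-1/2}\int_\Omega(\boldsymbol\theta\times\boldsymbol\beta)\cdot\boldsymbol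 v$, $$\tilde b_1(\boldsymbol u,\boldsymbol\theta)=\sqrt\nu\sum_{T}\int_T\mathbf{curl}\,\boldsymbol\theta\cdot\boldsymbol u+\sqrt\nu\sum_{e\in\mathcal E_h\cup\mathcal F_h^\Gamma}\int_e\{\!\{\boldsymbol u\}\!\}\cdot[\![\boldsymbol\theta]\!]_T,\qquad \tilde b_2(\boldsymbol v,p)=-\sum_T\int_Tp\,\mathrm{div}\,\boldsymbol v+\sum_{e\in\mathcal E_h\cup\mathcal F_h^\Gamma}\int_e\{\!\{p\}\!\}[\![\boldsymbol v]\!]_N,$$ $$j(\boldsymbol u,\boldsymbol v)=\sqrt\nu\sum_{e\in\mathcal E_h\cup\mathcal F_h^\Sigma}\int_eC_{11}[\![\boldsymbol u]\!]_T\cdot[\![\boldsymbol v]\!]_T+\sum_{e\in\mathcal E_h\cup\mathcal F_h^\Gamma}\int_eA_{11}[\![\boldsymbol u]\!]_N[\![\boldsymbol v]\!]_N,\qquad e(p,q)=\sum_{e\in\mathcal E_h\cup\mathcal F_h^\Sigma}\int_eD_{11}[\![p]\!]\cdot[\![q]\!],$$ $$\widetilde F(\boldsymbol v)=\int_\Omega\boldsymbol f\cdot\boldsymbol v-\sum_{e\in\mathcal F_h^\Sigma}\Big(\int_ep_\Sigma\,\boldsymbol v\cdot\boldsymbol n-\sqrt\nu\int_eC_{11}\boldsymbol u_\Sigma\cdot(\boldsymbol v\times\boldsymbol n)\Big),$$ $$\widetilde G(\boldsymbol\theta)=-\sqrt\nu\sum_{e\in\mathcal F_h^\Sigma}\int_e\boldsymbol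 u_\Sigma\cdot\boldsymbol\theta,\qquad\widetilde L(q)=\sum_{e\in\mathcal F_h^\Sigma}\int_eD_{11}(p_\Sigma\boldsymbol n)\cdot(q\boldsymbol n).$$ *)

(* Defs.v *)
From HB Require Import structures.
From mathcomp Require Import all_boot all_order all_algebra.
From mathcomp Require Import all_classical all_reals all_analysis.
(* Imported without its notations, which clash with those of MathComp-Analysis. *)
From mathcomp.multinomials Require mpoly.
Import -(notations) mpoly.

Set Implicit Arguments.
Unset Strict Implicit.
Unset Printing Implicit Defensive.
Import Order.TTheory GRing.Theory Num.Theory.
Import numFieldNormedType.Exports.

Local Open Scope classical_set_scope.
Local Open Scope ring_scope.

(* Points and vectors are row vectors ['rV[R]_3].  The library norm [`|x|] on
    ['rV[R]_3] is the sup norm: it gives the usual topology, but lengths,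
    diameters and unit normals below use the Euclidean norm [enorm]. *)

Section Space.
Variable R : realType.
Local Notation vec := 'rV[R]_3.
Implicit Types (u v x : vec) (A D S : set vec).

Definition dot u v : R := \sum_(i < 3) u 0 i * v 0 i.

Definition cross u v : vec :=
  \row_(i < 3) [:: u 0 1 * v 0 2 - u 0 2 * v 0 1;
                   u 0 2 * v 0 0 - u 0 0 * v 0 2;
                   u 0 0 * v 0 1 - u 0 1 * v 0 0]`_i.

Definition enorm u : R := Num.sqrt (dot u u).

Definition pderiv (i : 'I_3) (q : vec -> R) x : R := 'D_(delta_mx 0 i) q x.

Definition vcoord (v : vec -> vec) (i : 'I_3) x : R := v x 0 i.

Definition div (v : vec -> vec) x : R := \sum_(i < 3) pderiv i (vcoord v i) x.

Definition curl (v : vec -> vec) x : vec :=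
  \row_(i < 3) [:: pderiv 1 (vcoord v 2) x - pderiv 2 (vcoord v 1) x;
                   pderiv 2 (vcoord v 0) x - pderiv 0 (vcoord v 2) x;
                   pderiv 0 (vcoord v 1) x - pderiv 1 (vcoord v 0) x]`_i.

Definition bdry A : set vec := closure A `\` A°.

(* The library has no measurable structure on ['rV[R]_3]: three-dimensional
    Lebesgue measure is the product measure on [R * R * R], read through the
    coordinate bijection [pt3]. *)

Definition leb2 := (@lebesgue_measure R \x @lebesgue_measure R)%E.

Definition leb3 := (@lebesgue_measure R \x @lebesgue_measure R
                      \x @lebesgue_measure R)%E.

Definition pt3 (t : measurableTypeR R * measurableTypeR R * measurableTypeR R)
    : vec :=
  \row_(i < 3) [:: t.1.1 : R; t.1.2 : R; t.2 : R]`_i.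

Definition vint D (g : vec -> R) : R :=
  \int[leb3]_(t in pt3 @^-1` D) g (pt3 t).

(* [g] belongs to L^p(D): its extension by zero does so on the whole space. *)
Definition inLp (p : \bar R) D (g : vec -> R) : Prop :=
  ((g \o pt3) \_ (pt3 @^-1` D)) \in Lfun leb3 p.

Definition inLp_vec (p : \bar R) D (v : vec -> vec) : Prop :=
  forall i, inLp p D (vcoord v i).

Definition ae_eq_in (V : Type) D (g h : vec -> V) : Prop :=
  {ae leb3, forall t, D (pt3 t) -> g (pt3 t) = h (pt3 t)}.

(* The product norm of L^oo(D)^3, i.e. the largest of the three component
   norms.  It is bounded by the essential supremum of the Euclidean length. *)
Definition Linf_norm D (v : vec -> vec) : R :=
  \big[Num.max/0]_(i < 3)
    fine ('N[leb3]_+oo[EFin \o ((vcoord v i \o pt3) \_ (pt3 @^-1` D))]).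

(* Up to the rigid motion [Q], [D] is locally the region below the graph of a
   Lipschitz function of two variables. *)
Definition lipschitz_boundary D : Prop :=
  forall x, bdry D x ->
  exists (U : set vec) (Q : 'M[R]_3) (phi : 'rV[R]_2 -> R),
    [/\ open U, U x, Q *m Q^T = 1%:M, lipschitz phi &
        forall z, U z ->
          let y := z *m Q in
          D z <-> y 0 2 < phi (\row_(j < 2) y 0 (widen_ord (leqnSn 2) j))].

Definition bounded_lipschitz_domain D : Prop :=
  [/\ D !=set0, open D, connected D, bounded_set D & lipschitz_boundary D].

(* The vertices of a simplex are the rows of [V]; [A] selects a subsimplex. *)

Definition simplex n (V : 'M[R]_(n, 3)) (A : {set 'I_n}) : set vec :=
  [set x | exists w : 'rV[R]_n,
     [/\ forall i, 0 <= w 0 i, forall i, i \notin A -> w 0 i = 0,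
         \sum_i w 0 i = 1 & x = w *m V]].

Definition open_simplex n (V : 'M[R]_(n, 3)) (A : {set 'I_n}) : set vec :=
  [set x | exists w : 'rV[R]_n,
     [/\ forall i, i \in A -> 0 < w 0 i, forall i, i \notin A -> w 0 i = 0,
         \sum_i w 0 i = 1 & x = w *m V]].

Definition nondegenerate (V : 'M[R]_(4, 3)) : bool :=
  row_free (\matrix_(i < 3) (row (lift ord0 i) V - row ord0 V)).

Definition diam A : R :=
  sup [set d | exists x y, [/\ A x, A y & d = enorm (x - y)]].

(* A mesh is a finite family of tetrahedra, given by their vertices. *)

Section Mesh.
Variables (N : nat) (Th : 'I_N -> 'M[R]_(4, 3)).

Definition tet (K : 'I_N) : set vec := simplex (Th K) [set: 'I_4]%SET.

(* Conformity is the last clause: two distinct elements meet in a common vertex,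
   edge or face, or not at all ([A] and [B] are then empty).  A domain that has
   such a mesh is polyhedral. *)
Definition is_mesh_of D : Prop :=
  [/\ forall K, nondegenerate (Th K),
      closure D = \bigcup_(K in [set: 'I_N]) tet K,
      forall K L, K != L -> (tet K)° `&` (tet L)° = set0 &
      forall K L, K != L -> exists A B : {set 'I_4},
        tet K `&` tet L = simplex (Th K) A /\
        tet K `&` tet L = simplex (Th L) B].

Definition hT (K : 'I_N) : R := diam (tet K).

Definition shape_regular (kappa : R) : Prop :=
  forall K, exists x r,
    [/\ 0 < r, [set y | enorm (y - x) < r] `<=` tet K & hT K <= kappa * r].

(* [(K, i)] is the face of the element [K] opposite to its [i]-th vertex. *)
Definition half_face : finType := ('I_N * 'I_4)%type.

Definition hface (F : half_face) : set vec := simplex (Th F.1) [set~ F.2]%SET.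

Definition hface_relint (F : half_face) : set vec :=
  open_simplex (Th F.1) [set~ F.2]%SET.

Definition fvertex (F : half_face) (j : 'I_3) : vec :=
  row j (row' F.2 (Th F.1)).

Definition farea_vec (F : half_face) : vec :=
  cross (fvertex F 1 - fvertex F 0) (fvertex F 2 - fvertex F 0).

(* The sign makes the normal point away from the opposite vertex. *)
Definition face_normal (F : half_face) : vec :=
  (- Num.sg (dot (farea_vec F) (row F.2 (Th F.1) - fvertex F 0))
     / enorm (farea_vec F)) *: farea_vec F.

(* Surface integrals use the affine parametrisation of the face by the reference
   triangle, whose area element is [enorm (farea_vec F)]. *)
Definition ref_tri : set (measurableTypeR R * measurableTypeR R) :=
  [set st | [/\ 0 <= st.1 :> R, 0 <= st.2 :> R & (st.1 : R) + st.2 <= 1]].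

Definition fparam (F : half_face)
    (st : measurableTypeR R * measurableTypeR R) : vec :=
  fvertex F 0 + (st.1 : R) *: (fvertex F 1 - fvertex F 0)
              + (st.2 : R) *: (fvertex F 2 - fvertex F 0).

Definition fint (F : half_face) (g : vec -> R) : R :=
  enorm (farea_vec F) * \int[leb2]_(st in ref_tri) g (fparam F st).

Definition inL2_face (F : half_face) (g : vec -> R) : Prop :=
  ((g \o fparam F) \_ ref_tri) \in Lfun leb2 2%:E.

(* The faces of the mesh: [(F, Some G)] is the internal face seen from its two
   sides T^+ and T^-, and [(F, None)] is a boundary face.  As all the quantities
   below are symmetric in T^+ and T^-, the side with the smaller index is taken
   for T^+, so that each internal face occurs once. *)
Definition mface : finType := (half_face * option half_face)%type.

Definition internal (e : mface) : bool :=
  if e.2 is Some G then (e.1.1 < G.1)%N && `[< hface e.1 = hface G >]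
  else false.

Definition on_boundary (F : half_face) : bool :=
  [forall G : half_face, (G.1 != F.1) ==> ~~ `[< hface G = hface F >]].

Definition face_on S (e : mface) : bool :=
  [&& e.2 == None, on_boundary e.1 & `[< hface_relint e.1 `<=` S >]].

Definition compatible (Gam Sig : set vec) : Prop :=
  forall F, on_boundary F -> hface_relint F `<=` Gam \/ hface_relint F `<=` Sig.

Definition surface_null S : Prop :=
  forall F, on_boundary F ->
    leb2.-negligible (ref_tri `&` fparam F @^-1` S).

Definition inL2_boundary S (g : vec -> R) : Prop :=
  forall e, face_on S e -> inL2_face e.1 g.

Definition trace (V : ptopologicalType) (v : vec -> V) (K : 'I_N) x :=
  lim (v @ within (tet K)° (nbhs x)).

Definition two_sided (V : zmodType) (g : half_face -> V) (e : mface) : V :=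
  g e.1 + (if e.2 is Some G then g G else 0).

Definition average (V : lmodType R) (g : half_face -> V) (e : mface) : V :=
  if e.2 is Some G then 2^-1 *: (g e.1 + g G) else g e.1.

Definition jumpT (v : vec -> vec) (e : mface) x : vec :=
  two_sided (fun F => cross (trace v F.1 x) (face_normal F)) e.

Definition jumpN (v : vec -> vec) (e : mface) x : R :=
  two_sided (fun F => dot (trace v F.1 x) (face_normal F)) e.

Definition jump (q : vec -> R) (e : mface) x : vec :=
  two_sided (fun F => trace q F.1 x *: face_normal F) e.

Definition avg_vec (v : vec -> vec) (e : mface) x : vec :=
  average (fun F => trace v F.1 x) e.

Definition avg (q : vec -> R) (e : mface) x : R :=
  average (V := R^o) (fun F => trace q F.1 x) e.

Definition poly_on (m : nat) D (q : vec -> R) : Prop :=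
  exists2 p : mpoly 3 R, (mmeasure mdeg p <= m.+1)%N &
    forall x, D x -> q x = meval (x 0) p.

(* Elements of the discrete spaces are representatives of L^2 classes which are
   polynomial at every point of each open element; values on the mesh skeleton
   are irrelevant, and so volume integrals of derivatives, like traces, only use
   the open elements. *)
Definition broken (m : nat) D (q : vec -> R) : Prop :=
  inLp 2%:E D q /\ forall K, poly_on m (tet K)° q.

Definition broken_vec (m : nat) D (v : vec -> vec) : Prop :=
  forall i, broken m D (vcoord v i).

Definition Zh (k : nat) D := broken_vec k D.

Definition Hh (k : nat) D := broken_vec k.+1 D.

Definition Qh (k : nat) D Sig (q : vec -> R) : Prop :=
  broken k D q /\ (surface_null Sig -> vint D q = 0).

Definition max_h (e : mface) : R :=
  if e.2 is Some G then Num.max (hT e.1.1) (hT G.1) else hT e.1.1.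

Definition max_hV (e : mface) : R :=
  if e.2 is Some G then Num.max (hT e.1.1)^-1 (hT G.1)^-1 else (hT e.1.1)^-1.

Definition C11 (c11 : R) (e : mface) : R := c11 * max_hV e.
Definition A11 (a11 : R) (e : mface) : R := a11 * max_hV e.
Definition D11 (d11 : R) (e : mface) : R := d11 * max_h e.

Section Forms.
Variables (Om Gam Sig : set vec) (nu sigma c11 a11 d11 : R).

Definition form_a (u v : vec -> vec) : R :=
  sigma * vint Om (fun x => dot (u x) (v x)).

Definition form_d (w th : vec -> vec) : R :=
  vint Om (fun x => dot (w x) (th x)).

Definition form_c (beta th v : vec -> vec) : R :=
  (Num.sqrt nu)^-1 * vint Om (fun x => dot (cross (th x) (beta x)) (v x)).

Definition form_b1 (u th : vec -> vec) : R :=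
  Num.sqrt nu * (\sum_K vint (tet K)° (fun x => dot (curl th x) (u x)))
  + Num.sqrt nu * (\sum_(e : mface | internal e || face_on Gam e)
      fint e.1 (fun x => dot (avg_vec u e x) (jumpT th e x))).

Definition form_b2 (v : vec -> vec) (p : vec -> R) : R :=
  - (\sum_K vint (tet K)° (fun x => p x * div v x))
  + \sum_(e : mface | internal e || face_on Gam e)
      fint e.1 (fun x => avg p e x * jumpN v e x).

Definition form_j (u v : vec -> vec) : R :=
  Num.sqrt nu * (\sum_(e : mface | internal e || face_on Sig e)
      fint e.1 (fun x => C11 c11 e * dot (jumpT u e x) (jumpT v e x)))
  + \sum_(e : mface | internal e || face_on Gam e)
      fint e.1 (fun x => A11 a11 e * (jumpN u e x * jumpN v e x)).

Definition form_e (p q : vec -> R) : R :=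
  \sum_(e : mface | internal e || face_on Sig e)
    fint e.1 (fun x => D11 d11 e * dot (jump p e x) (jump q e x)).

Definition rhs_F (f uSig : vec -> vec) (pSig : vec -> R) (v : vec -> vec) : R :=
  vint Om (fun x => dot (f x) (v x))
  - \sum_(e : mface | face_on Sig e)
      (fint e.1 (fun x => pSig x * dot (trace v e.1.1 x) (face_normal e.1))
       - Num.sqrt nu * fint e.1 (fun x =>
           C11 c11 e * dot (uSig x) (cross (trace v e.1.1 x) (face_normal e.1)))).

Definition rhs_G (uSig th : vec -> vec) : R :=
  - Num.sqrt nu * \sum_(e : mface | face_on Sig e)
      fint e.1 (fun x => dot (uSig x) (trace th e.1.1 x)).

Definition rhs_L (pSig q : vec -> R) : R :=
  \sum_(e : mface | face_on Sig e)
    fint e.1 (fun x => D11 d11 e *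
      dot (pSig x *: face_normal e.1) (trace q e.1.1 x *: face_normal e.1)).

End Forms.
End Mesh.
End Space.

(* Main.v *)
(* The discrete spaces are finite dimensional and the equations are linear, so
   it suffices to show that the homogeneous system, or its transpose, has only
   the zero solution.  Tested with its own solution it reduces to
     sigma |u|^2 + |w|^2 + nu^-1/2 (w x beta, u) + j(u, u) + e(p, p) = 0.
   Pointwise |beta|^2 <= 3 |beta|_oo^2, the factor 3 coming from the component
   norms, so the smallness assumption still absorbs the convective term.  Hence
   u = w = 0, and p has no jump across internal faces and vanishes on Sigma.
   What remains is b2(v, p) = 0 for all v; integrating by parts element by
   element, the face terms cancel and b2(v, p) is the sum of the integrals of
   grad p . v, so that v = grad p makes p constant on each element.  Two points
   of the connected set Omega are joined through relative interiors of faces,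
   so p is one constant, which vanishes on Sigma or has mean zero. *)

(* Every form is transcribed to the polynomial coefficients of the discrete functions on the
   elements. There linearity, degrees and finite generation are algebra, and the arbitrary values on
   the mesh skeleton disappear; they return only as equality almost everywhere. Generating families
   need not be free, so existence and uniqueness are not exchanged by counting dimensions: existence
   uses the kernel of the transposed system, uniqueness that of the system itself. The energy
   argument serves both, as it sees only the diagonal. Integration by parts needs the divergence
   theorem for polynomials on a tetrahedron. Fubini and the fundamental theorem of calculus give it
   along one edge, as a difference of two face integrals; the three edges at a vertex form a basis
   and so determine the whole flux. If the face integral of a square vanishes, the polynomial need
   not be zero: it vanishes only almost everywhere on that face. The face terms are therefore
   compared through integrals of products. *)
From Pilot Require Import Defs.
From HB Require Import structures.
From mathcomp.multinomials Require mpoly.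
Import -(notations) mpoly.
From mathcomp Require Import all_boot all_order all_algebra.
From mathcomp Require Import all_classical all_reals all_analysis.
From mathcomp Require Import measurable_realfun ess_sup_inf.
From mathcomp Require Import ring lra.
Set Implicit Arguments.
Unset Strict Implicit.
Unset Printing Implicit Defensive.
Import Order.TTheory GRing.Theory Num.Theory.
Import numFieldNormedType.Exports.
Local Open Scope classical_set_scope.
Local Open Scope ring_scope.
Import Pilot.Defs.

(** * Affine changes of variables *)

Section Scaling.
Local Open Scope ereal_scope.
Context d (T : measurableType d) (R : realType).
Implicit Types (mu : {measure set T -> \bar R}) (phi psi : T -> T).

(** The pushforward of [mu] is [c] times [mu]. Phrased with preimages, it composes and needs no
    inverse map; for an invertible affine map [c] is the inverse of the absolute determinant. *)
Definition scales mu phi (c : R) : Prop :=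
  measurable_fun setT phi /\
  forall S, measurable S -> mu (phi @^-1` S) = c%:E * mu S.

Lemma scales_comp mu phi psi (b c : R) :
  scales mu phi b -> scales mu psi c -> scales mu (psi \o phi) (b * c)%R.
Proof.
move=> [mphi hphi] [mpsi hpsi]; split; first exact: measurableT_comp.
move=> S mS; rewrite comp_preimage hphi ?hpsi ?EFinM ?muleA//.
by rewrite -[X in measurable X]setTI; exact: mpsi.
Qed.

Lemma scales_ge0_integral mu phi (c : R) (D : set T) (f : T -> \bar R) :
  (0 <= c)%R -> scales mu phi c -> measurable D -> measurable_fun D f ->
  (forall x, D x -> 0 <= f x) ->
  \int[mu]_(x in phi @^-1` D) f (phi x) = c%:E * \int[mu]_(x in D) f x.
Proof.
move=> c0 [mphi hphi] mD mf f0.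
transitivity (\int[mscale (NngNum c0) mu]_(x in D) f x); last first.
  by rewrite (ge0_integral_mscale mu mD).
rewrite -(@ge0_integral_pushforward _ _ _ _ _ _ mphi mu D f)//; last first.
  by move=> x; rewrite inE; exact: f0.
by apply: eq_measure_integral => A mA _; rewrite /= /pushforward hphi.
Qed.

Lemma scales_integral mu phi (c : R) (D : set T) (f : T -> \bar R) :
  (0 <= c)%R -> scales mu phi c -> measurable D -> measurable_fun D f ->
  mu.-integrable D f ->
  \int[mu]_(x in phi @^-1` D) f (phi x) = c%:E * \int[mu]_(x in D) f x.
Proof.
move=> c0 hphi mD mf fi.
rewrite integralE [in RHS]integralE muleBr//; last first.
  rewrite fin_num_adde_defl// fin_numN.
  exact: integrable_fin_num (integrable_funeneg mD fi).
congr (_ - _).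
  under eq_integral do rewrite funepos_comp/=.
  apply: (scales_ge0_integral (f := f^\+) c0 hphi mD) => //.
  exact: measurable_funepos.
under eq_integral do rewrite funeneg_comp/=.
apply: (scales_ge0_integral (f := f^\-) c0 hphi mD) => //.
exact: measurable_funeneg.
Qed.

Lemma scales_Rintegral mu phi (c : R) (D : set T) (f : T -> R) :
  (0 <= c)%R -> scales mu phi c -> measurable D ->
  mu.-integrable D (EFin \o f) ->
  (\int[mu]_(x in phi @^-1` D) f (phi x) = c * \int[mu]_(x in D) f x)%R.
Proof.
move=> c0 hphi mD fi; rewrite /Rintegral.
rewrite (@scales_integral mu phi c D (EFin \o f) c0)//; last first.
  exact: measurable_int fi.
by rewrite fineM//; exact: integrable_fin_num.
Qed.

End Scaling.

Section SkewProduct.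
Local Open Scope ereal_scope.
Context d1 d2 (T1 : measurableType d1) (T2 : measurableType d2) (R : realType).
Variables (m1 : {sigma_finite_measure set T1 -> \bar R})
          (m2 : {sigma_finite_measure set T2 -> \bar R}).

(** Cavalieri: the section at [x] of the preimage is the preimage under [h x] of the section, so the
    factor of the fibre maps passes to the product. *)
Lemma scales_skewr (h : T1 -> T2 -> T2) (c : R) :
  measurable_fun setT (fun z => h z.1 z.2) ->
  (0 <= c)%R -> (forall x, scales m2 (h x) c) ->
  scales (m1 \x m2) (fun z => (z.1, h z.1 z.2)) c.
Proof.
move=> mh c0 hs; split; first exact: measurable_fun_pair.
move=> S mS; rewrite /product_measure1 -ge0_integralZl//; last first.
  exact: measurable_fun_xsection.
apply: eq_integral => x _ /=; have [_ <-] := hs x; last exact: measurable_xsection.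
by congr (m2 _); apply/seteqP; split => y /=; rewrite /xsection /= !inE.
Qed.

(** The product measure integrates sections over the first factor; maps that move the first
    coordinate need the other order. *)
Lemma product_measureC S : measurable S -> (m1 \x m2) S = (m1 \x^ m2) S.
Proof.
by move=> mS; apply: product_measure_unique => //= A B mA mB;
  rewrite product_measure2E.
Qed.

Lemma scales_skewl (h : T2 -> T1 -> T1) (c : R) :
  measurable_fun setT (fun z => h z.2 z.1) ->
  (0 <= c)%R -> (forall y, scales m1 (h y) c) ->
  scales (m1 \x m2) (fun z => (h z.2 z.1, z.2)) c.
Proof.
move=> mh c0 hs; have mphi : measurable_fun setT (fun z => (h z.2 z.1, z.2)).
  exact: measurable_fun_pair.
split=> // S mS; rewrite [LHS]product_measureC; last first.
  by rewrite -[X in measurable X]setTI; exact: mphi.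
rewrite [X in _ = _ * X]product_measureC//.
rewrite /product_measure2 -ge0_integralZl//; last first.
  exact: measurable_fun_ysection.
apply: eq_integral => y _ /=; have [_ <-] := hs y; last exact: measurable_ysection.
by congr (m1 _); apply/seteqP; split => x /=; rewrite /ysection /= !inE.
Qed.

End SkewProduct.

Section AffineMaps.
Context (R : realType).
Local Notation mR := (measurableTypeR R).
Local Notation mu := (@lebesgue_measure R).

(** Uniqueness of Lebesgue measure, applied to [|a|] times the pushforward: only half-open intervals
    have to be checked. For [a < 0] the preimage is closed at the other end, which does not change
    its length. *)
Lemma lebesgue_scale (a b : R) : a != 0 ->
  scales mu (fun z : mR => a * z + b : mR) `|a|^-1.
Proof.
move=> a0; pose phi := fun z : mR => a * z + b : mR.
have ma : measurable_fun setT phi.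
  by apply: measurable_funD => //; apply: measurable_funM.
split=> // S mS; rewrite -/phi.
have an : (0 < `|a|) by rewrite normr_gt0.
have E : (mu S = `|a|%:E * mu (phi @^-1` S))%E.
  pose nu := mscale (NngNum (normr_ge0 a)) (pushforward mu phi).
  apply: (@lebesgue_measure_unique R (nu ma) _ S) => // X [[p q] _ <-].
  rewrite /nu /= /mscale /= /pushforward lebesgue_measure_itv/= lte_fin.
  have [a1|a1] := ltP 0 a.
    rewrite [X in mu X](_ : _ = `](p - b) / a, (q - b) / a]%classic).
      rewrite lebesgue_measure_itv/= lte_fin ltr_pM2r ?invr_gt0// ltrD2r.
      case: ifPn => pq; last by rewrite mule0.
      by rewrite -!EFinD -EFinM gtr0_norm//; congr EFin; field; rewrite gt_eqF.
    apply/seteqP; split => z /=; rewrite !in_itv/= ltr_pdivrMr// ler_pdivlMr//;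
      by rewrite ltrBlDr lerBrDr mulrC.
  have {a1} a1 : a < 0 by rewrite lt_neqAle a0.
  rewrite [X in mu X](_ : _ = `[(q - b) / a, (p - b) / a[%classic).
    rewrite lebesgue_measure_itv/= lte_fin ltr_nM2r ?invr_lt0// ltrD2r.
    case: ifPn => pq; last by rewrite mule0.
    by rewrite -!EFinD -EFinM ltr0_norm//; congr EFin; field; rewrite lt_eqF.
  apply/seteqP; split => z /=; rewrite !in_itv/= ltr_ndivlMr// ler_ndivrMr//;
    by rewrite ltrBlDr lerBrDr mulrC andbC.
transitivity ((`|a|^-1)%:E * (`|a|%:E * mu (phi @^-1` S)))%E; last by rewrite -E.
by rewrite muleA -EFinM mulVf ?gt_eqF// mul1e.
Qed.

Local Notation R2 := (mR * mR)%type.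
Local Notation R3 := (mR * mR * mR)%type.

Definition aff2 (a b c d e f : R) (w : R2) : R2 :=
  (a * w.1 + b * w.2 + e : mR, c * w.1 + d * w.2 + f : mR).

Lemma scales_lower2 (a b e : R) : a != 0 ->
  scales (@leb2 R) (aff2 a b 0 1 e 0) `|a|^-1.
Proof.
move=> a0; rewrite (_ : aff2 _ _ _ _ _ _ =
    fun w => (a * w.1 + (b * w.2 + e) : mR, w.2)); last first.
  by apply/funext => -[x y]; congr pair; rewrite /=; ring.
apply: (@scales_skewl _ _ mR mR R mu mu (fun y x => a * x + (b * y + e) : mR)) => //=.
- apply: measurable_funD; first exact: measurable_funM.
  by apply: measurable_funD => //; exact: measurable_funM.
- by move=> y; exact: lebesgue_scale.
Qed.

Lemma scales_upper2 (c d f : R) : d != 0 ->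
  scales (@leb2 R) (aff2 1 0 c d 0 f) `|d|^-1.
Proof.
move=> d0; rewrite (_ : aff2 _ _ _ _ _ _ =
    fun w => (w.1, d * w.2 + (c * w.1 + f) : mR)); last first.
  by apply/funext => -[x y]; congr pair; rewrite /=; ring.
apply: (@scales_skewr _ _ mR mR R mu mu (fun x y => d * y + (c * x + f) : mR)) => //=.
- apply: measurable_funD; first exact: measurable_funM.
  by apply: measurable_funD => //; exact: measurable_funM.
- by move=> y; exact: lebesgue_scale.
Qed.

(* A product of two triangular maps, after a shear if the pivot vanishes. *)
Lemma scales_aff2 (a b c d e f : R) : a * d - b * c != 0 ->
  scales (@leb2 R) (aff2 a b c d e f) `|a * d - b * c|^-1.
Proof.
have piv a' b' c' d' : a' != 0 -> a' * d' - b' * c' != 0 ->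
    scales (@leb2 R) (aff2 a' b' c' d' e f) `|a' * d' - b' * c'|^-1.
  move=> a0 h; have A0 : d' - c' / a' * b' != 0.
    by apply: contra_neq h => A0; rewrite -[RHS](mulr0 a') -A0; field.
  have := scales_comp (scales_lower2 b' e a0) (scales_upper2 (c' / a') (f - c' / a' * e) A0).
  rewrite -invfM -normrM.
  congr scales; last by congr (`|_|^-1); field.
  by apply/funext => -[x y]; congr pair; rewrite /=; field.
move=> h; have [a0|] := eqVneq a 0; last by move=> a0; exact: piv.
have b0 : b != 0 by apply: contra_neq h => b0; rewrite a0 b0; ring.
subst a; have := @piv (0 - b) b (c - d) d; rewrite sub0r oppr_eq0 => /(_ b0).
have -> : - b * d - b * (c - d) = 0 * d - b * c by ring.
move=> /(_ h) hs.
have := scales_comp (scales_upper2 1 0 (oner_neq0 R)) hs.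
rewrite normr1 invr1 mul1r; congr scales.
by apply/funext => -[x y]; congr pair; rewrite /=; ring.
Qed.

HB.instance Definition _ := Measure.on (@leb2 R).

Lemma leb2_sigma_finite : sigma_finite setT (@leb2 R).
Proof.
have /sigma_finiteP[F [TF ndF Foo]] := sigma_finiteT mu.
exists (fun n => F n `*` F n).
  rewrite -setXTT TF predeqE => -[x y]; split.
    move=> [/= [n _ Fnx] [k _ Gky]]; exists (maxn n k) => //; split.
    - by move: x Fnx; exact/subsetPset/ndF/leq_maxl.
    - by move: y Gky; exact/subsetPset/ndF/leq_maxr.
  by move=> [n _ []/= ? ?]; split; exists n.
move=> k; have [? ?] := Foo k; split; first exact: measurableX.
by rewrite /leb2 product_measure1E// lte_mul_pinfty// ge0_fin_numE.
Qed.

HB.instance Definition _ :=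
  Measure_isSigmaFinite.Build _ _ _ (@leb2 R) leb2_sigma_finite.

HB.instance Definition _ := Measure.on (@leb3 R).

Definition aff3 (a1 a2 a3 b1 b2 b3 c1 c2 c3 e f g : R) (w : R3) : R3 :=
  (a1 * w.1.1 + a2 * w.1.2 + a3 * w.2 + e : mR,
   b1 * w.1.1 + b2 * w.1.2 + b3 * w.2 + f : mR,
   c1 * w.1.1 + c2 * w.1.2 + c3 * w.2 + g : mR).

Lemma scales_plane3 (a1 a2 a3 b1 b2 b3 e f : R) : a1 * b2 - a2 * b1 != 0 ->
  scales (@leb3 R) (aff3 a1 a2 a3 b1 b2 b3 0 0 1 e f 0) `|a1 * b2 - a2 * b1|^-1.
Proof.
move=> a0; rewrite (_ : aff3 _ _ _ _ _ _ _ _ _ _ _ _ =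
    fun w => (aff2 a1 a2 b1 b2 (a3 * w.2 + e) (b3 * w.2 + f) w.1, w.2)); last first.
  apply/funext => -[[x y] z]; rewrite /aff3 /aff2 /=.
  by congr (_, _, _); ring.
apply: (@scales_skewl _ _ R2 mR R (@leb2 R) mu
  (fun z => aff2 a1 a2 b1 b2 (a3 * z + e) (b3 * z + f))) => //=.
- apply: measurable_fun_pair => /=.
  + apply: measurable_funD; last by apply: measurable_funD => //; exact: measurable_funM.
    apply: measurable_funD; apply: measurable_funM => //;
    apply: measurableT_comp => //.
  + apply: measurable_funD; last by apply: measurable_funD => //; exact: measurable_funM.
    apply: measurable_funD; apply: measurable_funM => //;
    apply: measurableT_comp => //.
- by move=> y; exact: scales_aff2.
Qed.

Lemma scales_line3 (c1 c2 c3 g : R) : c3 != 0 ->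
  scales (@leb3 R) (aff3 1 0 0 0 1 0 c1 c2 c3 0 0 g) `|c3|^-1.
Proof.
move=> c0; rewrite (_ : aff3 _ _ _ _ _ _ _ _ _ _ _ _ =
    fun w => (w.1, c3 * w.2 + (c1 * w.1.1 + c2 * w.1.2 + g) : mR)); last first.
  apply/funext => -[[x y] z]; rewrite /aff3 /=.
  by congr (_, _, _); ring.
apply: (@scales_skewr _ _ R2 mR R (@leb2 R) mu
  (fun xy z => c3 * z + (c1 * xy.1 + c2 * xy.2 + g) : mR)) => //=.
- apply: measurable_funD; first exact: measurable_funM.
  apply: measurable_funD => //; apply: measurable_funD; apply: measurable_funM => //;
    exact: measurableT_comp.
- by move=> y; exact: lebesgue_scale.
Qed.

Definition det3 (a1 a2 a3 b1 b2 b3 c1 c2 c3 : R) : R :=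
  a1 * (b2 * c3 - b3 * c2) - a2 * (b1 * c3 - b3 * c1) + a3 * (b1 * c2 - b2 * c1).

(* Again triangular factors, now with a 2x2 block as pivot; the parameters [p]
   and [q] of the preliminary shear make that block invertible. *)
Lemma scales_aff3 (a1 a2 a3 b1 b2 b3 c1 c2 c3 e f g : R) :
  det3 a1 a2 a3 b1 b2 b3 c1 c2 c3 != 0 ->
  scales (@leb3 R) (aff3 a1 a2 a3 b1 b2 b3 c1 c2 c3 e f g)
    `|det3 a1 a2 a3 b1 b2 b3 c1 c2 c3|^-1.
Proof.
have piv x1 x2 x3 y1 y2 y3 z1 z2 z3 : x1 * y2 - x2 * y1 != 0 ->
    det3 x1 x2 x3 y1 y2 y3 z1 z2 z3 != 0 ->
    scales (@leb3 R) (aff3 x1 x2 x3 y1 y2 y3 z1 z2 z3 e f g)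
      `|det3 x1 x2 x3 y1 y2 y3 z1 z2 z3|^-1.
  move=> D0 h; pose D := x1 * y2 - x2 * y1.
  pose B := (z1 * y2 - z2 * y1) / D; pose C := (x1 * z2 - x2 * z1) / D.
  have A0 : z3 - B * x3 - C * y3 != 0.
    apply: contra_neq h => A0; rewrite -[RHS](mulr0 D) -A0 /det3 /B /C /D.
    by field.
  have := scales_comp (scales_plane3 x3 y3 e f D0)
    (scales_line3 B C (g - B * e - C * f) A0).
  rewrite -invfM -normrM.
  congr scales; last by congr (`|_|^-1); rewrite /det3 /B /C /D; field.
  apply/funext => -[[x y] z]; rewrite /aff3 /=.
  by congr (_, _, _); rewrite /B /C /D; field.
move=> h; have [D0|] := eqVneq (a1 * b2 - a2 * b1) 0; last by move=> D0; exact: piv.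
(* With [D1] and [D3] the other two minors of the first two rows, the new minor is
   [D0 - q * D1 + p * D3]. By expansion along the third row the three minors cannot all vanish. *)
have [p [q pq]] : exists p q : R,
    (a1 - p * a3) * (b2 - q * b3) - (a2 - q * a3) * (b1 - p * b3) != 0.
  have [D1|D1] := eqVneq (a1 * b3 - a3 * b1) 0; last first.
    exists 0, 1; apply: contra_neq D1 => D1.
    by rewrite -[RHS]oppr0 -[in RHS]D1 -[LHS]subr0 -[in LHS]D0; ring.
  exists 1, 0; apply: contra_neq h => D2.
  have D3 : a2 * b3 - a3 * b2 = 0.
    by rewrite -[RHS]D2 -[LHS]addr0 -[in LHS]D0; ring.
  have -> : det3 a1 a2 a3 b1 b2 b3 c1 c2 c3 = c1 * (a2 * b3 - a3 * b2)
     - c2 * (a1 * b3 - a3 * b1) + c3 * (a1 * b2 - a2 * b1) by rewrite /det3; ring.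
  by rewrite D0 D1 D3; ring.
have := piv (a1 - p * a3) (a2 - q * a3) a3 (b1 - p * b3) (b2 - q * b3) b3
  (c1 - p * c3) (c2 - q * c3) c3 pq.
have -> : det3 (a1 - p * a3) (a2 - q * a3) a3 (b1 - p * b3) (b2 - q * b3) b3
  (c1 - p * c3) (c2 - q * c3) c3 = det3 a1 a2 a3 b1 b2 b3 c1 c2 c3.
  by rewrite /det3; ring.
move=> /(_ h) hs.
have := scales_comp (scales_line3 p q 0 (oner_neq0 R)) hs.
rewrite normr1 invr1 mul1r; congr scales.
by apply/funext => -[[x y] z]; rewrite /aff3 /=; congr (_, _, _); ring.
Qed.

End AffineMaps.

(** * Points, open sets and polynomial functions *)

Section Points.
Context (R : realType).
Local Notation vec := 'rV[R]_3.
Local Notation mR := (measurableTypeR R).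
Local Notation mu := (@lebesgue_measure R).
Local Notation R3 := (mR * mR * mR)%type.

Lemma pt3E0 (t : R3) : pt3 t 0 0 = t.1.1. Proof. by rewrite mxE. Qed.
Lemma pt3E1 (t : R3) : pt3 t 0 1 = t.1.2. Proof. by rewrite mxE. Qed.
Lemma pt3E2 (t : R3) : pt3 t 0 2 = t.2. Proof. by rewrite mxE. Qed.
Definition pt3E := (pt3E0, pt3E1, pt3E2).

Lemma ord3P (P : 'I_3 -> Prop) : P 0 -> P 1 -> P 2 -> forall i, P i.
Proof.
move=> P0 P1 P2 [[|[|[|//]]] h]; [move: P0|move: P1|move: P2];
by congr P; apply: val_inj.
Qed.

Lemma sum3 (V : nmodType) (F : 'I_3 -> V) : \sum_i F i = F 0 + F 1 + F 2.
Proof.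
rewrite !big_ord_recr big_ord0 /= add0r.
by congr (F _ + F _ + F _); apply: val_inj.
Qed.

Lemma sum4 (V : nmodType) (F : 'I_4 -> V) : \sum_i F i = F 0 + F 1 + F 2 + F 3.
Proof.
rewrite !big_ord_recr big_ord0 /= add0r.
by congr (F _ + F _ + F _ + F _); apply: val_inj.
Qed.

Lemma vec3P (x y : vec) : x 0 0 = y 0 0 -> x 0 1 = y 0 1 -> x 0 2 = y 0 2 -> x = y.
Proof. by move=> h0 h1 h2; apply/rowP; exact: ord3P. Qed.

Lemma measurable_pt3 i : measurable_fun setT (fun t : R3 => pt3 t 0 i : mR).
Proof.
elim/ord3P: i; under eq_fun do rewrite pt3E; first exact: measurableT_comp.
- exact: measurableT_comp.
- exact: measurable_snd.
Qed.

Definition box (a b : 'I_3 -> R) : set R3 :=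
  (`]a 0, b 0[%classic `*` `]a 1, b 1[%classic) `*` `]a 2, b 2[%classic.

Lemma boxP a b t : box a b t <-> forall i, a i < pt3 t 0 i < b i.
Proof.
split=> [[[]]|h]; rewrite /= ?in_itv/=; last first.
  by move: (h 0) (h 1) (h 2); rewrite !pt3E; split => //; split => /=; rewrite in_itv.
by move=> h0 h1 h2; elim/ord3P; rewrite pt3E.
Qed.

Lemma measurable_box a b : measurable (box a b).
Proof. by apply: measurableX; [apply: measurableX|]; exact: measurable_itv. Qed.

Lemma leb3_box a b : leb3 (box a b) = (mu `]a 0%R, b 0%R[ * mu `]a 1%R, b 1%R[ * mu `]a 2%R, b 2%R[)%E.
Proof.
rewrite /leb3 /box product_measure1E//; last exact: measurableX.
by congr (_ * _)%E; exact: product_measure1E.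
Qed.

Lemma leb3_box_gt0 a b : (forall i, a i < b i) -> (0 < leb3 (box a b))%E.
Proof.
move=> ab; rewrite leb3_box !lebesgue_measure_itv/= !lte_fin !ab -!EFinD -!EFinM lte_fin.
by rewrite !mulr_gt0// subr_gt0.
Qed.

Lemma leb3_box_lty a b : (leb3 (box a b) < +oo)%E.
Proof.
rewrite leb3_box !lebesgue_measure_itv/=.
by do 3?case: ifPn => _; rewrite -?EFinD ?mule0 ?mul0e -?EFinM ?ltry.
Qed.

Lemma open_subbox (O : set vec) (x : vec) : open O -> O x ->
  exists a b : {ffun 'I_3 -> rat},
   (forall i, ratr (a i) < x 0 i < ratr (b i)) /\
   forall y : vec, (forall i, ratr (a i) < y 0 i < ratr (b i)) -> O y.
Proof.
rewrite openE => Oo /Oo /nbhs_ballP[e /= e0 xe].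
have /choice[a ha] : forall i, exists q : rat, x 0 i - e < ratr q < x 0 i.
  move=> i; have [|q] := @rat_in_itvoo R (x 0 i - e) (x 0 i).
    by rewrite ltrBlDr ltrDl.
  by rewrite in_itv/= => hq; exists q.
have /choice[b hb] : forall i, exists q : rat, x 0 i < ratr q < x 0 i + e.
  move=> i; have [|q] := @rat_in_itvoo R (x 0 i) (x 0 i + e).
    by rewrite ltrDl.
  by rewrite in_itv/= => hq; exists q.
exists [ffun i => a i], [ffun i => b i]; split => [i|y hy].
  by rewrite !ffunE; have /andP[_ ->] := ha i; have /andP[-> _] := hb i.
apply: xe; split=> // i j; rewrite ord1 /ball/= ltr_norml.
have := hy j; rewrite !ffunE; have := ha j; have := hb j.
by move=> /andP[? ?] /andP[? ?] /andP[? ?]; apply/andP; split; lra.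
Qed.

(** Only countably many boxes have rational corners, so an open set is a countable union of
    measurable boxes; this links the topology of row vectors to the product sigma-algebra. *)
Lemma measurable_open (O : set vec) : open O -> measurable (@pt3 R @^-1` O).
Proof.
move=> Oo; pose I : countType := ({ffun 'I_3 -> rat} * {ffun 'I_3 -> rat})%type.
pose F (q : I) := box (ratr \o q.1) (ratr \o q.2).
pose G q := if `[< F q `<=` @pt3 R @^-1` O >] then F q else set0.
rewrite (_ : _ @^-1` _ = \bigcup_q G q).
  apply: countable_bigcupT_measurable; first exact: countableP.
  by move=> q; rewrite /G; case: ifP => // _; exact: measurable_box.
apply/seteqP; split => [t Ot|t [q _]]; last first.
  by rewrite /G; case: ifPn => // /asboolP h; exact: h.
have [a [b [h1 h2]]] := open_subbox Oo Ot.
exists (a, b) => //; rewrite /G ifT; first exact/boxP.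
by apply/asboolP => s /boxP; exact: h2.
Qed.

Lemma open_leb3_gt0 (O : set vec) : open O -> O !=set0 ->
  (0 < leb3 (@pt3 R @^-1` O))%E.
Proof.
move=> Oo [x Ox]; have [a [b [h1 h2]]] := open_subbox Oo Ox.
apply: (@lt_le_trans _ _ (leb3 (box (ratr \o a) (ratr \o b)))).
  by apply: leb3_box_gt0 => i; have /andP[] := h1 i; exact: lt_trans.
apply: le_measure; rewrite ?inE.
- exact: measurable_box.
- exact: measurable_open.
- by move=> t /boxP; exact: h2.
Qed.

Lemma coord_le_norm (x : vec) i : `|x 0 i| <= `|x|.
Proof. rewrite [leRHS](mx_normrE x); exact: (le_bigmax _ (fun ij => `|x ij.1 ij.2|) (0, i)). Qed.

Lemma bounded_setP (D : set vec) : bounded_set D ->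
  exists M, forall x, D x -> forall i, `|x 0 i| <= M.
Proof.
move=> [M [_ /(_ (M + 1))]]; rewrite ltrDl ltr01 => /(_ isT)/= h.
by exists (M + 1) => x Dx i; apply: le_trans (h _ Dx); exact: coord_le_norm.
Qed.

Lemma bounded_leb3_lty (D : set vec) : measurable (@pt3 R @^-1` D) ->
  bounded_set D -> (leb3 (@pt3 R @^-1` D) < +oo)%E.
Proof.
move=> mD /bounded_setP [M hM].
apply: (@le_lt_trans _ _ (leb3 (box (fun=> - (M + 1)) (fun=> M + 1)))).
  apply: le_measure; rewrite ?inE => //; first exact: measurable_box.
  move=> t /hM tM; apply/boxP => i; rewrite -ltr_norml.
  by apply: le_lt_trans (tM i) _; rewrite ltrDl.
exact: leb3_box_lty.
Qed.

End Points.

Section PolynomialFunctions.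
Context (R : realType).
Local Notation vec := 'rV[R]_3.
Local Notation mR := (measurableTypeR R).
Local Notation poly3 := (mpoly 3 R).
Implicit Types (P Q : poly3) (x v : vec).

Definition ev P x : R := meval (x 0) P.
Definition var (i : 'I_3) : poly3 := mpolyX R (mnm1 i).

Lemma evC c x : ev (mpolyC 3 c) x = c. Proof. exact: mevalC. Qed.
Lemma ev_var i x : ev (var i) x = x 0 i. Proof. exact: mevalXU. Qed.
Lemma evD P Q x : ev (P + Q) x = ev P x + ev Q x. Proof. exact: mevalD. Qed.
Lemma evB P Q x : ev (P - Q) x = ev P x - ev Q x. Proof. exact: mevalB. Qed.
Lemma evM P Q x : ev (P * Q) x = ev P x * ev Q x. Proof. exact: mevalM. Qed.
Lemma evZ c P x : ev (c *: P) x = c * ev P x. Proof. exact: mevalZ. Qed.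
Lemma ev0 x : ev 0 x = 0. Proof. exact: meval0. Qed.
Lemma ev_sum (I : Type) (r : seq I) (p : pred I) (F : I -> poly3) x :
  ev (\sum_(i <- r | p i) F i) x = \sum_(i <- r | p i) ev (F i) x.
Proof. exact: raddf_sum. Qed.

Lemma poly3_ind (S : poly3 -> Prop) :
  (forall c, S (mpolyC 3 c)) -> (forall i, S (var i)) ->
  (forall P Q, S P -> S Q -> S (P + Q)) ->
  (forall P Q, S P -> S Q -> S (P * Q)) -> forall P, S P.
Proof.
move=> SC Sv SD SM; elim/mpolyind => [|c m P _ _ SP]; first exact: SC 0.
apply: (SD) => //; rewrite -mul_mpolyC; apply: (SM) => //.
rewrite mpolyXE_id; apply: (big_ind S); [exact: SC 1|exact: SM|move=> i _].
by elim: (m i) => [|k IH]; [exact: SC 1|rewrite exprS; apply: SM => //; exact: Sv].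
Qed.

Lemma ev_continuous P : continuous (ev P).
Proof.
elim/poly3_ind: P => [c|i|P Q hP hQ|P Q hP hQ] x.
- by rewrite (funext (evC c)); exact: cst_continuous.
- by rewrite (funext (ev_var i)); exact: coord_continuous.
- by rewrite (funext (evD P Q)); apply: continuousD; [exact: hP|exact: hQ].
- by rewrite (funext (evM P Q)); apply: continuousM; [exact: hP|exact: hQ].
Qed.

Lemma measurable_ev P : measurable_fun setT (ev P \o @pt3 R : _ -> mR).
Proof.
elim/poly3_ind: P => [c|i|P Q hP hQ|P Q hP hQ].
- by rewrite (funext (evC c)); exact: measurable_cst.
- by rewrite (funext (ev_var i)); exact: measurable_pt3.
- by rewrite (funext (evD P Q)); exact: measurable_funD.
- by rewrite (funext (evM P Q)); exact: measurable_funM.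
Qed.

Definition ev_deriv P x v : R := \sum_(i < 3) v 0 i * ev (mderiv i P) x.

(** Links the formal [mderiv] with the analytic derivative in [pderiv]; the arbitrary direction [v]
    also serves the fundamental theorem of calculus along edges. *)
Lemma ev_is_derive P x v : is_derive x v (ev P) (ev_deriv P x v).
Proof.
elim/poly3_ind: P => [c|i|P Q hP hQ|P Q hP hQ].
- have -> : ev (mpolyC 3 c) = cst c by apply/funext => y; rewrite evC.
  have -> : ev_deriv (mpolyC 3 c) x v = 0.
    by rewrite /ev_deriv big1// => i _; rewrite mderivC ev0 mulr0.
  exact: is_derive_cst.
- have -> : ev (var i) = fun y : vec => y 0 i by apply/funext => y; rewrite ev_var.
  have H : (fun h => h^-1 *: ((h *: v + x) 0 i - x 0 i)) @ 0^' --> v 0 i.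
    apply: cvg_near_cst; near=> h; rewrite !mxE addrK scalerA mulVf ?scale1r//.
    by near: h; exact: nbhs_dnbhs_neq.
  have -> : ev_deriv (var i) x v = v 0 i.
    rewrite /ev_deriv (bigD1 i)//= big1 => [|j ji]; rewrite /var mderivX mnm1E.
      rewrite eqxx scale1r /ev mevalX big1 ?mulr1 ?addr0// => k _.
      by rewrite mnmBE subnn expr0.
    by rewrite eq_sym (negbTE ji) scale0r ev0 mulr0.
  by split; [apply/cvg_ex; exists (v 0 i)|exact: cvg_lim].
- have -> : ev (P + Q) = ev P + ev Q by apply/funext => y; rewrite evD.
  have -> : ev_deriv (P + Q) x v = ev_deriv P x v + ev_deriv Q x v.
    by rewrite /ev_deriv -big_split; apply: eq_bigr => i _; rewrite mderivD evD mulrDr.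
  exact: is_deriveD.
- have -> : ev (P * Q) = ev P * ev Q by apply/funext => y; rewrite evM.
  have -> : ev_deriv (P * Q) x v = ev P x *: ev_deriv Q x v + ev Q x *: ev_deriv P x v.
    rewrite /ev_deriv !scaler_sumr -big_split; apply: eq_bigr => i _.
    by rewrite mderivM evD !evM /GRing.scale/=; ring.
  exact: is_deriveM.
Unshelve. all: by end_near. Qed.

Lemma pderiv_ev i P x : pderiv i (ev P) x = ev (mderiv i P) x.
Proof.
rewrite /pderiv (@derive_val _ _ _ _ _ _ _ (ev_is_derive P x _)).
rewrite /ev_deriv (bigD1 i)//= big1 => [|j ji]; rewrite mxE.
  by rewrite !eqxx mul1r addr0.
by rewrite (negbTE ji) andbF mul0r.
Qed.

Lemma ev_line_derive P x v (t : R) :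
  is_derive t 1 (fun s : R => ev P (x + s *: v)) (ev_deriv P (x + t *: v) v).
Proof.
have [/cvg_ex[l hl] hd] := ev_is_derive P (x + t *: v) v.
have hlE : l = ev_deriv P (x + t *: v) v by rewrite -hd; exact/esym/cvg_lim.
rewrite hlE in hl.
have H : (fun h : R => h^-1 *: (ev P (x + (h *: 1 + t) *: v) - ev P (x + t *: v))) @ 0^' -->
    ev_deriv P (x + t *: v) v.
  apply: cvg_trans hl; apply: near_eq_cvg; apply: nearW => h /=.
  by rewrite [h *: 1]mulr1 scalerDl addrCA.
split; first by apply/cvg_ex; exists (ev_deriv P (x + t *: v) v).
exact: cvg_lim.
Qed.

(** [mmeasure mdeg] is one more than the degree, and 0 for the zero polynomial. Hence degree at most
    [m] reads [<= m.+1] throughout. *)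
Lemma mmeasure_mderiv i P :
  (mmeasure mdeg (mderiv i P) <= (mmeasure mdeg P).-1)%N.
Proof.
rewrite [leqLHS]mmeasureE; apply/bigmax_leqP_seq => m + _.
rewrite mcoeff_msupp mcoeff_mderiv => h.
have /mmeasure_mnm_lt : mnm_add m (mnm1 i) \in msupp P.
  by rewrite mcoeff_msupp; apply: contra_neq h => ->; rewrite mul0rn.
move=> /(_ mdeg)/=; rewrite mdegD mdeg1 addn1.
by case: (mmeasure mdeg P) => // k; rewrite ltnS.
Qed.

(** In characteristic zero, differentiating in a variable that occurs in the monomial [m] multiplies
    its coefficient by a nonzero integer. *)
Lemma mderiv_eq0_const P : (forall i, mderiv i P = 0) -> P = mpolyC 3 (mcoeff mnm0 P).
Proof.
move=> dP; apply/mpolyP => m; rewrite mcoeffC.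
case: eqVneq => [->|m0]; first by rewrite mulr1.
rewrite mulr0; have [i mi] : exists i, (0 < m i)%N.
  apply/not_existsP => h; move/negP: m0; apply; apply/eqP/mnmP => i.
  by rewrite mnm0E; apply/eqP; rewrite -leqn0 leqNgt; apply/negP/h.
have := congr1 (mcoeff (mnm_sub m (mnm1 i))) (dP i).
rewrite mcoeff_mderiv mcoeff0 submK.
  by move/eqP; rewrite mulrn_eq0/= => /eqP.
by apply/mnm_lepP => j; rewrite mnm1E; case: eqVneq => // <-.
Qed.

(** Induction on the degree: the partial derivatives vanish on [O] as well, so they are zero by
    induction and [P] is a constant with value 0. *)
Lemma poly_eq0 (O : set vec) P : open O -> O !=set0 ->
  (forall x, O x -> ev P x = 0) -> P = 0.
Proof.
move=> Oo [x0 Ox0]; have [n] := ubnP (mmeasure mdeg P).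
elim: n P => // n IH P hP h0.
have dP0 i : mderiv i P = 0.
  have [->|P0] := eqVneq P 0; first by rewrite mderiv0.
  apply: IH => [|x Ox]; last first.
    rewrite -pderiv_ev /pderiv (near_eq_derive (g := cst 0)) ?derive_cst//.
    by near=> y; apply: h0; near: y; exact: open_nbhs_nbhs.
  apply: leq_ltn_trans (mmeasure_mderiv i P) _; move: hP.
  by rewrite ltnS; apply: leq_trans; rewrite ltn_predL lt0n mmeasure_poly_eq0.
have E := mderiv_eq0_const dP0; have := h0 _ Ox0.
by rewrite [in ev _ _]E evC => c0; rewrite E c0 mpolyC0.
Unshelve. all: by end_near. Qed.

End PolynomialFunctions.

(** * Barycentric coordinates *)

Section Barycentric.
Context (R : realType).
Local Notation vec := 'rV[R]_3.
Implicit Types (V : 'M[R]_(4, 3)) (x y v : vec).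

(** Homogeneous coordinates: the column of ones makes the condition that the weights sum to 1 part
    of the linear system. *)
Definition hom_mx V : 'M[R]_(4, 1 + 3) := row_mx (const_mx 1) V.

(* The barycentric coordinates of [x] solve [lam *m hom_mx V = (1, x)]. *)
Definition lam V (i : 'I_4) x : R :=
  (row_mx (1%:M : 'M[R]_1) x *m invmx (hom_mx V : 'M[R]_4)) 0 i.

(** A row in the kernel has weights of sum zero, so its last three weights combine the edge vectors
    at vertex 0 to zero. *)
Lemma hom_mx_unit V : nondegenerate V -> (hom_mx V : 'M[R]_4) \in unitmx.
Proof.
move=> /row_freeP [B hB]; rewrite -row_free_unit -kermx_eq0; apply/rowV0P => w.
move=> /sub_kermxP h; have : w *m row_mx (const_mx 1 : 'cV_4) V = 0 by exact: h.
rewrite mul_mx_row -[0]row_mx0 => /eq_row_mx[h1 h2].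
have hs : w 0 0 = - \sum_(j < 3) w 0 (lift ord0 j).
  move/rowP: h1 => /(_ 0); rewrite !mxE big_ord_recl /= !mxE mulr1 => /eqP.
  by rewrite addr_eq0 => /eqP ->; congr (- _); apply: eq_bigr => j _; rewrite mxE mulr1.
pose u : 'rV[R]_3 := \row_j w 0 (lift ord0 j).
have u0 : u *m (\matrix_(i < 3) (row (lift ord0 i) V - row ord0 V)) = 0.
  apply/rowP => j; rewrite !mxE; move/rowP: h2 => /(_ j); rewrite !mxE => h2.
  under eq_bigr do rewrite !mxE mulrBr.
  rewrite sumrB -mulr_suml -[X in _ - X]opprK -mulNr -hs opprK.
  by rewrite -[RHS]h2 [RHS]big_ord_recl /= addrC.
have {}u0 : u = 0 by rewrite -[u]mulmx1 -hB mulmxA u0 mul0mx.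
have uE j : w 0 (lift ord0 j) = 0 by move/rowP: u0 => /(_ j); rewrite !mxE.
rewrite row_mx0; apply/rowP => i; rewrite mxE; case: (unliftP ord0 i) => [j|] ->; first exact: uE.
by rewrite hs big1 ?oppr0.
Qed.

Section Nondegenerate.
Variable V : 'M[R]_(4, 3).
Hypothesis hV : nondegenerate V.

Lemma lamK x : (\row_i lam V i x) *m hom_mx V = row_mx (1%:M : 'M[R]_1) x.
Proof.
have -> : \row_i lam V i x = row_mx (1%:M : 'M[R]_1) x *m invmx (hom_mx V : 'M[R]_4).
  by apply/rowP => i; rewrite mxE.
by rewrite mulmxKV// hom_mx_unit.
Qed.

Lemma lam_sum x : \sum_i lam V i x = 1.
Proof.
have := lamK x; rewrite /hom_mx mul_mx_row => /eq_row_mx[/rowP/(_ 0) + _].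
rewrite !mxE eqxx [1 *+ _]/= => h; rewrite -[RHS]h.
by apply: eq_bigr => i _; rewrite !mxE mulr1.
Qed.

Lemma lam_comb x : (\row_i lam V i x) *m V = x.
Proof. by have := lamK x; rewrite /hom_mx mul_mx_row => /eq_row_mx[_]. Qed.

Lemma lam_uniq (w : 'rV[R]_4) i : \sum_j w 0 j = 1 -> lam V i (w *m V) = w 0 i.
Proof.
move=> hw; rewrite /lam.
have -> : row_mx (1%:M : 'M[R]_1) (w *m V) = w *m hom_mx V.
  rewrite /hom_mx mul_mx_row; congr row_mx; apply/rowP => j; rewrite !mxE ord1 eqxx.
  by rewrite -[LHS]hw; apply: eq_bigr => k _; rewrite mxE mulr1.
by rewrite mulmxK// hom_mx_unit.
Qed.

Lemma lam_vertex i j : lam V i (row j V) = (i == j)%:R.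
Proof.
rewrite rowE lam_uniq; first by rewrite mxE eqxx.
rewrite (bigD1 j)//= big1 ?mxE ?eqxx ?addr0// => k /negbTE kj.
by rewrite mxE kj andbF.
Qed.

End Nondegenerate.

Lemma lamE V i x : lam V i x = invmx (hom_mx V : 'M[R]_4) 0 i +
  \sum_(j < 3) x 0 j * invmx (hom_mx V : 'M[R]_4) (lift ord0 j) i.
Proof.
rewrite /lam mxE big_ord_recl; congr (_ + _).
  rewrite -[RHS]mul1r; congr (_ * _);
  have := row_mxEl (1%:M : 'M[R]_1) x 0 0; rewrite [1%:M _ _]mxE eqxx => E; rewrite -[RHS]E.
  by congr (row_mx _ _ _ _); exact: val_inj.
apply: eq_bigr => j _; congr (_ * _); rewrite -(row_mxEr (1%:M : 'M[R]_1) x 0 j).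
by congr (row_mx _ _ _ _); exact: val_inj.
Qed.

Lemma lam_line V i x y (t : R) :
  lam V i (x + t *: (y - x)) = lam V i x + t * (lam V i y - lam V i x).
Proof.
rewrite !lamE opprD addrACA subrr add0r -addrA; congr (_ + _).
rewrite -sumrB mulr_sumr -big_split; apply: eq_bigr => j _; rewrite !mxE /=; ring.
Qed.

Definition lampoly V i : mpoly 3 R :=
  mpolyC 3 (invmx (hom_mx V : 'M[R]_4) 0 i) +
  \sum_(j < 3) invmx (hom_mx V : 'M[R]_4) (lift ord0 j) i *: var R j.

Lemma ev_lampoly V i x : ev (lampoly V i) x = lam V i x.
Proof.
rewrite lamE evD evC ev_sum; congr (_ + _); apply: eq_bigr => j _.
by rewrite evZ ev_var mulrC.
Qed.

Lemma lam_continuous V i : continuous (lam V i).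
Proof. by rewrite -(funext (ev_lampoly V i)); exact: ev_continuous. Qed.

Lemma simplexP V (A : {set 'I_4}) x : nondegenerate V ->
  simplex V A x <-> (forall i, 0 <= lam V i x) /\ (forall i, i \notin A -> lam V i x = 0).
Proof.
move=> hV; split=> [[w [w0 wA w1 ->]]|[h0 hA]].
  by split=> i; rewrite lam_uniq//; exact: wA.
exists (\row_i lam V i x); split.
- by move=> i; rewrite mxE.
- by move=> i iA; rewrite mxE hA.
- by under eq_bigr do rewrite mxE; exact: lam_sum.
- by rewrite lam_comb.
Qed.

(** For a nondegenerate [V] this is the interior of the tetrahedron ([tet_interior]), given by
    strict inequalities between continuous functions. *)
Definition otet V : set vec := [set x | forall i, 0 < lam V i x].

Lemma otet_open V : open (otet V).
Proof.
rewrite openE => x xo; change (nbhs x (fun y => forall i, 0 < lam V i y)).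
apply: (@filter_forall _ _ (fun i y => 0 < lam V i y) _ (nbhs_filter x)) => i.
by apply: (cvgr_gt (lam V i x)); [exact: lam_continuous|exact: xo].
Qed.

Lemma near_line (P : set vec) x v : nbhs x P -> \forall t \near 0^'+, P (x + (t : R) *: v).
Proof.
move=> Px; have : (fun t : R => x + t *: v) @ 0^'+ --> x.
  apply: cvg_at_right_filter; rewrite -[X in _ --> X]addr0 -(scale0r v).
  by apply: cvgD; [exact: cvg_cst|apply: cvgZr_tmp; exact: cvg_id].
by move=> /(_ _ Px).
Qed.

Lemma otet_sub V : nondegenerate V -> otet V `<=` simplex V [set: 'I_4]%SET.
Proof. by move=> hV x xo; apply/simplexP => //; split=> i; rewrite ?inE// ltW. Qed.

Lemma tet_interior V : nondegenerate V -> (simplex V [set: 'I_4]%SET)° = otet V.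
Proof.
move=> hV; apply/seteqP; split=> x.
  move=> xi i; rewrite lt_neqAle eq_sym.
  have [/(_ i) x0 _] := (simplexP _ x hV).1 (interior_subset xi).
  rewrite x0 andbT; apply/eqP => xi0.
  (* Moving away from vertex [i] would make a vanishing [lam V i] negative at once. *)
  have : \forall t \near 0^'+, 0 <= lam V i (x + (t : R) *: (x - row i V)).
    apply: (@near_line (fun z => 0 <= lam V i z)); apply: filterS xi => z /simplexP[]// h _; exact: h.
  move=> /(filterI (nbhs_right_gt (0:R)))/filter_ex[t [/= t0]].
  rewrite -opprB scalerN -scaleNr lam_line lam_vertex// xi0 eqxx add0r subr0 mulr1.
  by rewrite oppr_ge0 leNgt t0.
move=> xo; apply: filterS (otet_sub hV) _.
by apply: open_nbhs_nbhs; split=> //; exact: otet_open.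
Qed.

Lemma otet_neq0 V : nondegenerate V -> otet V !=set0.
Proof.
move=> hV; exists (const_mx 4^-1 *m V) => i; rewrite lam_uniq//; first by rewrite mxE.
by rewrite (eq_bigr (fun=> 4^-1)) ?sumr_const ?card_ord ?mxE// => [|j _]; rewrite ?mxE//; field.
Qed.

Lemma tet_line V x y (t : R) : nondegenerate V -> 0 < t <= 1 ->
  simplex V [set: 'I_4]%SET x -> otet V y -> otet V (x + t *: (y - x)).
Proof.
move=> hV /andP[t0 t1] /simplexP[]// x0 _ yo i; rewrite lam_line.
have -> : lam V i x + t * (lam V i y - lam V i x) = (1 - t) * lam V i x + t * lam V i y by ring.
by rewrite ltr_wpDl ?mulr_gt0// mulr_ge0// subr_ge0.
Qed.

Lemma tet_closure V x : nondegenerate V ->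
  simplex V [set: 'I_4]%SET x -> closure (otet V) x.
Proof.
move=> hV xT; have [c co] := otet_neq0 hV => B /(near_line (c - x)) hB.
have [t [/= tB]] : exists t : R, B (x + t *: (c - x)) /\ 0 < t < 1.
  apply: (@filter_ex _ 0^'+); apply: filterI => //.
  by near=> t; apply/andP; split; near: t; [exact: nbhs_right_gt|exact: nbhs_right_lt].
move=> /andP[t0 t1]; exists (x + t *: (c - x)); split => //.
by apply: tet_line => //; rewrite t0 ltW.
Unshelve. all: by end_near. Qed.

End Barycentric.

(** * Integrals of polynomials against a weight *)

Section WeightedIntegral.
Context d (T : measurableType d) (R : realType).
Variables (mu : {measure set T -> \bar R}) (D : set T) (X : T -> 'rV[R]_3).
Hypothesis mD : measurable D.
Hypothesis mX : forall i, measurable_fun D (fun t => X t 0 i : measurableTypeR R).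
Hypothesis bX : exists M : R, forall t, D t -> forall i, `|X t 0 i| <= M.
Implicit Types (g : T -> R) (P Q : mpoly 3 R).

Lemma measurable_evX P : measurable_fun D (ev P \o X : _ -> measurableTypeR R).
Proof.
elim/poly3_ind: P => [c|i|P Q hP hQ|P Q hP hQ].
- by rewrite (funext (evC c)); exact: measurable_cst.
- by rewrite (funext (ev_var i)); exact: mX.
- by rewrite (funext (evD P Q)); exact: measurable_funD.
- by rewrite (funext (evM P Q)); exact: measurable_funM.
Qed.

Lemma bounded_evX P : exists C, forall t, D t -> `|ev P (X t)| <= C.
Proof.
have [M hM] := bX; elim/poly3_ind: P => [c|i|P Q [B hB] [C hC]|P Q [B hB] [C hC]].
- by exists `|c| => t _; rewrite evC.
- by exists M => t /hM; rewrite ev_var.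
- by exists (B + C) => t Dt; rewrite evD (le_trans (ler_normD _ _))// lerD ?hB ?hC.
- by exists (B * C) => t Dt; rewrite evM normrM ler_pM ?hB ?hC.
Qed.

Lemma integrable_evX g P : mu.-integrable D (EFin \o g) ->
  mu.-integrable D (EFin \o (fun t => g t * ev P (X t))).
Proof.
move=> gi; have [C hC] := bounded_evX P.
apply: (eq_integrable mD ((EFin \o g) \* (EFin \o (ev P \o X)))%E); first by move=> t _ /=; rewrite EFinM.
apply: integrableMl => //; first exact: measurable_evX.
exists C; split; first exact: num_real.
by move=> M CM t Dt; apply: le_trans (hC _ Dt) _; exact: ltW.
Qed.

(** The map [X] is abstract so that one theory covers elements ([leb3] with [pt3]) and faces ([leb2]
    with [tparam]). The weight [g] carries data that are not polynomial: [beta], [f] and the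
    boundary data. *)
Definition wint g P : R := \int[mu]_(t in D) (g t * ev P (X t)).

Lemma wintP g (a : R) P Q : mu.-integrable D (EFin \o g) ->
  wint g (a *: P + Q) = a * wint g P + wint g Q.
Proof.
move=> gi; rewrite /wint -RintegralZl//; last exact: integrable_evX.
rewrite -RintegralD//; last 2 first.
- apply: (eq_integrable mD (EFin \o (fun t => g t * ev (a *: P) (X t)))).
    by move=> t _ /=; rewrite evZ mulrCA.
  exact: integrable_evX.
- exact: integrable_evX.
by apply: eq_Rintegral => t _; rewrite evD evZ; ring.
Qed.

Lemma wint0 g : wint g 0 = 0.
Proof.
by rewrite /wint; under eq_Rintegral do rewrite ev0 mulr0; rewrite Rintegral_cst// mul0r.
Qed.

Lemma wintD g P Q : mu.-integrable D (EFin \o g) -> wint g (P + Q) = wint g P + wint g Q.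
Proof. by move=> gi; rewrite -[P]scale1r wintP// mul1r scale1r. Qed.

Lemma wintZ g a P : mu.-integrable D (EFin \o g) -> wint g (a *: P) = a * wint g P.
Proof. by move=> gi; rewrite -[a *: P]addr0 wintP// wint0 addr0. Qed.

Lemma wint_sum (I : Type) (r : seq I) (p : pred I) (F : I -> mpoly 3 R) g :
  mu.-integrable D (EFin \o g) ->
  wint g (\sum_(i <- r | p i) F i) = \sum_(i <- r | p i) wint g (F i).
Proof.
move=> gi; elim/big_rec2: _ => [|i y x _ <-]; first exact: wint0.
by rewrite wintD.
Qed.

Hypothesis fD : (mu D < +oo)%E.

Lemma integrable_one : mu.-integrable D (EFin \o cst 1).
Proof.
apply: measurable_bounded_integrable => //.
exact: bounded_cst.
Qed.

Lemma wint_sqr_ge0 P : 0 <= wint (cst 1) (P * P).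
Proof. by apply: Rintegral_ge0 => t _; rewrite mul1r evM -expr2 sqr_ge0. Qed.

(** Only almost everywhere: for a face, [X] covers a piece of a plane, on which a nonzero polynomial
    may vanish. *)
Lemma wint_sqr_eq0 P : wint (cst 1) (P * P) = 0 ->
  {ae mu, forall t, D t -> ev P (X t) = 0}.
Proof.
rewrite /wint => h.
have hi := integrable_evX (P * P) integrable_one.
have : (\int[mu]_(t in D) `|(cst 1 t * ev (P * P) (X t))%:E| = 0)%E.
  under eq_integral => t _ do rewrite gee0_abs ?lee_fin ?mul1r ?evM -?expr2 ?sqr_ge0//.
  under eq_integral => t _ do rewrite expr2 -evM -[ev _ _]mul1r.
  rewrite -[LHS]fineK; last exact: integrable_fin_num hi.
  by congr EFin.
move=> /(ae_eq_integral_abs mu mD (measurable_int _ hi)); apply: filterS => t ht Dt.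
have /= := ht Dt; move=> /(congr1 fine) /= /eqP.
by rewrite mul1r evM -expr2 sqrf_eq0 => /eqP.
Qed.

End WeightedIntegral.

(** * Lines, planes and the boundary of a tetrahedron are null sets *)

Section NullSets.
Context (R : realType).
Local Notation mR := (measurableTypeR R).
Local Notation R2 := (mR * mR)%type.
Local Notation R3 := (mR * mR * mR)%type.

Lemma scales_null d (T : measurableType d) (m : {measure set T -> \bar R}) phi c S :
  scales m phi c -> measurable S -> m S = 0%E -> m (phi @^-1` S) = 0%E.
Proof. by move=> [_ h] mS S0; rewrite h// S0 mule0. Qed.

(** The line is the preimage of a coordinate axis under an invertible affine map that has the given
    equation as its second component. *)
Lemma leb2_line_null (c a b : R) : (a != 0) || (b != 0) ->
  leb2 [set w : R2 | a * w.1 + b * w.2 + c = 0] = 0%E.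
Proof.
pose S : set R2 := setT `*` [set (0:R)].
have mS : measurable S by exact: measurableX.
have S0 : leb2 S = 0%E.
  by rewrite /leb2 product_measure1E// [X in (_ * X)%E]lebesgue_measure_set1 mule0.
move=> /orP[a0|b0].
  have h : 0 * b - 1 * a != 0 by rewrite mul0r mul1r sub0r oppr_eq0.
  have := scales_null (scales_aff2 0 c h) mS S0.
  by congr (leb2 _ = _); apply/seteqP; split=> -[x y] /=; [case|].
have h : 1 * b - 0 * a != 0 by rewrite mul0r mul1r subr0.
have := scales_null (scales_aff2 0 c h) mS S0.
by congr (leb2 _ = _); apply/seteqP; split=> -[x y] /=; [case|].
Qed.

(** As for lines: two unit vectors complete the nonzero row [(a, b, c)] to an invertible matrix. *)
Lemma leb3_plane_null (e a b c : R) : [|| a != 0, b != 0 | c != 0] ->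
  leb3 [set w : R3 | a * w.1.1 + b * w.1.2 + c * w.2 + e = 0] = 0%E.
Proof.
pose S : set R3 := setT `*` [set (0:R)].
have mS : measurable S by exact: measurableX.
have S0 : leb3 S = 0%E.
  by rewrite /leb3 product_measure1E// [X in (_ * X)%E]lebesgue_measure_set1 mule0.
have key x1 x2 x3 y1 y2 y3 : det3 x1 x2 x3 y1 y2 y3 a b c != 0 ->
    leb3 [set w : R3 | a * w.1.1 + b * w.1.2 + c * w.2 + e = 0] = 0%E.
  move=> h; have := scales_null (scales_aff3 0 0 e h) mS S0.
  by congr (leb3 _ = _); apply/seteqP; split=> -[[x y] z] /=; [case|].
move=> /or3P[h|h|h]; [apply: (key 0 1 0 0 0 1)|apply: (key 0 0 1 1 0 0)|
  apply: (key 1 0 0 0 1 0)]; by rewrite /det3; apply: contra_neq h => h; rewrite -[RHS]h; ring.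
Qed.

Lemma leb3_finite (D : set R3) (M : R) : measurable D ->
  (forall t, D t -> forall i, `|pt3 t 0 i| <= M) -> (leb3 D < +oo)%E.
Proof.
move=> mD hM.
apply: (@le_lt_trans _ _ (leb3 (box (fun=> - (M + 1)) (fun=> M + 1)))).
  apply: le_measure; rewrite ?inE => //; first exact: measurable_box.
  move=> t Dt; apply/boxP => i; rewrite -ltr_norml.
  by apply: le_lt_trans (hM _ Dt i) _; rewrite ltrDl.
exact: leb3_box_lty.
Qed.

Section Tetrahedron.
Variable V : 'M[R]_(4, 3).
Hypothesis hV : nondegenerate V.
Local Notation T := (simplex V [set: 'I_4]%SET).

Lemma lam_le1 x i : T x -> 0 <= lam V i x <= 1.
Proof.
move=> /simplexP[]// h _; rewrite h/= -(lam_sum hV x) (bigD1 i)//= lerDl.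
exact: sumr_ge0.
Qed.

Lemma tet_bounded : exists M : R, forall x, T x -> forall i, `|x 0 i| <= M.
Proof.
exists (\sum_i \sum_j `|V j i|) => x xT i.
rewrite -{1}(lam_comb hV x) !mxE (le_trans (ler_norm_sum _ _ _))//.
rewrite (bigD1 i)//= ler_wpDr ?sumr_ge0// => [k _|]; first exact: sumr_ge0.
apply: ler_sum => j _; rewrite mxE normrM ler_piMl// ger0_norm;
  by have /andP[] := lam_le1 j xT.
Qed.

Definition ovol : set R3 := @pt3 R @^-1` otet V.

Lemma measurable_ovol : measurable ovol.
Proof. by apply: measurable_open; exact: otet_open. Qed.

Lemma ovol_bounded : exists M : R, forall t, ovol t -> forall i, `|pt3 t 0 i| <= M.
Proof. by have [M h] := tet_bounded; exists M => t /(otet_sub hV); exact: h. Qed.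

Lemma ovol_finite : (leb3 ovol < +oo)%E.
Proof. by have [M] := ovol_bounded; apply: leb3_finite; exact: measurable_ovol. Qed.

Lemma measurable_lam i : measurable_fun setT (fun t : R3 => lam V i (pt3 t) : mR).
Proof.
have -> : (fun t : R3 => lam V i (pt3 t)) = ev (lampoly V i) \o @pt3 R.
  by apply/funext => t; rewrite /= ev_lampoly.
by apply: measurable_evX => // j; exact: measurable_pt3.
Qed.

(** [lam V i] is 1 at one vertex and 0 at another, so its linear part is nonzero and its zero set is
    a plane. *)
Lemma lam_null i : leb3 [set t : R3 | lam V i (pt3 t) = 0] = 0%E.
Proof.
pose m := invmx (hom_mx V : 'M[R]_4).
have -> : [set t : R3 | lam V i (pt3 t) = 0] =
    [set t : R3 | m (lift ord0 0) i * t.1.1 + m (lift ord0 1) i * t.1.2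
                  + m (lift ord0 2) i * t.2 + m 0 i = 0].
  apply/seteqP; split => t /=; rewrite lamE sum3 !pt3E => h; rewrite -[RHS]h /m; ring.
apply: leb3_plane_null; apply/negbNE; rewrite !negb_or !negbK.
apply/negP => /and3P[/eqP h0 /eqP h1 /eqP h2].
have c x : lam V i x = m 0 i by rewrite lamE sum3 -/m h0 h1 h2 !mulr0 !addr0.
have [j ij] : exists j : 'I_4, i != j by case: (eqVneq i 0) => [->|]; [exists 1|exists 0].
have := lam_vertex hV i j; rewrite (negbTE ij) c.
have := lam_vertex hV i i; rewrite eqxx c => -> /eqP; by rewrite oner_eq0.
Qed.

Lemma measurable_tet : measurable (@pt3 R @^-1` T).
Proof.
have -> : @pt3 R @^-1` T = \bigcap_(i in [set: 'I_4]) ((fun t => lam V i (pt3 t)) @^-1` `[0, +oo[).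
  apply/seteqP; split=> t /=.
    by move=> /simplexP[]// h _ i _ /=; rewrite in_itv/= andbT; exact: h.
  move=> h; apply/simplexP => //; split=> i; last by rewrite inE.
  by have /= := h i I; rewrite in_itv/= andbT.
apply: fin_bigcap_measurable; first exact: finite_finset.
move=> i _; rewrite -[X in measurable X]setTI.
by apply: measurable_lam => //; exact: measurable_itv.
Qed.

Lemma tet_skeleton_null : leb3 (@pt3 R @^-1` T `\` ovol) = 0%E.
Proof.
have mTo := measurableD measurable_tet measurable_ovol.
apply/(measure_negligible mTo)/negligibleS; last first.
  apply: (@negligible_bigcup _ _ R (@leb3 R) (fun k => [set t : R3 | lam V (inord k) (pt3 t) = 0])).
  move=> k; exists [set t : R3 | lam V (inord k) (pt3 t) = 0]; split => //.
    rewrite -[X in measurable X]setTI.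
    by apply: (measurable_lam _ _ (measurable_set1 (0:R))).
  exact: lam_null.
move=> t [/= /simplexP[]// h _ ho]; apply: contrapT => hn; apply: ho => i.
rewrite lt_neqAle h andbT eq_sym; apply/eqP => h0; apply: hn.
by exists i => //=; rewrite inord_val.
Qed.

End Tetrahedron.

End NullSets.

(** * The divergence theorem on a tetrahedron *)

Section Triangle.
Context (R : realType).
Local Notation vec := 'rV[R]_3.
Local Notation mR := (measurableTypeR R).
Local Notation mu := (@lebesgue_measure R).
Local Notation R2 := (mR * mR)%type.
Local Notation ref := (@ref_tri R).
Implicit Types (A B C u v : vec).

Lemma dotE u v : dot u v = u 0 0 * v 0 0 + u 0 1 * v 0 1 + u 0 2 * v 0 2.
Proof. exact: sum3. Qed.

Lemma cross0 u v : cross u v 0 0 = u 0 1 * v 0 2 - u 0 2 * v 0 1.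
Proof. by rewrite mxE. Qed.
Lemma cross1 u v : cross u v 0 1 = u 0 2 * v 0 0 - u 0 0 * v 0 2.
Proof. by rewrite mxE. Qed.
Lemma cross2 u v : cross u v 0 2 = u 0 0 * v 0 1 - u 0 1 * v 0 0.
Proof. by rewrite mxE. Qed.
Definition crossE := (cross0, cross1, cross2).

Lemma addE u v i : (u + v) 0 i = u 0 i + v 0 i. Proof. by rewrite mxE. Qed.
Lemma oppE u i : (- u) 0 i = - u 0 i. Proof. by rewrite mxE. Qed.
Lemma scaE (a : R) u i : (a *: u) 0 i = a * u 0 i. Proof. by rewrite mxE. Qed.
Definition vecE := (addE, oppE, scaE, crossE).

Lemma dotDr u v w : dot u (v + w) = dot u v + dot u w :> R.
Proof. by rewrite !dotE !vecE; ring. Qed.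
Lemma dotZr (a : R) u v : dot u (a *: v) = a * dot u v.
Proof. by rewrite !dotE !vecE; ring. Qed.
Lemma dotZl (a : R) u v : dot (a *: u) v = a * dot u v.
Proof. by rewrite !dotE !vecE; ring. Qed.
Lemma dotBr u v w : dot u (v - w) = dot u v - dot u w :> R.
Proof. by rewrite !dotE !vecE; ring. Qed.

(** At the vertices [fv] this is [fparam] by conversion; freed from the mesh, it allows triangles
    with different listings of their vertices to be compared. *)
Definition tparam A B C (w : R2) : vec :=
  A + (w.1 : R) *: (B - A) + (w.2 : R) *: (C - A).

Lemma measurable_ref : measurable ref.
Proof.
have -> : ref = [set w : R2 | 0 <= (w.1 : R)] `&` [set w : R2 | 0 <= (w.2 : R)]
    `&` [set w : R2 | (w.1 : R) + w.2 <= 1].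
  by apply/seteqP; split=> w /= => [[]|[[]]].
have m1 : measurable_fun setT (fun w : R2 => w.1) by exact: measurable_fst.
have m2 : measurable_fun setT (fun w : R2 => w.2) by exact: measurable_snd.
have m3 : measurable_fun setT (fun w : R2 => (w.1 : R) + w.2 : mR) by exact: measurable_funD.
apply: measurableI; first apply: measurableI.
- have -> : [set w : R2 | 0 <= (w.1 : R)] = fst @^-1` `[0, +oo[.
    by apply/seteqP; split=> w /=; rewrite in_itv/= andbT.
  by rewrite -[X in measurable X]setTI; apply: m1 => //; exact: measurable_itv.
- have -> : [set w : R2 | 0 <= (w.2 : R)] = snd @^-1` `[0, +oo[.
    by apply/seteqP; split=> w /=; rewrite in_itv/= andbT.
  by rewrite -[X in measurable X]setTI; apply: m2 => //; exact: measurable_itv.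
- have -> : [set w : R2 | (w.1 : R) + w.2 <= 1] = (fun w : R2 => (w.1 : R) + w.2 : mR) @^-1` `]-oo, 1].
    by apply/seteqP; split=> w /=; rewrite in_itv/=.
  by rewrite -[X in measurable X]setTI; apply: m3 => //; exact: measurable_itv.
Qed.

Lemma leb2_rect (a b c d : R) :
  leb2 (`]a, b[%classic `*` `]c, d[%classic) = (mu `]a, b[ * mu `]c, d[)%E.
Proof. exact: product_measure1E. Qed.

Lemma leb2_ref_lty : (leb2 ref < +oo)%E.
Proof.
apply: (@le_lt_trans _ _ (leb2 (`](-1), 2[%classic `*` `](-1), 2[%classic))).
  apply: le_measure; rewrite ?inE; [exact: measurable_ref|exact: measurableX|].
  by move=> w [h1 h2 h3]; split; rewrite /= in_itv/=; apply/andP; split; lra.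
by rewrite leb2_rect !lebesgue_measure_itv/= !lte_fin; case: ifP => _;
  rewrite ?mule0// -EFinM ltry.
Qed.

Lemma leb2_ref_gt0 : (0 < leb2 ref)%E.
Proof.
apply: (@lt_le_trans _ _ (leb2 (`]0, 2^-1[%classic `*` `]0, 2^-1[%classic))).
  rewrite leb2_rect !lebesgue_measure_itv/= !lte_fin invr_gt0 ltr0n -!EFinD -EFinM lte_fin.
  by rewrite mulr_gt0// subr0.
apply: le_measure; rewrite ?inE; [exact: measurableX|exact: measurable_ref|].
move=> w [/=]; rewrite !in_itv/= => /andP[? ?] /andP[? ?]; split; lra.
Qed.

Lemma measurable_tparam A B C i : measurable_fun setT (fun w => tparam A B C w 0 i : mR).
Proof.
have -> : (fun w => tparam A B C w 0 i : mR) =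
    fun w => (A 0 i + (w.1 : R) * (B 0 i - A 0 i)) + (w.2 : R) * (C 0 i - A 0 i).
  by apply/funext => w; rewrite /tparam !vecE.
apply: measurable_funD; last exact: measurable_funM.
by apply: measurable_funD => //; exact: measurable_funM.
Qed.

Lemma tparam_bounded A B C : exists M : R, forall w, ref w -> forall i, `|tparam A B C w 0 i| <= M.
Proof.
exists (`|A| + `|B - A| + `|C - A|) => w [h1 h2 h3] i.
have w1 : `|w.1 : R| <= 1 by rewrite ger0_norm//; lra.
have w2 : `|w.2 : R| <= 1 by rewrite ger0_norm//; lra.
rewrite /tparam addE addE (le_trans (ler_normD _ _))// lerD//.
  rewrite (le_trans (ler_normD _ _))// lerD ?coord_le_norm// scaE normrM.
  by rewrite -[leRHS]mul1r ler_pM// coord_le_norm.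
by rewrite scaE normrM -[leRHS]mul1r ler_pM// coord_le_norm.
Qed.

Lemma tparam_inj A B C : cross (B - A) (C - A) != 0 -> injective (tparam A B C).
Proof.
move=> c0 [s t] [s' t']; rewrite /tparam /= => h.
have {}h : (s - s' : R) *: (B - A) + (t - t' : R) *: (C - A) = 0.
  by move/eqP: h; rewrite -subr_eq0 => /eqP <-; apply: vec3P; rewrite !vecE; ring.
have s0 : s - s' = 0 :> R.
  apply/eqP; apply: contraNT c0 => s0; apply/eqP.
  have : (s - s' : R) *: cross (B - A) (C - A) = cross ((s - s' : R) *: (B - A) + (t - t' : R) *: (C - A)) (C - A).
    by apply: vec3P; rewrite !vecE; ring.
  rewrite h => /eqP; rewrite (_ : cross 0 _ = 0); last by apply: vec3P; rewrite !vecE !mxE; ring.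
  by rewrite scaler_eq0 (negbTE s0) => /eqP.
have t0 : t - t' = 0 :> R.
  apply/eqP; apply: contraNT c0 => t0; apply/eqP.
  have : (t - t' : R) *: cross (B - A) (C - A) = cross (B - A) ((s - s' : R) *: (B - A) + (t - t' : R) *: (C - A)).
    by apply: vec3P; rewrite !vecE; ring.
  rewrite h => /eqP; rewrite (_ : cross _ 0 = 0); last by apply: vec3P; rewrite !vecE !mxE; ring.
  by rewrite scaler_eq0 (negbTE t0) => /eqP.
by congr pair; apply/eqP; rewrite -subr_eq0; apply/eqP.
Qed.

(** The change of parameters [psi] is affine and the preimage of the reference triangle is that
    triangle itself. Its area is positive and finite, so the determinant of [psi] is 1 or -1,
    without matching up the vertices. *)
Lemma triangle_reparam A B C A' B' C' :
  cross (B - A) (C - A) != 0 -> cross (B' - A') (C' - A') != 0 ->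
  tparam A B C @` ref = tparam A' B' C' @` ref ->
  (exists2 dl : R, `|dl| = 1 & cross (B' - A') (C' - A') = dl *: cross (B - A) (C - A)) /\
  forall f : vec -> R, (@leb2 R).-integrable ref (EFin \o (f \o tparam A B C)) ->
   \int[@leb2 R]_(w in ref) f (tparam A B C w) = \int[@leb2 R]_(w in ref) f (tparam A' B' C' w).
Proof.
move=> c0 c0' himg.
have sub w : ref w -> exists2 a, ref a & tparam A B C a = tparam A' B' C' w.
  move=> rw; have : (tparam A' B' C' @` ref) (tparam A' B' C' w) by exists w.
  by rewrite -himg.
have [[x0 y0] r0 h0] : exists2 a, ref a & tparam A B C a = A'.
  have [|a ra ha] := sub (0, 0); first by split=> /=; lra.
  by exists a => //; rewrite ha /tparam/= !scale0r !addr0.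
have [[x1 y1] r1 h1] : exists2 a, ref a & tparam A B C a = B'.
  have [|a ra ha] := sub (1, 0); first by split=> /=; lra.
  by exists a => //; rewrite ha /tparam/= scale0r scale1r addr0 addrC subrK.
have [[x2 y2] r2 h2] : exists2 a, ref a & tparam A B C a = C'.
  have [|a ra ha] := sub (0, 1); first by split=> /=; lra.
  by exists a => //; rewrite ha /tparam/= scale0r scale1r addr0 addrC subrK.
pose psi : R2 -> R2 := aff2 (x1 - x0) (x2 - x0) (y1 - y0) (y2 - y0) x0 y0.
pose dl : R := (x1 - x0) * (y2 - y0) - (x2 - x0) * (y1 - y0).
have hpsi w : tparam A' B' C' w = tparam A B C (psi w).
  by rewrite -h0 -h1 -h2 /tparam /psi /aff2 /=; apply: vec3P; rewrite !vecE; ring.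
have hc : cross (B' - A') (C' - A') = dl *: cross (B - A) (C - A).
  by rewrite -h0 -h1 -h2 /tparam /dl /=; apply: vec3P; rewrite !vecE; ring.
have dl0 : dl != 0 by apply: contra_neq c0' => dl0; rewrite hc dl0 scale0r.
have pre : psi @^-1` ref = ref.
  apply/seteqP; split=> w /= => [rp|rw].
    have : (tparam A B C @` ref) (tparam A' B' C' w) by exists (psi w) => //; rewrite hpsi.
    by rewrite himg => -[w' rw' /(tparam_inj c0') <-].
  have [a ra ha] := sub w rw.
  by move: ha; rewrite hpsi => /(tparam_inj c0) <-.
have hs := scales_aff2 x0 y0 dl0.
have dl1 : `|dl| = 1.
  have [_ /(_ _ measurable_ref)] := hs; rewrite pre => hE.
  have [r0' roo] := (leb2_ref_gt0, leb2_ref_lty).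
  have rE : leb2 ref = (fine (leb2 ref))%:E by rewrite fineK// ge0_fin_numE// ltW.
  have rp : 0 < fine (leb2 ref) by rewrite fine_gt0// r0'.
  have : (leb2 ref = (`|dl|^-1)%:E * leb2 ref)%E by exact: hE.
  rewrite rE -EFinM => -[] /eqP; rewrite -subr_eq0 -{1}[fine _]mul1r -mulrBl mulf_eq0.
  by rewrite [fine _ == 0]gt_eqF// orbF subr_eq0 eq_sym invr_eq1 => /eqP.
split; first by exists dl.
move=> f fi.
have := scales_Rintegral (f := f \o tparam A B C) _ hs measurable_ref fi.
rewrite pre -/dl dl1 invr1 mul1r => /(_ ler01) <-.
by apply: eq_Rintegral => w _; rewrite /= hpsi.
Qed.

Lemma enorm_scale (a : R) u : enorm (a *: u) = `|a| * enorm u.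
Proof.
rewrite /enorm -[X in X * _]ger0_norm// -sqrtr_sqr -sqrtrM ?sqr_ge0//.
by congr Num.sqrt; rewrite !dotE !scaE real_normK ?num_real//; ring.
Qed.

Lemma dot_ge0 u : 0 <= dot u u.
Proof. by apply: sumr_ge0 => i _; rewrite -expr2 sqr_ge0. Qed.

Lemma dot_eq0 u : (dot u u == 0) = (u == 0).
Proof.
apply/eqP/eqP => [h|->]; last by rewrite dotE !mxE; ring.
apply/rowP => i; rewrite mxE; have /eqP := h.
by rewrite psumr_eq0 => [/allP/(_ i (mem_index_enum _))/=|j _];
  rewrite -expr2 ?sqrf_eq0 ?sqr_ge0// => /eqP.
Qed.

Lemma enorm_gt0 u : u != 0 -> 0 < enorm u.
Proof. by move=> u0; rewrite sqrtr_gt0 lt_neqAle eq_sym dot_eq0 u0 dot_ge0. Qed.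

End Triangle.

(** * Fubini and the fundamental theorem of calculus on the reference tetrahedron *)

Section Stokes.
Context (R : realType).
Local Notation vec := 'rV[R]_3.
Local Notation mR := (measurableTypeR R).
Local Notation mu := (@lebesgue_measure R).
Local Notation R3 := (mR * mR * mR)%type.
Local Notation ref := (@ref_tri R).
Implicit Types (A B C v : vec) (P : mpoly 3 R).

Definition ref_tet : set R3 :=
  [set y | [/\ ref y.1, 0 <= (y.2 : R) & (y.2 : R) <= 1 - y.1.1 - y.1.2]].

Definition dir_mderiv P v : mpoly 3 R := \sum_(i < 3) v 0 i *: mderiv i P.

Lemma ev_dir_mderiv P v x : ev (dir_mderiv P v) x = ev_deriv P x v.
Proof. by rewrite ev_sum; apply: eq_bigr => i _; rewrite evZ. Qed.

Lemma line_FTC P x v (b : R) : 0 <= b ->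
  (\int[mu]_(z in `[0%R, b]) (ev_deriv P (x + z *: v) v)%:E
   = (ev P (x + b *: v) - ev P x)%:E)%E.
Proof.
rewrite le_eqVlt => /predU1P[<-|b0].
  by rewrite set_itv1 integral_set1 scale0r addr0 subrr.
have cl Q : continuous (fun z : R => ev Q (x + z *: v)).
  move=> z; apply: continuous_comp; last exact: ev_continuous.
  by apply: cvgD; [exact: cvg_cst|apply: cvgZr_tmp; exact: cvg_id].
rewrite (@continuous_FTC2 R _ (fun z => ev P (x + z *: v)) 0 b b0).
- by rewrite scale0r addr0 EFinB.
- rewrite -(_ : (fun z : R => ev (dir_mderiv P v) (x + z *: v)) = fun z => ev_deriv P (x + z *: v) v).
    by apply: continuous_subspaceT; exact: cl.
  by apply/funext => z; exact: ev_dir_mderiv.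
- split.
  + by move=> z _; have [] := ev_line_derive P x v z.
  + by apply: cvg_at_right_filter; exact: cl.
  + by apply: cvg_at_left_filter; exact: cl.
- move=> z _; rewrite derive1E.
  exact: (@derive_val _ _ _ _ _ _ _ (ev_line_derive P x v z)).
Qed.

Definition tetmap (v0 v1 v2 v3 : vec) (y : R3) : vec :=
  tparam v0 v1 v2 y.1 + (y.2 : R) *: (v3 - v0).

Lemma measurable_tetmap v0 v1 v2 v3 i : measurable_fun setT (fun y => tetmap v0 v1 v2 v3 y 0 i : mR).
Proof.
have -> : (fun y => tetmap v0 v1 v2 v3 y 0 i : mR) =
    fun y => tparam v0 v1 v2 y.1 0 i + (y.2 : R) * (v3 - v0) 0 i.
  by apply/funext => y; rewrite /tetmap !vecE.
apply: measurable_funD; last exact: measurable_funM.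
by apply: (measurableT_comp (measurable_tparam v0 v1 v2 i)).
Qed.

Lemma measurable_ref_tet : measurable ref_tet.
Proof.
have -> : ref_tet = (ref `*` setT) `&` ((fun y : R3 => y.2) @^-1` `[0, +oo[)
   `&` ((fun y : R3 => (y.2 : R) + y.1.1 + y.1.2 : mR) @^-1` `]-oo, 1]).
  apply/seteqP; split=> y /=; rewrite !in_itv/= ?andbT.
    by move=> [h1 h2 h3]; split; [|lra].
  by move=> [[[h1 _] h2] h3]; split => //; lra.
apply: measurableI; first apply: measurableI.
- by apply: measurableX => //; exact: measurable_ref.
- by rewrite -[X in measurable X]setTI; apply: measurable_snd => //; exact: measurable_itv.
- rewrite -[X in measurable X]setTI.
  have m3 : measurable_fun setT (fun y : R3 => (y.2 : R) + y.1.1 + y.1.2 : mR).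
    apply: measurable_funD; last exact: measurableT_comp.
    by apply: measurable_funD => //; exact: measurableT_comp.
  by apply: m3 => //; exact: measurable_itv.
Qed.

Lemma ref_tet_bound y : ref_tet y -> [/\ `|y.1.1 : R| <= 1, `|y.1.2 : R| <= 1 & `|y.2 : R| <= 1].
Proof.
by move=> [[h1 h2 h3] h4 h5]; split; rewrite ger0_norm//; lra.
Qed.

Lemma leb3_ref_tet_lty : (leb3 ref_tet < +oo)%E.
Proof.
apply: (@leb3_finite _ _ 1); first exact: measurable_ref_tet.
by move=> t /ref_tet_bound[h1 h2 h3]; elim/ord3P; rewrite pt3E.
Qed.

Lemma tetmap_bounded v0 v1 v2 v3 : exists M : R,
  forall y, ref_tet y -> forall i, `|tetmap v0 v1 v2 v3 y 0 i| <= M.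
Proof.
have [M hM] := tparam_bounded v0 v1 v2.
exists (M + `|v3 - v0|) => y ry i; have [_ _ y3] := ref_tet_bound ry.
have [r1 _ _] := ry.
rewrite /tetmap addE (le_trans (ler_normD _ _))// lerD ?hM// scaE normrM.
by rewrite -[leRHS]mul1r ler_pM// coord_le_norm.
Qed.

(** Over each point of the base the fibre runs in direction [v3 - v0] up to the face opposite [v0],
    where [tparam v3 v1 v2] takes over with the same parameters. The lateral faces contain that
    direction and contribute nothing. *)
Lemma ref_tet_stokes P v0 v1 v2 v3 :
  \int[@leb3 R]_(y in ref_tet) ev_deriv P (tetmap v0 v1 v2 v3 y) (v3 - v0) =
  \int[@leb2 R]_(w in ref) ev P (tparam v3 v1 v2 w)
  - \int[@leb2 R]_(w in ref) ev P (tparam v0 v1 v2 w).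
Proof.
pose Q := dir_mderiv P (v3 - v0).
have QE x : ev_deriv P x (v3 - v0) = ev Q x by rewrite ev_dir_mderiv.
have iQ : (@leb3 R).-integrable ref_tet (EFin \o (ev Q \o tetmap v0 v1 v2 v3)).
  apply: (eq_integrable measurable_ref_tet (EFin \o (fun y => cst 1 y * ev Q (tetmap v0 v1 v2 v3 y)))).
    by move=> y _ /=; rewrite mul1r.
  apply: integrable_evX.
  - exact: measurable_ref_tet.
  - by move=> i; apply: measurable_funTS; exact: measurable_tetmap.
  - exact: tetmap_bounded.
  - exact: integrable_one measurable_ref_tet leb3_ref_tet_lty.
have iP A B C : (@leb2 R).-integrable ref (EFin \o (ev P \o tparam A B C)).
  apply: (eq_integrable (@measurable_ref R) (EFin \o (fun y => cst 1 y * ev P (tparam A B C y)))).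
    by move=> y _ /=; rewrite mul1r.
  apply: integrable_evX.
  - exact: measurable_ref.
  - by move=> i; apply: measurable_funTS; exact: measurable_tparam.
  - exact: tparam_bounded.
  - exact: integrable_one (@measurable_ref R) (@leb2_ref_lty R).
rewrite -RintegralB; [|exact: measurable_ref|exact: iP|exact: iP].
have top w : ref w -> tparam v0 v1 v2 w + (1 - (w.1 : R) - w.2) *: (v3 - v0) = tparam v3 v1 v2 w.
  by move=> _; apply: vec3P; rewrite /tparam !vecE; ring.
rewrite /Rintegral; congr fine.
rewrite integral_mkcond -[LHS](integral12_prod_meas1 (m1 := @leb2 R) (m2 := mu)); last first.
  apply/(integrable_mkcond _ measurable_ref_tet).
  by apply: eq_integrable iQ => [|y _]; [exact: measurable_ref_tet|rewrite /= QE].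
rewrite [RHS]integral_mkcond; apply: eq_integral => w _.
rewrite /fubini_F patchE; case: ifPn => [/set_mem rw|]; last first.
  move=> /negP nr; rewrite integral0_eq// => z _; rewrite patchE ifF//.
  by apply/negP => /set_mem [r1 _ _]; apply: nr; exact/mem_set.
have [w1 w2 w3] := rw.
rewrite /= -top// -line_FTC; last by lra.
rewrite [RHS]integral_mkcond; apply: eq_integral => z _; rewrite !patchE.
have -> : ((w, z) \in ref_tet) = (z \in [set` `[0%R, 1 - (w.1 : R) - w.2]]).
  apply/idP/idP => /set_mem h; apply/mem_set.
    by move: h => [_ h1 h2]; rewrite /= in_itv/= h1 h2.
  by move: h; rewrite /= in_itv/= => /andP[h1 h2].
by [].
Qed.

Definition triple A B C : R := dot (cross A B) C.

Definition tetra (v0 v1 v2 v3 : vec) : set vec := tetmap v0 v1 v2 v3 @` ref_tet.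

(** The factor is the absolute determinant of the linear part of [tetmap], by change of
    variables. *)
Lemma tetra_stokes P v0 v1 v2 v3 :
  triple (v1 - v0) (v2 - v0) (v3 - v0) != 0 ->
  measurable (@pt3 R @^-1` tetra v0 v1 v2 v3) ->
  (@leb3 R).-integrable (@pt3 R @^-1` tetra v0 v1 v2 v3)
     (EFin \o (fun t => ev_deriv P (pt3 t) (v3 - v0))) ->
  \int[@leb3 R]_(t in @pt3 R @^-1` tetra v0 v1 v2 v3) ev_deriv P (pt3 t) (v3 - v0) =
  `|triple (v1 - v0) (v2 - v0) (v3 - v0)| *
  (\int[@leb2 R]_(w in ref) ev P (tparam v3 v1 v2 w)
  - \int[@leb2 R]_(w in ref) ev P (tparam v0 v1 v2 w)).
Proof.
set e1 := v1 - v0; set e2 := v2 - v0; set e3 := v3 - v0 => d0 mD fi.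
have dE : det3 (e1 0 0) (e2 0 0) (e3 0 0) (e1 0 1) (e2 0 1) (e3 0 1)
   (e1 0 2) (e2 0 2) (e3 0 2) = triple e1 e2 e3.
  by rewrite /triple dotE !crossE /det3; ring.
have d0' := d0; rewrite -dE in d0'.
have hs := scales_aff3 (v0 0 0) (v0 0 1) (v0 0 2) d0'.
set phi := aff3 _ _ _ _ _ _ _ _ _ _ _ _ in hs.
have phiE y : pt3 (phi y) = tetmap v0 v1 v2 v3 y.
  apply: vec3P; rewrite pt3E /tetmap /tparam !vecE /phi /aff3 /=; rewrite /e1 /e2 /e3 !vecE; ring.
have inj : injective (tetmap v0 v1 v2 v3).
  move=> [[a b] c] [[a' b'] c'] /eqP; rewrite -subr_eq0 => /eqP h.
  have {}h : (a - a' : R) *: e1 + (b - b' : R) *: e2 + (c - c' : R) *: e3 = 0.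
    by rewrite -[RHS]h /tetmap /tparam /e1 /e2 /e3; apply: vec3P; rewrite !vecE /=; ring.
  set s := _ + _ + _ in h.
  have z u w : triple 0 u w = 0 by rewrite /triple dotE !crossE !mxE; ring.
  have a0 : (a - a' : R) * triple e1 e2 e3 = triple s e2 e3.
    by rewrite /s /triple !dotE !vecE; ring.
  have b0 : (b - b' : R) * triple e1 e2 e3 = triple s e3 e1.
    by rewrite /s /triple !dotE !vecE; ring.
  have c0 : (c - c' : R) * triple e1 e2 e3 = triple s e1 e2.
    by rewrite /s /triple !dotE !vecE; ring.
  move: a0 b0 c0; rewrite h !z => /eqP + /eqP + /eqP.
  rewrite !mulf_eq0 (negbTE d0) !orbF !subr_eq0 => /eqP -> /eqP -> /eqP ->.
  by [].
have pre : phi @^-1` (@pt3 R @^-1` tetra v0 v1 v2 v3) = ref_tet.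
  apply/seteqP; split=> y /=; rewrite phiE; last by exists y.
  by move=> [y' ry' /inj <-].
have := scales_Rintegral _ hs mD fi; rewrite pre dE invr_ge0 normr_ge0 => /(_ isT).
rewrite -ref_tet_stokes => h.
have -> : \int[@leb3 R]_(y in ref_tet) ev_deriv P (tetmap v0 v1 v2 v3 y) e3 =
   \int[@leb3 R]_(y in ref_tet) ev_deriv P (pt3 (phi y)) e3.
  by apply: eq_Rintegral => y _; rewrite phiE.
by rewrite h mulrA mulfV ?mul1r// normr_eq0.
Qed.

End Stokes.

(** * From directional formulas to the full flux *)

Section Divergence.
Context (R : realType).
Local Notation vec := 'rV[R]_3.
Local Notation mR := (measurableTypeR R).
Local Notation R2 := (mR * mR)%type.
Local Notation R3 := (mR * mR * mR)%type.
Local Notation ref := (@ref_tri R).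
Implicit Types (A B C v : vec) (P : mpoly 3 R).

(** Relabelling the vertices lets [tetra_stokes] be used along each of the three edges at [v0]. *)
Lemma tetra_cyc v0 v1 v2 v3 : tetra v0 v1 v2 v3 = tetra v0 v2 v3 v1.
Proof.
have sub u1 u2 u3 : tetra v0 u1 u2 u3 `<=` tetra v0 u2 u3 u1.
  move=> x [[[a b] c] [[/= h1 h2 h3] h4 h5] <-].
  exists (b, c, a); first by split; [split|..] => /=; lra.
  by rewrite /tetmap /tparam /=; apply: vec3P; rewrite !vecE; ring.
by apply/seteqP; split=> //; apply: subset_trans (sub _ _ _) (sub _ _ _).
Qed.

Lemma tetra_swap v0 v1 v2 v3 : tetra v0 v1 v2 v3 = tetra v0 v1 v3 v2.
Proof.
have sub u2 u3 : tetra v0 v1 u2 u3 `<=` tetra v0 v1 u3 u2.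
  move=> x [[[a b] c] [[/= h1 h2 h3] h4 h5] <-].
  exists (a, c, b); first by split; [split|..] => /=; lra.
  by rewrite /tetmap /tparam /=; apply: vec3P; rewrite !vecE; ring.
by apply/seteqP; split.
Qed.

Definition triangle A B C : set vec := tparam A B C @` ref.

Lemma triangle_cyc A B C : triangle A B C = triangle B C A.
Proof.
have sub A' B' C' : triangle A' B' C' `<=` triangle B' C' A'.
  move=> x [[s t] [/= h1 h2 h3] <-]; exists (t, 1 - s - t).
    by split=> /=; lra.
  by rewrite /tparam /=; apply: vec3P; rewrite !vecE; ring.
by apply/seteqP; split=> //; apply: subset_trans (sub _ _ _) (sub _ _ _).
Qed.

Lemma triangle_swap A B C : triangle A B C = triangle A C B.
Proof.
have sub B' C' : triangle A B' C' `<=` triangle A C' B'.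
  move=> x [[s t] [/= h1 h2 h3] <-]; exists (t, s); first by split=> /=; lra.
  by rewrite /tparam /=; apply: vec3P; rewrite !vecE; ring.
by apply/seteqP; split.
Qed.

(* Without the area factor: the integral over the reference triangle. *)
Definition triI A B C P : R := wint (@leb2 R) ref (tparam A B C) (cst 1) P.

Lemma integrable_one_ref : (@leb2 R).-integrable ref (EFin \o cst 1).
Proof. exact: integrable_one (@measurable_ref R) (@leb2_ref_lty R). Qed.

Lemma integrable_tri A B C P (g : R2 -> R) : (@leb2 R).-integrable ref (EFin \o g) ->
  (@leb2 R).-integrable ref (EFin \o (fun w => g w * ev P (tparam A B C w))).
Proof.
move=> gi; apply: integrable_evX => //.
- exact: measurable_ref.
- by move=> i; apply: measurable_funTS; exact: measurable_tparam.
- exact: tparam_bounded.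
Qed.

Lemma triIE A B C P : triI A B C P = \int[@leb2 R]_(w in ref) ev P (tparam A B C w).
Proof. by apply: eq_Rintegral => w _; rewrite mul1r. Qed.

Lemma triI_eq A B C A' B' C' P :
  cross (B - A) (C - A) != 0 -> cross (B' - A') (C' - A') != 0 ->
  triangle A B C = triangle A' B' C' -> triI A B C P = triI A' B' C' P.
Proof.
move=> h h' hT; have [_ H] := triangle_reparam h h' hT.
rewrite !triIE H//.
apply: (eq_integrable (@measurable_ref R) (EFin \o (fun w => cst 1 w * ev P (tparam A B C w)))).
  by move=> w _ /=; rewrite mul1r.
by apply: integrable_tri; exact: integrable_one_ref.
Qed.

Lemma triple_cyc A B C : triple A B C = triple B C A.
Proof. by rewrite /triple !dotE !crossE; ring. Qed.

(** Expansion of [v] in the basis reciprocal to [u1], [u2], [u3], multiplied by the triple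
    product. *)
Lemma dot_basis_eq0 u1 u2 u3 v : triple u1 u2 u3 != 0 ->
  dot u1 v = 0 -> dot u2 v = 0 -> dot u3 v = 0 -> v = 0.
Proof.
move=> t0 h1 h2 h3.
have : triple u1 u2 u3 *: v =
    dot u1 v *: cross u2 u3 + dot u2 v *: cross u3 u1 + dot u3 v *: cross u1 u2.
  by rewrite /triple; apply: vec3P; rewrite !vecE !dotE !crossE; ring.
by rewrite h1 h2 h3 !scale0r !addr0 => /eqP; rewrite scaler_eq0 (negbTE t0) => /eqP.
Qed.

Lemma edge_cross_cyc A B C : cross (A - C) (B - C) = cross (B - A) (C - A).
Proof. by apply: vec3P; rewrite !vecE; ring. Qed.

Lemma edge_cross_swap A B C : cross (A - B) (C - B) = - cross (B - A) (C - A).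
Proof. by apply: vec3P; rewrite !vecE; ring. Qed.

(* Stokes' formula along the three edges at [V0], written with the same face
   integrals [K], determines the vector [X]: the edges form a basis. *)
Lemma flux_unique (V0 V1 V2 V3 X : vec) (K : vec -> vec -> vec -> R) :
  let tp := triple (V1 - V0) (V2 - V0) (V3 - V0) in
  let s := Num.sg tp in
  tp != 0 ->
  (forall v1 v2 v3, triple (v1 - V0) (v2 - V0) (v3 - V0) != 0 ->
     tetra V0 V1 V2 V3 = tetra V0 v1 v2 v3 ->
     dot (v3 - V0) X = `|triple (v1 - V0) (v2 - V0) (v3 - V0)| * (K v3 v1 v2 - K V0 v1 v2)) ->
  (forall A B C A' B' C', cross (B - A) (C - A) != 0 -> cross (B' - A') (C' - A') != 0 ->
     triangle A B C = triangle A' B' C' -> K A B C = K A' B' C') ->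
  X = (s * K V1 V2 V3) *: cross (V2 - V1) (V3 - V1) + (- s * K V0 V2 V3) *: cross (V2 - V0) (V3 - V0)
  + (s * K V0 V1 V3) *: cross (V1 - V0) (V3 - V0) + (- s * K V0 V1 V2) *: cross (V1 - V0) (V2 - V0).
Proof.
move=> tp s tp0 hX hK; set I0 := K V1 V2 V3; set I1 := K V0 V2 V3.
set I2 := K V0 V1 V3; set I3 := K V0 V1 V2; set Y := _ + _ + _ + _.
have sE : s * tp = `|tp| by rewrite /s normrEsg.
have f0 : cross (V2 - V1) (V3 - V1) != 0.
  apply: contra_neq tp0 => c0.
  have -> : tp = dot (cross (V2 - V1) (V3 - V1)) (V1 - V0).
    by rewrite /tp /triple !dotE !vecE; ring.
  by rewrite c0 dotE !mxE; ring.
have h3 : dot (V3 - V0) X = `|tp| * (I0 - I3).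
  have c0 : cross (V1 - V3) (V2 - V3) != 0 by rewrite edge_cross_cyc.
  by rewrite (hX V1 V2 V3 tp0 erefl) (hK _ _ _ _ _ _ c0 f0 (triangle_cyc _ _ _)).
have h1 : dot (V1 - V0) X = `|tp| * (I0 - I1).
  have tE : triple (V2 - V0) (V3 - V0) (V1 - V0) = tp by rewrite -triple_cyc.
  have t0 : triple (V2 - V0) (V3 - V0) (V1 - V0) != 0 by rewrite tE.
  by rewrite (hX V2 V3 V1 t0 (tetra_cyc _ _ _ _)) tE.
have h2 : dot (V2 - V0) X = `|tp| * (I0 - I2).
  have tE : triple (V1 - V0) (V3 - V0) (V2 - V0) = - tp.
    by rewrite /tp /triple !dotE !vecE; ring.
  have t0 : triple (V1 - V0) (V3 - V0) (V2 - V0) != 0 by rewrite tE oppr_eq0.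
  rewrite (hX V1 V3 V2 t0 (tetra_swap _ _ _ _)) tE normrN.
  have c0 : cross (V1 - V2) (V3 - V2) != 0 by rewrite edge_cross_swap oppr_eq0.
  have hT : triangle V2 V1 V3 = triangle V1 V2 V3.
    by rewrite triangle_cyc; exact: triangle_swap.
  by rewrite (hK _ _ _ _ _ _ c0 f0 hT).
apply/eqP; rewrite -subr_eq0; apply/eqP.
have e21 : V2 - V1 = (V2 - V0) - (V1 - V0) by apply: vec3P; rewrite !vecE; ring.
have e31 : V3 - V1 = (V3 - V0) - (V1 - V0) by apply: vec3P; rewrite !vecE; ring.
apply: (dot_basis_eq0 tp0); rewrite dotBr ?h1 ?h2 ?h3 -sE /Y /tp e21 e31;
move: (V1 - V0) (V2 - V0) (V3 - V0) s I0 I1 I2 I3 {Y h1 h2 h3 sE e21 e31} => *;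
by rewrite /triple !dotE !vecE; ring.
Qed.

Section Tet.
Variable V : 'M[R]_(4, 3).
Hypothesis hV : nondegenerate V.

(* [fv] and [fa] are [fvertex] and [farea_vec] of one tetrahedron; [onormal] is
   the outward normal of length [enorm fa]. *)
Definition fv (i : 'I_4) (j : 'I_3) : vec := row j (row' i V).
Definition fa (i : 'I_4) : vec := cross (fv i 1 - fv i 0) (fv i 2 - fv i 0).
Definition onormal (i : 'I_4) : vec := (- Num.sg (dot (fa i) (row i V - fv i 0))) *: fa i.

Lemma fvE i j : fv i j = row (lift i j) V.
Proof. by apply/rowP => l; rewrite !mxE. Qed.

Local Notation V0 := (row 0 V).
Local Notation V1 := (row 1 V).
Local Notation V2 := (row 2 V).
Local Notation V3 := (row 3 V).

Lemma fv_rows :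
  [/\ [/\ fv 0 0 = V1, fv 0 1 = V2 & fv 0 2 = V3],
      [/\ fv 1 0 = V0, fv 1 1 = V2 & fv 1 2 = V3],
      [/\ fv 2 0 = V0, fv 2 1 = V1 & fv 2 2 = V3] &
      [/\ fv 3 0 = V0, fv 3 1 = V1 & fv 3 2 = V2]].
Proof. by split; split; rewrite fvE; congr (row _ V); apply: val_inj. Qed.

Definition etriple : R := triple (V1 - V0) (V2 - V0) (V3 - V0).

Lemma lam_diff i x y : lam V i x - lam V i y =
  dot (\row_j invmx (hom_mx V : 'M[R]_4) (lift ord0 j) i) (x - y).
Proof. by rewrite !lamE dotE !sum3 !mxE; ring. Qed.

(** The gradients [g 1], [g 2], [g 3] of the barycentric coordinates are dual to the edges at vertex
    0. The product of the two triple products is the determinant of the matrix of pairings, which is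
    the identity. *)
Lemma etriple_neq0 : etriple != 0.
Proof.
pose g i : vec := \row_j invmx (hom_mx V : 'M[R]_4) (lift ord0 j) i.
have hg a b : dot (g a) (row b V - V0) = (a == b)%:R - (a == 0)%:R.
  by rewrite -lam_diff !lam_vertex.
have : triple (g 1) (g 2) (g 3) * etriple = 1.
  transitivity (det3 (dot (g 1) (V1 - V0)) (dot (g 1) (V2 - V0)) (dot (g 1) (V3 - V0))
    (dot (g 2) (V1 - V0)) (dot (g 2) (V2 - V0)) (dot (g 2) (V3 - V0))
    (dot (g 3) (V1 - V0)) (dot (g 3) (V2 - V0)) (dot (g 3) (V3 - V0))).
    rewrite /etriple /triple /det3.
    move: (V1 - V0) (V2 - V0) (V3 - V0) (g 1) (g 2) (g 3) => u1 u2 u3 w1 w2 w3.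
    by rewrite !dotE !crossE; ring.
  by rewrite !hg /det3 /=; ring.
by move=> h; apply/eqP => e0; move: h; rewrite e0 mulr0 => /eqP; rewrite eq_sym oner_eq0.
Qed.

Lemma tetraE : simplex V [set: 'I_4]%SET = tetra V0 V1 V2 V3.
Proof.
apply/seteqP; split=> x.
  move=> [w [w0 _ w1 ->]]; exists (w 0 1 : mR, w 0 2 : mR, w 0 3 : mR).
    rewrite sum4 in w1; have h0 := w0 0; have h1 := w0 1; have h2 := w0 2; have h3 := w0 3.
    by split; [split|..] => /=; lra.
  rewrite /tetmap /tparam /=.
  have -> : w 0 1 = 1 - w 0 0 - w 0 2 - w 0 3 by rewrite -w1 sum4; ring.
  by apply: vec3P; rewrite !vecE !mxE sum4 (_ : w 0 1 = 1 - w 0 0 - w 0 2 - w 0 3); try ring;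
    rewrite -w1 sum4; ring.
move=> [[[a b] c] [[/= h1 h2 h3] h4 h5] <-].
pose w : 'rV[R]_4 := \row_i [:: 1 - a - b - c; a; b; c]`_i.
exists w; split.
- by case=> [[|[|[|[|//]]]] i4]; rewrite mxE /=; lra.
- by move=> i; rewrite inE.
- by rewrite sum4 !mxE /=; ring.
- by rewrite /tetmap /tparam; apply: vec3P; rewrite !vecE !mxE sum4 !mxE /=; ring.
Qed.

Definition volI P : R := wint (@leb3 R) (ovol V) (@pt3 R) (cst 1) P.

Lemma integrable_one_ovol : (@leb3 R).-integrable (ovol V) (EFin \o cst 1).
Proof. exact: integrable_one (measurable_ovol V) (ovol_finite hV). Qed.

Lemma integrable_ovol (g : R3 -> R) P : (@leb3 R).-integrable (ovol V) (EFin \o g) ->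
  (@leb3 R).-integrable (ovol V) (EFin \o (fun t => g t * ev P (pt3 t))).
Proof.
move=> gi; apply: integrable_evX => //.
- exact: measurable_ovol.
- by move=> i; apply: measurable_funTS; exact: measurable_pt3.
- exact: ovol_bounded.
Qed.

Lemma integrable_tet P : (@leb3 R).-integrable (@pt3 R @^-1` simplex V [set: 'I_4]%SET)
  (EFin \o (ev P \o @pt3 R)).
Proof.
have mT := measurable_tet hV; have [M hM] := tet_bounded hV.
apply: (eq_integrable mT (EFin \o (fun t => cst 1 t * ev P (pt3 t)))).
  by move=> t _ /=; rewrite mul1r.
apply: integrable_evX => //.
- by move=> i; apply: measurable_funTS; exact: measurable_pt3.
- by exists M => t /hM.
- by apply: integrable_one => //; apply: leb3_finite => // t /hM.
Qed.

(** [volI] uses the open element and Stokes' formula the closed one; they differ by a null set. *)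
Lemma volIE P : volI P =
  \int[@leb3 R]_(t in @pt3 R @^-1` simplex V [set: 'I_4]%SET) ev P (pt3 t).
Proof.
have mT := measurable_tet hV.
rewrite /volI /wint /Rintegral; congr fine.
rewrite [RHS](@negligible_integral _ _ _ _ _ (@pt3 R @^-1` simplex V [set: 'I_4]%SET `\` ovol V))//.
- rewrite setDD (_ : _ `&` ovol V = ovol V).
    by apply: eq_integral => t _; rewrite mul1r.
  by rewrite setIC; apply/setIidPl => t; exact: otet_sub.
- by apply: measurableD => //; exact: measurable_ovol.
- exact: integrable_tet.
- exact: tet_skeleton_null.
Qed.

Lemma tet_stokes P v1 v2 v3 : triple (v1 - V0) (v2 - V0) (v3 - V0) != 0 ->
  simplex V [set: 'I_4]%SET = tetra V0 v1 v2 v3 ->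
  volI (dir_mderiv P (v3 - V0)) = `|triple (v1 - V0) (v2 - V0) (v3 - V0)| *
    (triI v3 v1 v2 P - triI V0 v1 v2 P).
Proof.
move=> t0 hT; rewrite volIE hT !triIE -tetra_stokes//.
- by apply: eq_Rintegral => t _; rewrite ev_dir_mderiv.
- by rewrite -hT; exact: measurable_tet.
- rewrite -hT; apply: (eq_integrable (measurable_tet hV) (EFin \o (ev (dir_mderiv P (v3 - V0)) \o @pt3 R))).
    by move=> t _ /=; rewrite ev_dir_mderiv.
  exact: integrable_tet.
Qed.

(** The signed height of vertex [i] over its face is [etriple] up to a sign that alternates with
    [i], so one sign orients all four outward normals. *)
Lemma onormal_rows : let s := Num.sg etriple in
  [/\ onormal 0 = s *: cross (V2 - V1) (V3 - V1),
      onormal 1 = - s *: cross (V2 - V0) (V3 - V0),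
      onormal 2 = s *: cross (V1 - V0) (V3 - V0) &
      onormal 3 = - s *: cross (V1 - V0) (V2 - V0)].
Proof.
have [[a1 a2 a3] [b1 b2 b3] [c1 c2 c3] [d1 d2 d3]] := fv_rows.
rewrite /= /onormal /fa a1 a2 a3 b1 b2 b3 c1 c2 c3 d1 d2 d3.
split; congr (_ *: _).
- rewrite -sgrN; congr (Num.sg _); rewrite /etriple /triple !dotE !vecE; ring.
- congr (- Num.sg _); rewrite /etriple /triple !dotE !vecE; ring.
- rewrite -sgrN; congr (Num.sg _); rewrite /etriple /triple !dotE !vecE; ring.
Qed.

Lemma divergence_coord P i :
  volI (mderiv i P) = \sum_(j < 4) onormal j 0 i * triI (fv j 0) (fv j 1) (fv j 2) P.
Proof.
(* Linearity turns every directional formula into a product with one fixed vector, which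
   [flux_unique] then identifies. *)
have XE v : volI (dir_mderiv P v) = dot v (\row_i volI (mderiv i P)).
  have mX k : measurable_fun (ovol V) (fun t => pt3 t 0 k : mR).
    by apply: measurable_funTS; exact: measurable_pt3.
  have bX := ovol_bounded hV; have io := integrable_one_ovol.
  rewrite /volI /dir_mderiv (wint_sum (measurable_ovol V) mX bX)//.
  by apply: eq_bigr => j _; rewrite (wintZ (measurable_ovol V) mX bX)// mxE.
have /rowP/(_ i) := @flux_unique _ _ _ _ (\row_i volI (mderiv i P)) (fun A B C => triI A B C P)
  etriple_neq0 (fun v1 v2 v3 t0 hT => etrans (esym (XE _)) (tet_stokes P t0 (etrans tetraE hT)))
  (fun A B C A' B' C' => @triI_eq A B C A' B' C' P).
rewrite mxE => ->.
have [[a1 a2 a3] [b1 b2 b3] [c1 c2 c3] [d1 d2 d3]] := fv_rows.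
have [] := onormal_rows; rewrite /etriple => n0 n1 n2 n3.
rewrite sum4 n0 n1 n2 n3 a1 a2 a3 b1 b2 b3 c1 c2 c3 d1 d2 d3.
move: V0 V1 V2 V3 {n0 n1 n2 n3 a1 a2 a3 b1 b2 b3 c1 c2 c3 d1 d2 d3} => W0 W1 W2 W3.
rewrite !addE !scaE; move: (Num.sg _) (triI _ _ _ _) (triI _ _ _ _) (triI _ _ _ _) (triI _ _ _ _) => *.
by ring.
Qed.

End Tet.
End Divergence.

(** * Faces and mesh connectivity *)

Section Faces.
Context (R : realType).
Local Notation vec := 'rV[R]_3.
Local Notation mR := (measurableTypeR R).
Implicit Types (u v x d : vec) (V W : 'M[R]_(4, 3)).

(** Both numbers are six times the volume of the tetrahedron. *)
Lemma fa_triple V i : `|dot (fa V i) (row i V - fv V i 0)| = `|etriple V|.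
Proof.
have [[a1 a2 a3] [b1 b2 b3] [c1 c2 c3] [d1 d2 d3]] := fv_rows V.
have ord4P (P : 'I_4 -> Prop) : P 0 -> P 1 -> P 2 -> P 3 -> forall i, P i.
  move=> P0 P1 P2 P3 [[|[|[|[|//]]]] h]; [move: P0|move: P1|move: P2|move: P3];
  by congr P; apply: val_inj.
elim/ord4P: i; rewrite /fa ?(a1, a2, a3, b1, b2, b3, c1, c2, c3, d1, d2, d3) /etriple;
move: (row 0 V) (row 1 V) (row 2 V) (row 3 V) {a1 a2 a3 b1 b2 b3 c1 c2 c3 d1 d2 d3} => v0 v1 v2 v3.
- rewrite -normrN; congr `|_|; rewrite /triple !dotE !vecE; ring.
- congr `|_|; rewrite /triple !dotE !vecE; ring.
- rewrite -normrN; congr `|_|; rewrite /triple !dotE !vecE; ring.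
- by [].
Qed.

Section OneTet.
Variable V : 'M[R]_(4, 3).
Hypothesis hV : nondegenerate V.

Lemma fa_height_neq0 i : dot (fa V i) (row i V - fv V i 0) != 0.
Proof. by rewrite -normr_eq0 fa_triple normr_eq0 etriple_neq0. Qed.

Lemma fa_neq0 i : fa V i != 0.
Proof. by apply: contraNneq (fa_height_neq0 i) => ->; rewrite dotE !mxE !mul0r !addr0. Qed.

Lemma onormal_neq0 i : onormal V i != 0.
Proof. by rewrite scaler_eq0 oppr_eq0 sgr_eq0 negb_or fa_height_neq0 fa_neq0. Qed.

Lemma sum_lift (U : nmodType) (i : 'I_4) (F : 'I_4 -> U) :
  \sum_k F k = F i + \sum_(j < 3) F (lift i j).
Proof. exact: (bigD1_ord i). Qed.

Lemma face_weights i (s t : R) : exists w : 'rV[R]_4,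
  [/\ w 0 i = 0, forall j, w 0 (lift i j) = [:: 1 - s - t; s; t]`_j, \sum_j w 0 j = 1 &
      tparam (fv V i 0) (fv V i 1) (fv V i 2) (s : mR, t : mR) = w *m V].
Proof.
pose w : 'rV[R]_4 := \row_k if unlift i k is Some j then [:: 1 - s - t; s; t]`_j else 0.
have wl j : w 0 (lift i j) = [:: 1 - s - t; s; t]`_j by rewrite mxE liftK.
have wi : w 0 i = 0 by rewrite mxE unlift_none.
exists w; split=> //; first by rewrite (sum_lift i) wi add0r sum3 !wl /=; ring.
rewrite mulmx_sum_row (sum_lift i) wi scale0r add0r sum3 !wl -!fvE /tparam /=.
by apply: vec3P; rewrite !vecE; ring.
Qed.

Lemma faceE i : simplex V [set~ i]%SET = triangle (fv V i 0) (fv V i 1) (fv V i 2).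
Proof.
apply/seteqP; split=> x.
  move=> [w [w0 wi w1 ->]].
  have {}wi : w 0 i = 0 by apply: wi; rewrite !inE eqxx.
  rewrite (sum_lift i) wi add0r sum3 in w1.
  exists (w 0 (lift i 1) : mR, w 0 (lift i 2) : mR).
    by have := w0 (lift i 0); have := w0 (lift i 1); have := w0 (lift i 2); split => /=; lra.
  have E : w *m V = w 0 (lift i 0) *: fv V i 0 + w 0 (lift i 1) *: fv V i 1 + w 0 (lift i 2) *: fv V i 2.
    rewrite mulmx_sum_row (sum_lift i) wi scale0r add0r sum3.
    by rewrite !fvE.
  rewrite E /tparam /=; have -> : w 0 (lift i 0) = 1 - w 0 (lift i 1) - w 0 (lift i 2) by lra.
  by apply: vec3P; rewrite !vecE; ring.
move=> [[s t] [/= h1 h2 h3] <-]; have [w [wi wl w1 wE]] := face_weights i s t.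
exists w; split=> //; last by move=> k; rewrite !inE negbK => /eqP ->.
move=> k; case: (unliftP i k) => [j|] ->; rewrite ?wi//.
by rewrite wl; case: j => [[|[|[|//]]] j3] /=; lra.
Qed.

Lemma face_tet i x : simplex V [set~ i]%SET x -> simplex V [set: 'I_4]%SET x.
Proof.
by move=> [w [w0 _ w1 ->]]; exists w; split => // k; rewrite inE.
Qed.

(** The three vertices of the face have height 0 over it, so in barycentric coordinates only vertex
    [i] contributes. *)
Lemma lam_height i x : dot (fa V i) (x - fv V i 0) =
  lam V i x * dot (fa V i) (row i V - fv V i 0).
Proof.
have key j : dot (fa V i) (row (lift i j) V - fv V i 0) = 0.
  rewrite -fvE /fa; move: (fv V i) j => f; elim/ord3P; rewrite !dotE !vecE; ring.
have -> : x - fv V i 0 = lam V i x *: (row i V - fv V i 0) +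
   (lam V (lift i 0) x *: (row (lift i 0) V - fv V i 0) +
    lam V (lift i 1) x *: (row (lift i 1) V - fv V i 0) +
    lam V (lift i 2) x *: (row (lift i 2) V - fv V i 0)).
  transitivity (\sum_k lam V k x *: (row k V - fv V i 0)); last by rewrite (sum_lift i) sum3.
  under eq_bigr do rewrite scalerBr; rewrite sumrB -scaler_suml lam_sum// scale1r; congr (_ - _).
  by rewrite -{1}(lam_comb hV x) mulmx_sum_row; apply: eq_bigr => k _; rewrite mxE.
by rewrite !dotDr !dotZr -!dotDr !key !mulr0 !addr0.
Qed.

Lemma dot_onormal i x : dot (onormal V i) (x - fv V i 0) = - `|etriple V| * lam V i x.
Proof.
by rewrite /onormal dotZl (lam_height i x) -(fa_triple V i) normrEsg; ring.
Qed.

(** Near [x] the other coordinates stay positive, and by [dot_onormal] the [i]-th one grows along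
    any direction against the outward normal. *)
Lemma inward_otet i x d : (forall j, j != i -> 0 < lam V j x) -> lam V i x = 0 ->
  dot (onormal V i) d < 0 -> \forall t \near 0^'+, otet V (x + (t : R) *: d).
Proof.
move=> hj hi hd; apply: (@filter_forall R _ (fun j (t : R) => 0 < lam V j (x + t *: d))) => j.
have [->|ji] := eqVneq j i.
  near=> t; have t0 : 0 < t by near: t; exact: nbhs_right_gt.
  have := dot_onormal i (x + t *: d).
  have -> : x + t *: d - fv V i 0 = (x - fv V i 0) + t *: d by rewrite addrAC.
  rewrite dotDr dot_onormal hi mulr0 add0r dotZr => h.
  have e0 : 0 < `|etriple V| by rewrite normr_gt0 etriple_neq0.
  rewrite -(pmulr_rgt0 _ e0) -[ltRHS]opprK oppr_gt0 -mulNr -h.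
  by rewrite pmulr_rlt0.
apply: (@near_line R (fun z => 0 < lam V j z)).
exact: (cvgr_gt (lam V j x) (@lam_continuous R V j x) 0 (hj _ ji)).
Unshelve. all: by end_near. Qed.

Lemma lam_affine W k (w : 'rV[R]_4) : \sum_j w 0 j = 1 ->
  lam W k (w *m V) = \sum_j w 0 j * lam W k (row j V).
Proof.
move=> w1; rewrite lamE; under [RHS]eq_bigr do rewrite lamE mulrDr.
rewrite big_split -mulr_suml w1 mul1r; congr (_ + _).
under [RHS]eq_bigr do rewrite mulr_sumr; rewrite exchange_big; apply: eq_bigr => l _.
rewrite mxE mulr_suml; apply: eq_bigr => j _; rewrite mxE; ring.
Qed.

Lemma row_face i j : j != i -> simplex V [set~ i]%SET (row j V).
Proof.
move=> ji; apply/simplexP => //; split=> k; rewrite lam_vertex//.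
by rewrite !inE negbK => /eqP ->; rewrite eq_sym (negbTE ji).
Qed.

Lemma face_inj i j : simplex V [set~ i]%SET = simplex V [set~ j]%SET -> i = j.
Proof.
move=> h; apply/eqP; apply/negPn/negP => ij.
have : simplex V [set~ i]%SET (row j V) by apply: row_face; rewrite eq_sym.
rewrite h => /simplexP[]// _ /(_ j); rewrite !inE eqxx => /(_ isT).
by rewrite lam_vertex// eqxx => /eqP; rewrite oner_eq0.
Qed.

End OneTet.

(** The point [x] is a positive combination of the vertices of the face, where [lam W k] is
    nonnegative. If [lam W k] vanished at [x], it would vanish at all of them and so on the whole
    face; but [row k W] lies in the face. *)
Lemma face_relint_eq V W i i' x : nondegenerate V -> nondegenerate W ->
  simplex V [set~ i]%SET = simplex W [set~ i']%SET ->
  (forall j, j != i -> 0 < lam V j x) -> lam V i x = 0 ->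
  (forall j, j != i' -> 0 < lam W j x) /\ lam W i' x = 0.
Proof.
move=> hV hW hE hj hi.
have xV : simplex V [set~ i]%SET x.
  apply/simplexP => //; split=> k; last by rewrite !inE negbK => /eqP ->.
  by have [->|/hj/ltW//] := eqVneq k i; rewrite hi.
have xW := xV; rewrite hE in xW; have [w0 wi] := (simplexP _ _ hW).1 xW.
split=> [k ki|]; last by apply: wi; rewrite !inE eqxx.
rewrite lt_neqAle w0 andbT eq_sym; apply/eqP => k0.
have vk j : j != i -> 0 <= lam W k (row j V).
  move=> ji; have : simplex W [set~ i']%SET (row j V) by rewrite -hE; exact: row_face.
  by move=> /simplexP[]// h _; exact: h.
have vk0 j : j != i -> lam W k (row j V) = 0.
  have := lam_affine V W k (w := \row_j lam V j x).
  rewrite lam_comb// k0; under eq_bigr do rewrite mxE; rewrite lam_sum// => /(_ erefl).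
  rewrite (bigD1 i)//= mxE hi mul0r add0r => /esym/eqP; rewrite psumr_eq0; last first.
    by move=> l li; rewrite mxE mulr_ge0 ?vk// ltW ?hj.
  move=> /allP/(_ j (mem_index_enum _))/implyP h ji; move: (h ji).
  by rewrite mxE mulf_eq0 gt_eqF ?hj//= => /eqP.
have : simplex V [set~ i]%SET (row k W) by rewrite hE; exact: row_face.
move=> [v [v0 vi v1 hk]]; have := lam_vertex hW k k; rewrite eqxx hk lam_affine//.
rewrite (bigD1 i)//= vi ?mul0r ?add0r; last by rewrite !inE eqxx.
rewrite big1 => [/esym/eqP|j ji]; first by rewrite oner_eq0.
by rewrite vk0// mulr0.
Qed.

(** [triangle_reparam] makes the two normals equal up to sign. If they were equal, a step against
    the normal from the barycentre of the face would enter both disjoint elements. *)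
Lemma face_opposite V W i i' : nondegenerate V -> nondegenerate W ->
  simplex V [set~ i]%SET = simplex W [set~ i']%SET ->
  otet V `&` otet W = set0 -> onormal W i' = - onormal V i.
Proof.
move=> hV hW hE h0.
have hT := hE; rewrite !faceE// in hT.
have [[dl dl1 faE] _] := triangle_reparam (fa_neq0 hV i) (fa_neq0 hW i') hT.
have [s s1 sE] : exists2 s : R, (s == 1) || (s == -1) & onormal W i' = s *: onormal V i.
  rewrite /onormal; set a := Num.sg _; set b := Num.sg _; exists (a * dl * b).
    have : `|a * dl * b| == 1.
      by rewrite !normrM dl1 mulr1 !normr_sg !fa_height_neq0// mulr1.
    by rewrite eqr_norml ler01 andbT.
  rewrite [fa W i']faE !scalerA; congr (_ *: _).
  have b2 : b * b = 1 by rewrite -expr2 sqr_sg fa_height_neq0.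
  by rewrite -[LHS]mulr1 -b2; ring.
case/orP: s1 => /eqP s1; last by rewrite sE s1 scaleN1r.
exfalso.
pose w : 'rV[R]_4 := \row_j if j == i then 0 else 3^-1.
have w1 : \sum_j w 0 j = 1.
  rewrite (sum_lift i) mxE eqxx add0r sum3 !mxE ![lift _ _ == _]eq_sym !(negbTE (neq_lift _ _)).
  by field.
pose x := w *m V.
have xj j : j != i -> 0 < lam V j x.
  by move=> ji; rewrite lam_uniq// mxE (negbTE ji) invr_gt0.
have xi : lam V i x = 0 by rewrite lam_uniq// mxE eqxx.
have [yj yi] := face_relint_eq hV hW hE xj xi.
have n0 : onormal V i != 0 by exact: onormal_neq0.
have d0 : dot (onormal V i) (- onormal V i) < 0.
  by rewrite -scaleN1r dotZr mulN1r oppr_lt0 lt_neqAle eq_sym dot_eq0 n0 dot_ge0.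
have d0' : dot (onormal W i') (- onormal V i) < 0 by rewrite sE s1 scale1r.
have [t [tV tW]] : exists t : R, otet V (x + t *: - onormal V i) /\ otet W (x + t *: - onormal V i).
  apply: (@filter_ex _ 0^'+); apply: filterI; [exact: (inward_otet hV xj xi d0)|exact: (inward_otet hW yj yi d0')].
suff : set0 (x + t *: - onormal V i) by [].
by rewrite -h0.
Qed.

(** Three elements on one face would have pairwise opposite normals. Hence a half-face has at most
    one partner. *)
Lemma face_partner_uniq V W W' i j k :
  nondegenerate V -> nondegenerate W -> nondegenerate W' ->
  simplex V [set~ i]%SET = simplex W [set~ j]%SET ->
  simplex V [set~ i]%SET = simplex W' [set~ k]%SET ->
  otet V `&` otet W = set0 -> otet V `&` otet W' = set0 -> otet W `&` otet W' = set0 -> False.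
Proof.
move=> hV hW hW' h1 h2 o1 o2 o3.
have n1 := face_opposite hV hW h1 o1; have n2 := face_opposite hV hW' h2 o2.
have n3 := face_opposite hW hW' (etrans (esym h1) h2) o3.
have : onormal W' k = - onormal W' k by rewrite {1}n3 n1 n2.
move=> /eqP; rewrite -addr_eq0 -mulr2n -scaler_nat scaler_eq0 pnatr_eq0/=.
by rewrite (negbTE (onormal_neq0 hW' k)).
Qed.

End Faces.

(** * General position, convexity and edges *)

Section Generic.
Context (R : realType).
Local Notation vec := 'rV[R]_3.
Implicit Types (x d n q : vec) (V : 'M[R]_(4, 3)).

Definition affpoly n q : mpoly 3 R := \sum_(j < 3) n 0 j *: var R j - mpolyC 3 (dot n q).

Lemma ev_affpoly n q x : ev (affpoly n q) x = dot n (x - q).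
Proof.
rewrite evB evC ev_sum dotBr; congr (_ - _).
by apply: eq_bigr => j _; rewrite evZ ev_var.
Qed.

Lemma ev_prod (I : Type) (r : seq I) (p : pred I) (F : I -> mpoly 3 R) x :
  ev (\prod_(i <- r | p i) F i) x = \prod_(i <- r | p i) ev (F i) x.
Proof. exact: rmorph_prod. Qed.

(** The product of the affine equations is a nonzero polynomial, so it cannot vanish on the whole of
    [O]. *)
Lemma avoid_planes (I : finType) (n q : I -> vec) (O : set vec) :
  open O -> O !=set0 -> (forall i, n i != 0) ->
  exists2 x, O x & forall i, dot (n i) (x - q i) != 0.
Proof.
move=> Oo On n0; pose P := \prod_i affpoly (n i) (q i).
have P0 : P != 0.
  apply/prodf_neq0 => i _; apply: contraNneq (n0 i) => h; rewrite -dot_eq0.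
  by have := ev_affpoly (n i) (q i) (n i + q i); rewrite h ev0 addrK => <-.
have [x [Ox Px]] : exists x, O x /\ ev P x != 0.
  apply: contrapT => hn; move/eqP: P0; apply; apply: (poly_eq0 Oo On) => x Ox.
  by apply: contrapT => /eqP Px; apply: hn; exists x.
exists x => // i; move: Px; rewrite ev_prod => /prodf_neq0/(_ i isT).
by rewrite ev_affpoly.
Qed.

Lemma exists_orthogonal d : exists2 m : vec, m != 0 & dot m d = 0.
Proof.
have [/eqP d0|d0] := boolP ((d 0 0 == 0) && (d 0 1 == 0)); last first.
  exists (\row_j [:: - d 0 1; d 0 0; 0]`_j).
    apply: contraNneq d0 => /rowP h.
    have := h 0; have := h 1; rewrite !mxE /= => -> /eqP; rewrite oppr_eq0 => ->.
    by rewrite eqxx.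
  by rewrite dotE !mxE /=; ring.
move/eqP/andP : d0 => [/eqP d0 /eqP d1].
exists (delta_mx 0 0); last by rewrite dotE d0 d1 !mxE /=; ring.
by apply/negP => /eqP/rowP/(_ 0)/eqP; rewrite !mxE eqxx oner_eq0.
Qed.

(** [r] has a component along [m], which is orthogonal to [d], so [r] is not parallel to [d]. *)
Lemma cross_neq0 (r d m : vec) : d != 0 -> dot m d = 0 -> dot m r != 0 -> cross r d != 0.
Proof.
move=> d0 md; apply: contraNneq => c0.
have : dot d d * dot m r = dot d r * dot m d + dot m (cross d (cross r d)).
  by rewrite !dotE !crossE; ring.
rewrite c0 md mulr0 add0r (_ : cross d 0 = 0); last by apply: vec3P; rewrite !crossE !mxE; ring.
rewrite (_ : dot m 0 = 0); last by rewrite dotE !mxE; ring.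
by move/eqP; rewrite mulf_eq0 dot_eq0 (negbTE d0).
Qed.

Lemma cvg_rV (T : Type) (F : set_system T) (FF : Filter F) (N : nat) (f : T -> 'rV[R]_N) (l : 'rV[R]_N) :
  (forall j, (fun t => f t 0 j) @ F --> l 0 j) -> f @ F --> l.
Proof.
move=> h; apply/cvg_ballP => e e0; rewrite near_simpl.
suff : \forall t \near F, forall j, ball (l 0 j) e (f t 0 j).
  by apply: filterS => t ht; split => // i j; rewrite ord1; exact: ht.
by apply: filter_forall => j; have /cvg_ballP/(_ e e0) := h j.
Qed.

Lemma simplex_sub V (A : {set 'I_4}) : simplex V A `<=` simplex V [set: 'I_4]%SET.
Proof. by move=> x [w [w0 _ w1 ->]]; exists w; split=> // i; rewrite inE. Qed.

Lemma tet_closed V : nondegenerate V -> closed (simplex V [set: 'I_4]%SET).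
Proof.
move=> hV.
have -> : simplex V [set: 'I_4]%SET = \bigcap_(i in [set: 'I_4]) (lam V i @^-1` [set r | 0 <= r]).
  apply/seteqP; split=> x /=; first by move=> /simplexP[]// h _ i _; exact: h.
  by move=> h; apply/simplexP => //; split=> i; [exact: h|rewrite inE].
apply: closed_bigI => i _; apply: closed_comp; last exact: closed_ge.
by move=> x _; exact: lam_continuous.
Qed.

Lemma segment_conv (O : set vec) x : open O -> O x ->
  exists2 B : set vec, [/\ open B, B x & B `<=` O] &
    forall a b (t : R), B a -> B b -> 0 <= t <= 1 -> B (a + t *: (b - a)).
Proof.
move=> Oo Ox; have /nbhs_ballP[e /= e0 xe] : nbhs x O by exact: open_nbhs_nbhs.
exists (ball x e); first by split => //; [exact: ball_open|exact: ballxx].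
move=> a b t [_ ha] [_ hb] /andP[t0 t1]; split=> // i j.
have := ha i j; have := hb i j; rewrite /ball /= !ord1 !vecE.
move=> hb' ha'; set xa := `|_ - a 0 j| in ha'; set xb := `|_ - b 0 j| in hb'.
apply: (@le_lt_trans _ _ (Num.max xa xb)); last by rewrite gt_max ha' hb'.
have -> : x 0 j - (a 0 j + t * (b 0 j - a 0 j)) = (1 - t) * (x 0 j - a 0 j) + t * (x 0 j - b 0 j) by ring.
rewrite (le_trans (ler_normD _ _))// !normrM (ger0_norm t0) ger0_norm ?subr_ge0// -/xa -/xb.
have -> : Num.max xa xb = (1 - t) * Num.max xa xb + t * Num.max xa xb by ring.
by rewrite lerD// ler_wpM2l ?subr_ge0// le_max lexx ?orbT.
Qed.

Lemma lipschitz_dist (N : nat) (phi : 'rV[R]_N -> R) : lipschitz phi ->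
  continuous phi.
Proof.
move=> [M [_ /(_ (`|M| + 1))]]; rewrite (le_lt_trans (ler_norm _))// ?ltrDl// => /(_ isT) h.
move=> x; apply/(@cvgrPdist_lt _ _ _ _ (nbhs_filter x)) => e e0.
have M0 : 0 < `|M| + 1 by rewrite ltr_wpDl.
near=> y; apply: le_lt_trans (h (x, y) _) _ => //=.
rewrite -ltr_pdivlMl//; near: y.
by apply: cvgr_dist_lt; [exact: cvg_id|rewrite mulr_gt0// invr_gt0].
Unshelve. all: by end_near. Qed.

Lemma ord4_split (i j : 'I_4) : i != j ->
  exists p q : 'I_4, p != q /\ forall k, [|| k == i, k == j, k == p | k == q].
Proof.
move=> ij; have : #|~: [set i; j]%SET| == 2.
  by rewrite cardsCs finset.setCK cards2 ij card_ord.
move=> /cards2P[p [q [pq h]]]; exists p, q; split=> // k.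
have [kij|] := boolP (k \in [set i; j]%SET); first by move: kij; rewrite !inE => /orP[] ->; rewrite ?orbT.
by rewrite -finset.in_setC h !inE => /orP[] ->; rewrite ?orbT.
Qed.

(** At most two weights are left, so [x] lies on a line through two vertices. *)
Lemma simplex_line V (A : {set 'I_4}) i j x : i != j -> i \notin A -> j \notin A ->
  simplex V A x -> exists (p q : 'I_4) (s : R), p != q /\ x = row p V + s *: (row q V - row p V).
Proof.
move=> ij iA jA [w [w0 wA w1 ->]]; have [p [q [pq hk]]] := ord4_split ij.
exists p, q, (w 0 q); split=> //.
have key (U : nmodType) (F : 'I_4 -> U) : F i = 0 -> F j = 0 -> \sum_k F k = F p + F q.
  move=> Fi Fj; rewrite (bigD1 p)//= (bigD1 q) ?(eq_sym q)//= big1 ?addr0// => k /andP[kp kq].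
  by have := hk k; rewrite (negbTE kp) (negbTE kq) !orbF => /orP[]/eqP ->.
have wp : w 0 p = 1 - w 0 q.
  have := key _ (fun k => w 0 k) (wA _ iA) (wA _ jA); rewrite w1 => ->; ring.
have := key _ (fun k => w 0 k *: row k V).
rewrite /= (wA _ iA) (wA _ jA) !scale0r mulmx_sum_row => -> //; rewrite wp.
by apply: vec3P; rewrite !vecE; ring.
Qed.

End Generic.

(** * Open elements are disjoint and lie in the domain *)

Section Mesh.
Context (R : realType) (N : nat) (Th : 'I_N -> 'M[R]_(4, 3)) (Om : set 'rV[R]_3).
Local Notation vec := 'rV[R]_3.
Hypothesis hOm : bounded_lipschitz_domain Om.
Hypothesis hmesh : is_mesh_of Th Om.
Implicit Types (x : vec) (K L : 'I_N).

Lemma mesh_nondeg K : nondegenerate (Th K).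
Proof. by have [] := hmesh. Qed.

Lemma mesh_cover x : Om x -> exists K, tet Th K x.
Proof.
have [_ h _ _] := hmesh => /subset_closure; rewrite h.
by move=> [K _ xK]; exists K.
Qed.

Lemma tet_int K : (tet Th K)° = otet (Th K).
Proof. exact/tet_interior/mesh_nondeg. Qed.

Lemma mesh_disjoint K L : K != L -> otet (Th K) `&` otet (Th L) = set0.
Proof. by have [_ _ h _] := hmesh => /h; rewrite !tet_int. Qed.

(* The closure of a Lipschitz domain has no interior point on the boundary: the
   domain has no slit. *)
Lemma otet_sub_domain K : otet (Th K) `<=` Om.
Proof.
have [_ Oo _ _ hL] := hOm; have [_ hc _ _] := hmesh.
have sub z : otet (Th K) z -> closure Om z.
  by move=> zo; rewrite hc; exists K => //; exact: otet_sub (mesh_nondeg K) _ zo.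
move=> x xo; apply: contrapT => nOx.
have [|U [Q [phi [Uo Ux QQ lphi hU]]]] := hL x.
  by split; [exact: sub|move=> /interior_subset].
have QQ' : Q^T *m Q = 1%:M by exact: mulmx1C.
pose cut (z : vec) : 'rV[R]_2 := \row_(j < 2) z 0 (widen_ord (leqnSn 2) j).
(* The upward direction of the chart. The point [x], outside [Om], is on or above the graph, and a
   small step along [e] leads strictly above it. A whole neighbourhood of the new point misses [Om],
   although the point is in the closure. *)
pose e : vec := delta_mx 0 2 *m Q^T.
have [t [t0 zo zU]] : exists t : R, [/\ 0 < t, otet (Th K) (x + t *: e) & U (x + t *: e)].
  have [t h] : exists t : R, 0 < t /\ (otet (Th K) (x + t *: e) /\ U (x + t *: e)).
    apply: (@filter_ex _ 0^'+); apply: filterI; first exact: nbhs_right_gt.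
    apply: filterI; apply: (@near_line R); apply: open_nbhs_nbhs; split => //.
    exact: otet_open.
  by exists t; case: h => ? [].
have [z zE] : exists z : vec, z = x + t *: e by exists (x + t *: e).
rewrite -zE in zo zU.
have zQ : z *m Q = x *m Q + t *: delta_mx 0 2.
  by rewrite zE mulmxDl -scalemxAl -mulmxA QQ' mulmx1.
have hz : phi (cut (z *m Q)) < (z *m Q) 0 2.
  have -> : cut (z *m Q) = cut (x *m Q).
    rewrite zQ; apply/rowP => j; rewrite ![cut _ 0 j]mxE addE scaE [delta_mx _ _ _ _]mxE.
    rewrite (_ : (widen_ord _ j == 2) = false) ?andbF ?mulr0 ?addr0//.
    by apply/negbTE; rewrite -val_eqE /= neq_ltn ltn_ord.
  rewrite zQ addE scaE [delta_mx _ _ _ _]mxE !eqxx mulr1.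
  have := hU x Ux; move=> [_ h]; rewrite ltr_pwDr// leNgt; apply/negP => /h.
  exact: nOx.
have cQ j : continuous (fun y : vec => (y *m Q) 0 j).
  move=> y; rewrite (_ : (fun y : vec => (y *m Q) 0 j) = ev (\sum_i Q i j *: var R i)).
    exact: ev_continuous.
  by apply/funext => w; rewrite mxE ev_sum; apply: eq_bigr => i _; rewrite evZ ev_var mulrC.
have : \forall y \near z, U y /\ phi (cut (y *m Q)) < (y *m Q) 0 2.
  apply: filterI; first exact: open_nbhs_nbhs.
  have c1 : (fun y : vec => phi (cut (y *m Q))) @ z --> phi (cut (z *m Q)).
    apply: (@continuous_comp _ _ _ (fun y : vec => cut (y *m Q)) phi); last exact: lipschitz_dist.
    apply: (cvg_rV (nbhs_filter z)) => j.
    rewrite (_ : (fun y : vec => cut (y *m Q) 0 j) = fun y => (y *m Q) 0 (widen_ord (leqnSn 2) j)).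
      by rewrite mxE; exact: cQ.
    by apply/funext => y; rewrite mxE.
  have cc : (fun y : vec => (y *m Q) 0 2 - phi (cut (y *m Q))) @ z --> (z *m Q) 0 2 - phi (cut (z *m Q)).
    exact: (cvgB (cQ 2 z) c1).
  have := cvgr_gt _ cc 0; rewrite subr_gt0 => /(_ (nbhs_filter z) hz); apply: filterS => y.
  by rewrite subr_gt0.
move=> /(sub _ zo)[y [Oy [Uy hy]]].
by have [h _] := hU y Uy; have := h Oy; rewrite /= -/(cut _) ltNge ltW.
Qed.

End Mesh.

(** * Connectivity of the mesh through faces *)

Section MeshTopology.
Context (R : realType) (N : nat) (Th : 'I_N -> 'M[R]_(4, 3)) (Om : set 'rV[R]_3).
Local Notation vec := 'rV[R]_3.
Hypothesis hOm : bounded_lipschitz_domain Om.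
Hypothesis hmesh : is_mesh_of Th Om.
Implicit Types (x : vec) (K L : 'I_N).
Local Notation nd := (mesh_nondeg hmesh).

Lemma simplex_full (V W : 'M[R]_(4, 3)) (A : {set 'I_4}) : nondegenerate V -> nondegenerate W ->
  simplex V [set: 'I_4]%SET `<=` simplex W A -> otet V `&` otet W = set0 -> False.
Proof.
move=> hV hW h h0; have [c co] := otet_neq0 hV.
have : otet W c.
  rewrite -tet_interior//; apply: filterS (_ : otet V `<=` _) _.
    by move=> z /(otet_sub hV)/h; exact: simplex_sub.
  by apply: open_nbhs_nbhs; split=> //; exact: otet_open.
by move=> cW; suff : set0 c by []; rewrite -h0.
Qed.

Section Adjacency.
Variable c : 'I_N -> R.
Hypothesis hc : forall F G : half_face N, F.1 != G.1 ->
  hface Th F = hface Th G -> c F.1 = c G.1.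

(* A generic segment near [x] from one element to the other avoids the lines
   carrying the edges, so it passes between elements through common faces. *)
Lemma mesh_local_const K L x : Om x -> tet Th K x -> tet Th L x -> c K = c L.
Proof.
move=> Ox xK xL; apply: contrapT => /eqP cKL.
have [_ Oo _ _ _] := hOm.
have [B [Bo Bx BO] Bconv] := segment_conv Oo Ox.
have pick J : tet Th J x -> open (B `&` otet (Th J)) /\ B `&` otet (Th J) !=set0.
  move=> xJ; split; first by apply: openI => //; exact: otet_open.
  have [|z [zo zB]] := tet_closure (nd J) xJ (B := B).
    exact: open_nbhs_nbhs.
  by exists z.
have [oK nK] := pick K xK; have [oL nL] := pick L xL.
(* Ordered pairs of vertices of one element, standing for the lines that carry the edges. *)
pose E := ('I_N * ('I_4 * 'I_4))%type.
have vtx_neq (e : E) : e.2.1 != e.2.2 -> row e.2.2 (Th e.1) - row e.2.1 (Th e.1) != 0.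
  move=> ij; rewrite subr_eq0; apply/eqP => h.
  have := lam_vertex (nd e.1) e.2.1 e.2.2; rewrite h lam_vertex ?eqxx ?(negbTE ij)//; last exact: nd.
  by move/eqP; rewrite oner_eq0.
have /choice[m hm] : forall e : E, exists m : vec, m != 0 /\
    dot m (row e.2.2 (Th e.1) - row e.2.1 (Th e.1)) = 0.
  by move=> e; have [m m0 md] := exists_orthogonal (row e.2.2 (Th e.1) - row e.2.1 (Th e.1)); exists m.
(* Off a plane that contains the edge, with normal [m e], the point [a] is in particular off the
   line of the edge. *)
have [a [aB aK] ha] := avoid_planes (fun e => row e.2.1 (Th e.1)) oK nK (fun e => (hm e).1).
(* Normal of the plane through [a] and the edge. A pair of equal vertices gets an arbitrary nonzero
   vector, since [avoid_planes] asks this of every index. *)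
pose nrm (e : E) : vec := if e.2.1 == e.2.2 then delta_mx 0 0 else
  cross (row e.2.1 (Th e.1) - a) (row e.2.2 (Th e.1) - a).
have nrm0 e : nrm e != 0.
  rewrite /nrm; case: ifPn => ij.
    by apply/negP => /eqP/rowP/(_ 0)/eqP; rewrite !mxE eqxx oner_eq0.
  have [m0 md] := hm e.
  have -> : cross (row e.2.1 (Th e.1) - a) (row e.2.2 (Th e.1) - a) =
      cross (row e.2.1 (Th e.1) - a) (row e.2.2 (Th e.1) - row e.2.1 (Th e.1)).
    by move: (row e.2.1 _) (row e.2.2 _) => r1 r2; apply: vec3P; rewrite !vecE; ring.
  apply: (cross_neq0 (m := m e)) => //; first exact: vtx_neq.
  by rewrite -opprB -scaleN1r dotZr mulN1r oppr_eq0.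
have [b [bB bL] hb] := avoid_planes (fun=> a) oL nL nrm0.
pose g (t : R) := a + t *: (b - a).
have gB t : 0 <= t <= 1 -> B (g t) by move=> t01; exact: Bconv.
have gcont : continuous g.
  move=> t; apply: cvgD; first exact: cvg_cst.
  by apply: cvgZr_tmp; exact: cvg_id.
pose UA := \bigcup_(J in [set J | c J = c K]) tet Th J.
pose UB := \bigcup_(J in [set J | c J != c K]) tet Th J.
have UAc : closed UA.
  by apply: closed_bigcup => [|J _]; [exact: finite_finset|exact/tet_closed/nd].
have UBc : closed UB.
  by apply: closed_bigcup => [|J _]; [exact: finite_finset|exact/tet_closed/nd].
have UAB z : B z -> UA z \/ UB z.
  move=> /BO /(mesh_cover hmesh)[J zJ]; have [e|e] := eqVneq (c J) (c K).
    by left; exists J.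
  by right; exists J.
(* The closed sets [UA] and [UB] cover the segment and each contains one end, so by connectedness
   they meet on it. *)
have [t [t01 gA gBt]] : exists t, [/\ 0 <= t <= 1, UA (g t) & UB (g t)].
  apply: contrapT => hn.
  have hn' t : 0 <= t <= 1 -> UA (g t) -> ~ UB (g t) by move=> h1 h2 h3; apply: hn; exists t.
  have itvE : [set` `[0%R, 1%R]] = [set t : R | 0 <= t <= 1].
    by apply/seteqP; split=> t /=; rewrite in_itv.
  have H : [set t | 0 <= t <= 1] `&` (g @^-1` UA) = [set t | 0 <= t <= 1].
    rewrite -[RHS]itvE; apply: segment_connected; rewrite itvE.
    - exists 0; split; rewrite /= ?lexx ?ler01//.
      exists K => //; rewrite /g scale0r addr0; exact: (otet_sub (nd K)).
    - exists (g @^-1` (~` UB)).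
        by apply: open_comp => [t _|]; [exact: gcont|exact: closed_openC].
      apply/seteqP; split=> t [t01 h]; split=> //=; first exact: hn'.
      by have [] := UAB _ (gB t t01).
    - by exists (g @^-1` UA) => //; apply: closed_comp => // t _; exact: gcont.
  have one : [set t : R | 0 <= t <= 1] 1 by rewrite /= ler01 lexx.
  have [_ gA] : ([set t | 0 <= t <= 1] `&` (g @^-1` UA)) 1 by rewrite H.
  apply: (hn' 1) => //; exists L; first by rewrite /= eq_sym.
  by rewrite /g scale1r addrC subrK; exact: (otet_sub (nd L)).
have [K' cK' yK'] := gA; have [L' cL' yL'] := gBt.
have KL' : K' != L' by apply: contraNneq cL' => <-; rewrite /= cK'.
have hdis := mesh_disjoint hmesh KL'.
have [_ _ _ /(_ _ _ KL')[A [A' [hA hA']]]] := hmesh.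
(* On an edge line, [g t] would lie in the plane of [a] and that edge. As [b] does not, [t = 0]; but
   [a] itself is off the line. *)
have noline J (p q : 'I_4) (s : R) : p != q ->
    g t = row p (Th J) + s *: (row q (Th J) - row p (Th J)) -> False.
  move=> pq gE; have := hb (J, (p, q)); rewrite /nrm /= (negbTE pq).
  set N0 := cross _ _ => hN.
  have : t * dot N0 (b - a) = 0.
    rewrite -dotZr (_ : t *: (b - a) = g t - a); last by rewrite /g addrAC subrr add0r.
    rewrite gE /N0; move: (row p _) (row q _) => r1 r2; rewrite dotE !vecE; ring.
  move/eqP; rewrite mulf_eq0 (negbTE hN) orbF => /eqP t0.
  have := ha (J, (p, q)); have [_ /= md] := hm (J, (p, q)); rewrite /= => /negP; apply.
  move: gE; rewrite /g t0 scale0r addr0 => ->.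
  by rewrite addrAC subrr add0r dotZr md mulr0.
(* Missing two vertices would put [g t] on an edge line, so the common simplex misses exactly one:
   it is a face. *)
have one_out J (S : {set 'I_4}) : simplex (Th J) S (g t) -> S != [set: 'I_4]%SET -> exists i, S = [set~ i]%SET.
  move=> gS SnT; have [i iS] : exists i, i \notin S.
    apply: contrapT => h; move/negP: SnT; apply; apply/eqP/setP => i; rewrite inE.
    by apply/negPn/negP => iS; apply: h; exists i.
  exists i; apply/setP => j; rewrite !inE; have [->|ji] := eqVneq j i.
    exact/negbTE.
  apply/negPn/negP => jS; have [p [q [s [pq gE]]]] := simplex_line ji jS iS gS.
  exact: noline pq gE.
have yA : simplex (Th K') A (g t) by rewrite -hA.
have yA' : simplex (Th L') A' (g t) by rewrite -hA'.
have AnT : A != [set: 'I_4]%SET.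
  apply/eqP => AT; apply: (simplex_full (nd K') (nd L') (A := A') _ hdis).
  by rewrite -hA' hA AT.
have A'nT : A' != [set: 'I_4]%SET.
  apply/eqP => AT; apply: (simplex_full (nd L') (nd K') (A := A)).
    by rewrite -hA hA' AT.
  by rewrite setIC.
have [i Ai] := one_out _ _ yA AnT; have [j Aj] := one_out _ _ yA' A'nT.
have := @hc (K', i) (L', j) KL'; rewrite /hface /= -Ai -Aj -hA -hA' => /(_ erefl).
by move=> h; move/eqP: cL'; rewrite -h.
Qed.

(** The elements that share the value of [K] and the others form two closed unions. They cover [Om]
    and, by [mesh_local_const], do not meet inside it, while every element meets [Om]; connectedness
    concludes. *)
Lemma mesh_const K L : c K = c L.
Proof.
have [_ Oo Ocon _ _] := hOm.
apply: contrapT => /eqP cKL.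
pose UA := \bigcup_(J in [set J | c J = c K]) tet Th J.
pose UB := \bigcup_(J in [set J | c J != c K]) tet Th J.
have UAc : closed UA.
  by apply: closed_bigcup => [|J _]; [exact: finite_finset|exact/tet_closed/nd].
have UBc : closed UB.
  by apply: closed_bigcup => [|J _]; [exact: finite_finset|exact/tet_closed/nd].
have inO J : exists2 z, Om z & tet Th J z.
  have [z zo] := otet_neq0 (nd J); exists z; first exact: (otet_sub_domain hOm hmesh) zo.
  exact: (otet_sub (nd J)).
have H : Om `&` UA = Om.
  apply: Ocon.
  - by have [z Oz zK] := inO K; exists z; split => //; exists K.
  - exists (~` UB); first exact: closed_openC.
    apply/seteqP; split=> z [Oz h]; split=> //.
      move=> [J cJ zJ]; have [J' cJ' zJ'] := h; move/eqP: cJ; apply.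
      by rewrite -cJ'; exact: (mesh_local_const Oz).
    have [J zJ] := mesh_cover hmesh Oz; exists J => //=.
    by apply: contrapT => /eqP cJ; apply: h; exists J.
  - by exists UA.
have [z Oz zL] := inO L; move: Oz; rewrite -H => -[Oz [J cJ zJ]].
move/eqP: cKL; apply; rewrite -cJ; exact: (mesh_local_const Oz).
Qed.

End Adjacency.

Lemma domain_null : leb3 (@pt3 R @^-1` Om `\` \bigcup_(K in [set: 'I_N]) ovol (Th K)) = 0%E.
Proof.
have [_ Oo _ _ _] := hOm.
have mU : measurable (\bigcup_(K in [set: 'I_N]) ovol (Th K)).
  by apply: fin_bigcup_measurable; [exact: finite_finset|move=> K _; exact: measurable_ovol].
have mD := measurableD (measurable_open Oo) mU.
apply/(measure_negligible mD).
pose F k := if insub k is Some K then @pt3 R @^-1` tet Th K `\` ovol (Th K) else set0.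
apply: (@negligibleS _ _ _ _ (\bigcup_k F k)); last first.
  apply: negligible_bigcup => k; rewrite /F; case: insubP => [K _ _|_]; last exact: negligible_set0.
  exists (@pt3 R @^-1` tet Th K `\` ovol (Th K)); split => //; last exact: tet_skeleton_null (nd K).
  by apply: measurableD; [exact: measurable_tet (nd K)|exact: measurable_ovol].
move=> t [Ot nt]; have [K tK] := mesh_cover hmesh Ot.
exists (val K) => //; rewrite /F valK; split=> // tKo; apply: nt; by exists K.
Qed.

End MeshTopology.

(** * Linear systems on finitely generated subspaces *)

Section LinearAlgebra.
Context (R : realType).

(** Polynomials without a degree bound are not finite dimensional, so a subspace is carried by a
    finite generating family, not necessarily free. *)
Definition spans (W : lmodType R) (J : finType) (e : J -> W) (S : W -> Prop) : Prop :=
  (forall c : J -> R, S (\sum_j c j *: e j)) /\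
  (forall y, S y -> exists c : J -> R, y = \sum_j c j *: e j).

(** A bare predicate, so that [islin] can check composite expressions by their shape. *)
Definition is_lin (W V : lmodType R) (f : W -> V) : Prop :=
  forall (a : R) x y, f (a *: x + y) = a *: f x + f y.

Lemma lin0 (W V : lmodType R) (f : W -> V) : is_lin f -> f 0 = 0.
Proof.
move=> hf; have := hf 1 0 0; rewrite !scale1r addr0 => h.
by apply: (@addrI _ (f 0)); rewrite addr0 -h.
Qed.

Lemma lin_sum (W V : lmodType R) (f : W -> V) (J : finType) (c : J -> R) (e : J -> W) :
  is_lin f -> f (\sum_j c j *: e j) = \sum_j c j *: f (e j).
Proof.
move=> hf; elim/big_rec2: _ => [|j y x _ <-]; first exact: lin0.
by rewrite hf.
Qed.

Lemma spans_lincomb (W : lmodType R) (J : finType) (e : J -> W) S (a : R) x y :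
  spans e S -> S x -> S y -> S (a *: x + y).
Proof.
move=> [h1 h2] /h2[c ->] /h2[d ->]; have := h1 (fun j => a * c j + d j).
congr S; rewrite scaler_sumr -big_split; apply: eq_bigr => j _ /=.
by rewrite scalerDl scalerA.
Qed.

Lemma spans_prod (W1 W2 : lmodType R) (J1 J2 : finType) (e1 : J1 -> W1) (e2 : J2 -> W2) S1 S2 :
  spans e1 S1 -> spans e2 S2 ->
  spans (fun j : J1 + J2 => match j with inl i => (e1 i, 0) | inr i => (0, e2 i) end : W1 * W2)
    (fun y => S1 y.1 /\ S2 y.2).
Proof.
move=> [h1 g1] [h2 g2].
have key (c : J1 + J2 -> R) :
    \sum_j c j *: (match j with inl i => (e1 i, 0) | inr i => (0, e2 i) end : W1 * W2) =
    (\sum_i c (inl i) *: e1 i, \sum_i c (inr i) *: e2 i).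
  rewrite big_sumType /=.
  have E1 : \sum_i c (inl i) *: (e1 i, 0 : W2) = (\sum_i c (inl i) *: e1 i, 0).
    elim/big_rec2: _ => [//|i y x _ ->].
    by apply/pair_eqP; rewrite /= scaler0 addr0 !eqxx.
  have E2 : \sum_i c (inr i) *: (0 : W1, e2 i) = (0, \sum_i c (inr i) *: e2 i).
    elim/big_rec2: _ => [//|i y x _ ->].
    by apply/pair_eqP; rewrite /= scaler0 addr0 !eqxx.
  by rewrite E1 E2; apply/pair_eqP; rewrite /= addr0 add0r !eqxx.
split=> [c|[y1 y2] [/= /g1[c1 ->] /g2[c2 ->]]]; first by rewrite key; split; [exact: h1|exact: h2].
by exists (fun j => match j with inl i => c1 i | inr i => c2 i end); rewrite key.
Qed.

Lemma spans_ffun (W : lmodType R) (J I : finType) (e : J -> W) S : spans e S ->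
  spans (fun ij : I * J => [ffun i => if i == ij.1 then e ij.2 else 0] : {ffun I -> W})
    (fun f => forall i, S (f i)).
Proof.
move=> [h g].
have key (c : I * J -> R) i :
    (\sum_ij c ij *: ([ffun i => if i == ij.1 then e ij.2 else 0] : {ffun I -> W})) i =
    \sum_j c (i, j) *: e j.
  transitivity (\sum_i' \sum_j c (i', j) *: (if i == i' then e j else 0)).
    by rewrite sum_ffunE pair_bigA; apply: eq_bigr => -[i' j] _; rewrite !ffunE.
  rewrite (bigD1 i)//= [X in _ + X]big1 ?addr0; first by rewrite eqxx.
  move=> i' ii; rewrite big1// => j _.
  by rewrite eq_sym (negbTE ii) scaler0.
split=> [c i|f hf]; first by rewrite key; exact: h.
have /choice[c hc] : forall i, exists c : J -> R, f i = \sum_j c j *: e j by move=> i; exact: g.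
by exists (fun ij => c ij.1 ij.2); apply/ffunP => i; rewrite key hc.
Qed.

(** The bounded monomials of index [k.+1] are those of degree at most [k]. *)
Lemma spans_mpoly (k : nat) :
  spans (fun m : bmultinom 3 k.+1 => mpolyX R m) (fun p => (mmeasure mdeg p <= k.+1)%N).
Proof.
split=> [c|p hp]; last by exists (fun m : bmultinom 3 k.+1 => mcoeff m p); exact: mpolywE.
apply: (leq_trans (mmeasure_sum _ _ _ _)); apply/bigmax_leqP => m _.
by apply: (leq_trans (mmeasureZ_le _ _ _)); rewrite mmeasureX /= bmdeg.
Qed.

Lemma sum_enum_val (J : finType) (F : J -> R) :
  \sum_j F j = \sum_(i < #|J|) F (enum_val i).
Proof.
rewrite (reindex (fun i : 'I_#|J| => enum_val i))//=.
by exists enum_rank => x _; [exact: enum_valK|exact: enum_rankK].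
Qed.

(** Serves to impose the zero-mean condition: in coordinates the kernel of [m] is generated by the
    rows of [kermx M]. *)
Lemma spans_ker (W : lmodType R) (J : finType) (e : J -> W) S (m : W -> R) :
  is_lin (V := R^o) m -> spans e S ->
  exists (J' : finType) (e' : J' -> W), spans e' (fun y => S y /\ m y = 0).
Proof.
move=> hm he; have [h g] := he.
pose M : 'cV[R]_#|J| := \col_i m (e (enum_val i)).
pose f (r : 'rV[R]_#|J|) : W := \sum_j r 0 (enum_rank j) *: e j.
have fS r : S (f r) by exact: h.
have fm r : m (f r) = (r *m M) 0 0.
  rewrite /f (lin_sum (V := R^o))// mxE [LHS]sum_enum_val.
  by apply: eq_bigr => i _; rewrite enum_valK mxE.
have flin n (d : 'I_n -> R) (r : 'I_n -> 'rV[R]_#|J|) :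
    f (\sum_i d i *: r i) = \sum_i d i *: f (r i).
  rewrite /f; under [RHS]eq_bigr do rewrite scaler_sumr.
  rewrite exchange_big; apply: eq_bigr => j _; rewrite summxE scaler_suml.
  by apply: eq_bigr => i _; rewrite mxE scalerA.
exists 'I_#|J|, (fun i => f (row i (kermx M))); split=> [c|y [/g[c ->] my]].
  rewrite -flin; split=> //; rewrite fm.
  have -> : \sum_i c i *: row i (kermx M) = (\row_i c i) *m kermx M.
    by rewrite mulmx_sum_row; apply: eq_bigr => i _; rewrite mxE.
  by rewrite -mulmxA mulmx_ker mulmx0 mxE.
pose r : 'rV[R]_#|J| := \row_i c (enum_val i).
have yE : \sum_j c j *: e j = f r.
  by apply: eq_bigr => j _; rewrite mxE enum_rankK.
rewrite yE fm in my.
have /submxP[D rD] : (r <= kermx M)%MS.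
  by apply/sub_kermxP/rowP => i; rewrite ord1 my mxE.
exists (fun i => D 0 i); rewrite yE -flin rD mulmx_sum_row; congr f.
Qed.

(** [A] is the matrix of [B] on the generators. The load [L] is in its row space as soon as it kills
    [cokermx A], and each column of that matrix gives a [y] with [B x y = 0] for all [x], an element
    of the transposed kernel. *)
Lemma fredholm (W : lmodType R) (J : finType) (e : J -> W) S (B : W -> W -> R) (l : W -> R) :
  spans e S -> (forall y, is_lin (V := R^o) (B^~ y)) -> (forall x, is_lin (V := R^o) (B x)) ->
  is_lin (V := R^o) l ->
  (forall y, S y -> (forall x, S x -> B x y = 0) -> l y = 0) ->
  exists2 x, S x & forall y, S y -> B x y = l y.
Proof.
move=> he hBl hBr hl hker; have [h g] := he.
pose A : 'M[R]_#|J| := \matrix_(i, j) B (e (enum_val i)) (e (enum_val j)).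
pose L : 'rV[R]_#|J| := \row_j l (e (enum_val j)).
have /submxP[D DA] : (L <= A)%MS.
  rewrite submxE; apply/eqP/rowP => k; rewrite [RHS]mxE.
  pose y := \sum_j cokermx A (enum_rank j) k *: e j.
  have Sy : S y by exact: h.
  have ly : l y = (L *m cokermx A) 0 k.
    rewrite /y (lin_sum (V := R^o))// [LHS]sum_enum_val mxE; apply: eq_bigr => i _.
    by rewrite enum_valK [L 0 i]mxE; exact: mulrC.
  rewrite -ly; apply: hker => // x /g[c ->].
  rewrite (lin_sum (V := R^o) c e (hBl y)) big1// => j _.
  suff -> : B (e j) y = 0 by exact: mulr0.
  rewrite /y (lin_sum (V := R^o))// [LHS]sum_enum_val.
  have := mulmx_coker A => /matrixP/(_ (enum_rank j) k); rewrite !mxE => E.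
  transitivity (\sum_i A (enum_rank j) i * cokermx A i k); last exact: E.
  by apply: eq_bigr => i _; rewrite enum_valK [A _ _]mxE enum_rankK; exact: mulrC.
pose x := \sum_j D 0 (enum_rank j) *: e j.
exists x; first exact: h.
move=> y /g[c ->]; rewrite !(lin_sum (V := R^o))//; apply: eq_bigr => j _; congr (_ *: _).
rewrite /x (lin_sum (V := R^o) _ e (hBl (e j))) [LHS]sum_enum_val.
have := DA => /rowP/(_ (enum_rank j)); rewrite !mxE enum_rankK => ->.
by apply: eq_bigr => i _; rewrite enum_valK mxE enum_rankK.
Qed.

End LinearAlgebra.

(** * Rules for checking linearity *)

Section LinearMaps.
Context (R : realType) (W : lmodType R).
Local Notation poly := (mpoly 3 R).

Lemma is_lin_id : is_lin (fun y : W => y).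
Proof. by []. Qed.

Lemma is_lin_cst0 (V : lmodType R) : is_lin (fun _ : W => 0 : V).
Proof. by move=> a x y; rewrite scaler0 addr0. Qed.

Lemma is_lin_fst (V1 V2 : lmodType R) (f : W -> V1 * V2) : is_lin f -> is_lin (fun y => (f y).1).
Proof. by move=> hf a x y; rewrite hf. Qed.

Lemma is_lin_snd (V1 V2 : lmodType R) (f : W -> V1 * V2) : is_lin f -> is_lin (fun y => (f y).2).
Proof. by move=> hf a x y; rewrite hf. Qed.

Lemma is_lin_app (I : finType) (V : lmodType R) (f : W -> {ffun I -> V}) i :
  is_lin f -> is_lin (fun y => f y i).
Proof. by move=> hf a x y; rewrite hf !ffunE. Qed.

Lemma is_lin_add (V : lmodType R) (f g : W -> V) :
  is_lin f -> is_lin g -> is_lin (fun y => f y + g y).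
Proof. by move=> hf hg a x y; rewrite hf hg scalerDr addrACA. Qed.

Lemma is_lin_opp (V : lmodType R) (f : W -> V) : is_lin f -> is_lin (fun y => - f y).
Proof. by move=> hf a x y; rewrite hf opprD scalerN. Qed.

Lemma is_lin_scale (V : lmodType R) (f : W -> V) (b : R) : is_lin f -> is_lin (fun y => b *: f y).
Proof. by move=> hf a x y; rewrite hf scalerDr !scalerA mulrC. Qed.

Lemma is_lin_mulc (f : W -> R) (b : R) :
  is_lin (V := R^o) f -> is_lin (V := R^o) (fun y => b * f y).
Proof. exact: (@is_lin_scale R^o). Qed.

Lemma is_lin_sum (V : lmodType R) (I : Type) (r : seq I) (p : pred I) (f : I -> W -> V) :
  (forall i, is_lin (f i)) -> is_lin (fun y => \sum_(i <- r | p i) f i y).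
Proof.
move=> hf a x y; rewrite scaler_sumr -big_split /=.
by apply: eq_bigr => i _; exact: hf.
Qed.

Lemma is_lin_mull (f : W -> poly) (P : poly) : is_lin f -> is_lin (fun y => P * f y).
Proof. by move=> hf a x y; rewrite hf mulrDr scalerAr. Qed.

Lemma is_lin_mulr (f : W -> poly) (P : poly) : is_lin f -> is_lin (fun y => f y * P).
Proof. by move=> hf a x y; rewrite hf mulrDl scalerAl. Qed.

Lemma is_lin_mderiv (f : W -> poly) (i : 'I_3) : is_lin f -> is_lin (fun y => mderiv i (f y)).
Proof. by move=> hf a x y; rewrite hf mderivD mderivZ. Qed.

Lemma is_lin_nth (V : lmodType R) (f0 f1 f2 : W -> V) (i : 'I_3) :
  is_lin f0 -> is_lin f1 -> is_lin f2 -> is_lin (fun y => [:: f0 y; f1 y; f2 y]`_i).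
Proof. by move=> h0 h1 h2 a x y; elim/ord3P: i => /=; [exact: h0|exact: h1|exact: h2]. Qed.

Lemma is_lin_two_sided (N : nat) (V : lmodType R) (f : half_face N -> W -> V) (e : mface N) :
  (forall F, is_lin (f F)) -> is_lin (fun y => two_sided (fun F => f F y) e).
Proof.
move=> hf; rewrite /two_sided; case: e.2 => [G|]; apply: is_lin_add => //.
exact: is_lin_cst0.
Qed.

Lemma is_lin_average (N : nat) (V : lmodType R) (f : half_face N -> W -> V) (e : mface N) :
  (forall F, is_lin (f F)) -> is_lin (fun y => average (fun F => f F y) e).
Proof.
move=> hf; rewrite /average; case: e.2 => [G|] //.
by apply: is_lin_scale; exact: is_lin_add.
Qed.

End LinearMaps.

(** * The forms on polynomial pieces *)

Section PolyForms.
Context (R : realType) (N : nat) (Th : 'I_N -> 'M[R]_(4, 3)) (Gam Sig : set 'rV[R]_3).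
Local Notation vec := 'rV[R]_3.
Local Notation mR := (measurableTypeR R).
Local Notation R3 := (mR * mR * mR)%type.
Local Notation poly := (mpoly 3 R).
Local Notation pvec := ('I_3 -> poly).
Local Notation vpieces := {ffun 'I_N * 'I_3 -> poly}.
Local Notation pieces := {ffun 'I_N -> poly}.
Variables (nu sigma c11 a11 d11 : R) (beta : 'I_3 -> R3 -> R).
Implicit Types (P Q : poly) (p q : pvec) (K : 'I_N) (F : half_face N) (e : mface N).

(** The operations and forms are copied to polynomials, where traces are plain evaluations and
    linearity is algebraic; the representation lemmas relate the copies to the originals. *)
Definition pdot p q : poly := \sum_i p i * q i.

Definition pcross p q : pvec := fun i =>
  [:: p 1 * q 2 - p 2 * q 1; p 2 * q 0 - p 0 * q 2; p 0 * q 1 - p 1 * q 0]`_i.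

Definition cst_vec (n : vec) : pvec := fun i => mpolyC 3 (n 0 i).

Definition pcurl p : pvec := fun i =>
  [:: mderiv 1 (p 2) - mderiv 2 (p 1); mderiv 2 (p 0) - mderiv 0 (p 2);
      mderiv 0 (p 1) - mderiv 1 (p 0)]`_i.

Definition pdiv p : poly := \sum_i mderiv i (p i).

Definition faceI F P : R :=
  enorm (farea_vec Th F) * triI (fv (Th F.1) F.2 0) (fv (Th F.1) F.2 1) (fv (Th F.1) F.2 2) P.

Definition piece (U : vpieces) K : pvec := fun i => U (K, i).

Definition pnormal F : pvec := cst_vec (face_normal Th F).

Definition pjumpT (U : vpieces) e : pvec :=
  fun i => two_sided (fun F => pcross (piece U F.1) (pnormal F) i) e.
Definition pjumpN (U : vpieces) e : poly :=
  two_sided (fun F => pdot (piece U F.1) (pnormal F)) e.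
Definition pjump (P : pieces) e : pvec :=
  fun i => two_sided (fun F => P F.1 * pnormal F i) e.
Definition pavg_vec (U : vpieces) e : pvec := fun i => average (fun F => U (F.1, i)) e.
Definition pavg (P : pieces) e : poly := average (fun F => P F.1) e.

Definition pform_a (U V : vpieces) : R :=
  sigma * \sum_K volI (Th K) (pdot (piece U K) (piece V K)).
Definition pform_d (U V : vpieces) : R := \sum_K volI (Th K) (pdot (piece U K) (piece V K)).
(* [(T x beta) . V = beta . (V x T)]. *)
Definition pform_c (T V : vpieces) : R := (Num.sqrt nu)^-1 *
  \sum_K \sum_j wint (@leb3 R) (ovol (Th K)) (@pt3 R) (beta j) (pcross (piece V K) (piece T K) j).
Definition pform_b1 (U T : vpieces) : R :=
  Num.sqrt nu * (\sum_K volI (Th K) (pdot (pcurl (piece T K)) (piece U K)))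
  + Num.sqrt nu * (\sum_(e : mface N | internal Th e || face_on Th Gam e)
      faceI e.1 (pdot (pavg_vec U e) (pjumpT T e))).
Definition pform_b2 (V : vpieces) (P : pieces) : R :=
  - (\sum_K volI (Th K) (P K * pdiv (piece V K)))
  + \sum_(e : mface N | internal Th e || face_on Th Gam e) faceI e.1 (pavg P e * pjumpN V e).
Definition pform_j (U V : vpieces) : R :=
  Num.sqrt nu * (\sum_(e : mface N | internal Th e || face_on Th Sig e)
     faceI e.1 (C11 Th c11 e *: pdot (pjumpT U e) (pjumpT V e)))
  + \sum_(e : mface N | internal Th e || face_on Th Gam e)
      faceI e.1 (A11 Th a11 e *: (pjumpN U e * pjumpN V e)).
Definition pform_e (P Q : pieces) : R :=
  \sum_(e : mface N | internal Th e || face_on Th Sig e)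
     faceI e.1 (D11 Th d11 e *: pdot (pjump P e) (pjump Q e)).

Definition dofs : lmodType R := (vpieces * vpieces * pieces)%type.

(** The three equations added up. The signs of the second and third make the [b1] and [b2] terms
    cancel for [y = z]. *)
Definition pform (y z : dofs) : R :=
  (pform_a y.1.1 z.1.1 + pform_b1 z.1.1 y.1.2 + pform_b2 z.1.1 y.2 + pform_c y.1.2 z.1.1
   + pform_j y.1.1 z.1.1) +
  (pform_d y.1.2 z.1.2 - pform_b1 y.1.1 z.1.2) + (pform_e y.2 z.2 - pform_b2 y.1.1 z.2).

Hypothesis hTh : forall K, nondegenerate (Th K).
Hypothesis hbeta : forall K j, (@leb3 R).-integrable (ovol (Th K)) (EFin \o beta j).

Lemma is_lin_volI (W : lmodType R) (f : W -> poly) K :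
  is_lin f -> is_lin (V := R^o) (fun y => volI (Th K) (f y)).
Proof.
move=> hf a x y; rewrite hf /volI wintP//.
- exact: measurable_ovol.
- by move=> i; apply: measurable_funTS; exact: measurable_pt3.
- exact: ovol_bounded.
- exact: integrable_one_ovol.
Qed.

Lemma is_lin_beta (W : lmodType R) (f : W -> poly) K j : is_lin f ->
  is_lin (V := R^o) (fun y => wint (@leb3 R) (ovol (Th K)) (@pt3 R) (beta j) (f y)).
Proof.
move=> hf a x y; rewrite hf wintP//.
- exact: measurable_ovol.
- by move=> i; apply: measurable_funTS; exact: measurable_pt3.
- exact: ovol_bounded.
Qed.

Lemma is_lin_triI (W : lmodType R) (f : W -> poly) (A B C : vec) :
  is_lin f -> is_lin (V := R^o) (fun y => triI A B C (f y)).
Proof.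
move=> hf a x y; rewrite hf /triI wintP//.
- exact: measurable_ref.
- by move=> i; apply: measurable_funTS; exact: measurable_tparam.
- exact: tparam_bounded.
- exact: integrable_one_ref.
Qed.

Lemma is_lin_faceI (W : lmodType R) (f : W -> poly) F :
  is_lin f -> is_lin (V := R^o) (fun y => faceI F (f y)).
Proof. by move=> hf; apply: is_lin_mulc; exact: is_lin_triI. Qed.

(** Follows the shape of the expression; projections and products with a fixed factor are left to
    the last case. *)
Ltac islin := repeat lazymatch goal with
  | |- is_lin (fun y => two_sided _ _) => apply: is_lin_two_sided => ?
  | |- is_lin (fun y => average _ _) => apply: is_lin_average => ?
  | |- is_lin (fun y => mderiv _ _) => apply: is_lin_mderiv
  | |- is_lin (fun y => volI _ _) => apply: is_lin_volI
  | |- is_lin (fun y => faceI _ _) => apply: is_lin_faceI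
  | |- is_lin (fun y => wint _ _ _ _ _) => apply: is_lin_beta
  | |- is_lin (fun y => bigop.body _ _ _) => apply: is_lin_sum => ?
  | |- is_lin (fun y => _ *: _) => apply: is_lin_scale
  | |- is_lin (fun y => _ + _) => apply: is_lin_add
  | |- is_lin (fun y => - _) => apply: is_lin_opp
  | |- is_lin (fun y => nth _ _ _) => apply: is_lin_nth
  | _ => first [ exact: is_lin_id | apply: is_lin_app | apply: is_lin_fst | apply: is_lin_snd
     | apply: is_lin_mull | apply: is_lin_mulr | apply: is_lin_mulc ]
  end.

Lemma pform_linl z : is_lin (V := R^o) (pform^~ z).
Proof.
rewrite /pform /pform_a /pform_b1 /pform_b2 /pform_c /pform_j /pform_d /pform_e.
rewrite /pdot /pdiv /pcurl /pjumpT /pjumpN /pjump /pavg_vec /pavg /pdot /pcross /piece.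
islin.
Qed.

Lemma pform_linr y : is_lin (V := R^o) (pform y).
Proof.
rewrite /pform /pform_a /pform_b1 /pform_b2 /pform_c /pform_j /pform_d /pform_e.
rewrite /pdot /pdiv /pcurl /pjumpT /pjumpN /pjump /pavg_vec /pavg /pdot /pcross /piece.
islin.
Qed.

(** Testing with two of the three components equal to 0 isolates one equation of the system; these
    are the terms that drop out. *)
Lemma pform_zero (U : vpieces) (P : pieces) :
  [/\ [/\ pform_a U 0 = 0, pform_d U 0 = 0, pform_d 0 U = 0 & pform_j U 0 = 0],
      [/\ pform_b1 U 0 = 0, pform_b1 0 U = 0, pform_b2 U 0 = 0 & pform_b2 0 P = 0],
      pform_c U 0 = 0 /\ pform_c 0 U = 0, pform_e P 0 = 0 /\ pform_e 0 P = 0 &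
      pform_a 0 U = 0 /\ pform_j 0 U = 0].
Proof.
split; split.
- apply: (@lin0 _ _ R^o (pform_a U)); rewrite /pform_a /pdot /piece; islin.
- apply: (@lin0 _ _ R^o (pform_d U)); rewrite /pform_d /pdot /piece; islin.
- apply: (@lin0 _ _ R^o (pform_d^~ U)); rewrite /pform_d /pdot /piece; islin.
- apply: (@lin0 _ _ R^o (pform_j U)).
  rewrite /pform_j /pjumpT /pjumpN /pdot /pcross /piece; islin.
- apply: (@lin0 _ _ R^o (pform_b1 U)).
  rewrite /pform_b1 /pjumpT /pdot /pcross /pcurl /piece; islin.
- apply: (@lin0 _ _ R^o (pform_b1^~ U)).
  rewrite /pform_b1 /pavg_vec /pdot /piece; islin.
- apply: (@lin0 _ _ R^o (pform_b2 U)); rewrite /pform_b2 /pavg; islin.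
- apply: (@lin0 _ _ R^o (pform_b2^~ P)).
  rewrite /pform_b2 /pjumpN /pdiv /pdot /piece; islin.
- apply: (@lin0 _ _ R^o (pform_c U)); rewrite /pform_c /pcross /piece; islin.
- apply: (@lin0 _ _ R^o (pform_c^~ U)); rewrite /pform_c /pcross /piece; islin.
- apply: (@lin0 _ _ R^o (pform_e P)); rewrite /pform_e /pjump /pdot; islin.
- apply: (@lin0 _ _ R^o (pform_e^~ P)); rewrite /pform_e /pjump /pdot; islin.
- apply: (@lin0 _ _ R^o (pform_a^~ U)); rewrite /pform_a /pdot /piece; islin.
- apply: (@lin0 _ _ R^o (pform_j^~ U)).
  rewrite /pform_j /pjumpT /pjumpN /pdot /pcross /piece; islin.
Qed.

End PolyForms.

Section RintegralExtra.
Context d (T : measurableType d) (R : realType) (mu : {measure set T -> \bar R}) (D : set T).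
Hypothesis mD : measurable D.

Lemma Rintegral_sum (I : Type) (r : seq I) (f : I -> T -> R) :
  (forall i, mu.-integrable D (EFin \o f i)) ->
  \int[mu]_(t in D) (\sum_(i <- r) f i t) = \sum_(i <- r) \int[mu]_(t in D) f i t.
Proof.
move=> hf; elim: r => [|i r IH].
  by under eq_Rintegral do rewrite big_nil; rewrite Rintegral_cst// mul0r big_nil.
under eq_Rintegral do rewrite big_cons.
rewrite RintegralD// ?IH ?big_cons//.
apply: (eq_integrable mD (fun t => \sum_(j <- r) (f j t)%:E)%E).
  by move=> t _; rewrite /= sumEFin.
by apply: (@integrable_sum _ _ _ mu D mD _ r xpredT (fun i => EFin \o f i)) => j _; exact: hf.
Qed.

(** Almost everywhere, since [beta] is bounded only up to a null set. *)
Lemma ae_le_normr_Rintegral (f g : T -> R) :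
  mu.-integrable D (EFin \o f) -> mu.-integrable D (EFin \o g) ->
  (forall t, D t -> 0 <= g t) -> {ae mu, forall t, D t -> `|f t| <= g t} ->
  `|\int[mu]_(t in D) f t| <= \int[mu]_(t in D) g t.
Proof.
move=> fi gi g0 fg; apply: le_trans (le_normr_Rintegral mD fi) _.
have fi' : mu.-integrable D (EFin \o (fun t => `|f t|)) by exact: integrable_norm.
apply: fine_le; [exact: integrable_fin_num fi'|exact: integrable_fin_num gi|].
apply: ae_ge0_le_integral => //.
- exact: measurable_int fi'.
- exact: measurable_int gi.
Qed.

End RintegralExtra.

(** * Coercivity and kernel *)

Section Energy.
Context (R : realType) (N : nat) (Th : 'I_N -> 'M[R]_(4, 3)) (Gam Sig : set 'rV[R]_3).
Local Notation vec := 'rV[R]_3.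
Local Notation mR := (measurableTypeR R).
Local Notation R3 := (mR * mR * mR)%type.
Local Notation poly := (mpoly 3 R).
Local Notation pvec := ('I_3 -> poly).
Local Notation vpieces := {ffun 'I_N * 'I_3 -> poly}.
Local Notation pieces := {ffun 'I_N -> poly}.
Variables (nu sigma c11 a11 d11 : R) (beta : 'I_3 -> R3 -> R).
Implicit Types (P Q : poly) (p q : pvec) (K : 'I_N) (F : half_face N) (e : mface N).
Hypothesis hTh : forall K, nondegenerate (Th K).

Lemma is_linZ (W V : lmodType R) (f : W -> V) a x : is_lin f -> f (a *: x) = a *: f x.
Proof. by move=> hf; have := hf a x 0; rewrite addr0 (lin0 hf) addr0. Qed.

Lemma is_linD (W V : lmodType R) (f : W -> V) x y : is_lin f -> f (x + y) = f x + f y.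
Proof. by move=> hf; have := hf 1 x y; rewrite !scale1r. Qed.

Lemma is_linN (W V : lmodType R) (f : W -> V) x : is_lin f -> f (- x) = - f x.
Proof. by move=> hf; rewrite -scaleN1r is_linZ// scaleN1r. Qed.

Lemma is_lin_big (W V : lmodType R) (f : W -> V) (I : Type) (r : seq I) (c : pred I) (g : I -> W) :
  is_lin f -> f (\sum_(i <- r | c i) g i) = \sum_(i <- r | c i) f (g i).
Proof.
move=> hf; elim/big_rec2: _ => [|i y x _ <-]; first exact: lin0.
by rewrite is_linD.
Qed.

Let volI_lin K : is_lin (V := R^o) (volI (Th K)).
Proof. exact: (is_lin_volI (f := id) hTh). Qed.
Let faceI_lin F : is_lin (V := R^o) (faceI Th F).
Proof. exact: (@is_lin_faceI R N Th poly id F). Qed.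

Lemma volI_sqr_ge0 K P : 0 <= volI (Th K) (P * P).
Proof. exact: wint_sqr_ge0. Qed.

(** The points of the open element where [P] is nonzero form an open set, which would have positive
    measure if it were nonempty. So [P] vanishes on the element, hence as a polynomial. *)
Lemma volI_sqr_eq0 K P : volI (Th K) (P * P) = 0 -> P = 0.
Proof.
move=> /wint_sqr_eq0 h.
have : {ae @leb3 R, forall t, ovol (Th K) t -> ev P (pt3 t) = 0}.
  apply: h; first exact: measurable_ovol.
  - by move=> i; apply: measurable_funTS; exact: measurable_pt3.
  - exact: ovol_bounded.
  - exact: ovol_finite.
move=> {}h; apply: (poly_eq0 (otet_open (V := Th K))); first exact: otet_neq0.
apply: contrapT => /existsNP[x /not_implyP[xo Px]].
pose O := otet (Th K) `&` [set x | ev P x != 0].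
have Oo : open O.
  apply: openI; first exact: otet_open.
  apply: (@open_comp _ _ (ev P) [set r | r != 0]); last exact: open_neq.
  by move=> z _; exact: ev_continuous.
have := open_leb3_gt0 Oo (ex_intro _ x (conj xo (introN eqP Px))).
have -> : leb3 (@pt3 R @^-1` O) = 0%E; last by rewrite ltxx.
apply/(measure_negligible (measurable_open Oo)); apply: negligibleS h.
by move=> t [/= to /eqP tP]/= /(_ to).
Qed.

Lemma faceI_sqr_ge0 F P : 0 <= faceI Th F (P * P).
Proof. by apply: mulr_ge0; [exact: sqrtr_ge0|exact: wint_sqr_ge0]. Qed.

Lemma farea_gt0 F : 0 < enorm (farea_vec Th F).
Proof. by apply: enorm_gt0; exact: fa_neq0 (hTh _) _. Qed.

Lemma faceI_sqr_ae F P : faceI Th F (P * P) = 0 ->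
  {ae @leb2 R, forall w, ref_tri w -> ev P (fparam Th F w) = 0}.
Proof.
move/eqP; rewrite mulf_eq0 (gt_eqF (farea_gt0 F)) /= => /eqP.
apply: wint_sqr_eq0.
- exact: measurable_ref.
- by move=> i; apply: measurable_funTS; exact: measurable_tparam.
- exact: tparam_bounded.
- exact: leb2_ref_lty.
Qed.

(** [P] need not be zero as a polynomial, but it vanishes almost everywhere on the face; this form
    is the one that cancels face terms. *)
Lemma faceI_sqr_eq0 F P Q : faceI Th F (P * P) = 0 -> faceI Th F (P * Q) = 0.
Proof.
move=> /faceI_sqr_ae h; rewrite /faceI triIE /Rintegral.
rewrite (@ae_eq_integral _ _ _ _ _ (cst 0%E) _ (@measurable_ref R)).
- by rewrite integral0 mulr0.
- have /measurable_int := integrable_tri (fv (Th F.1) F.2 0) (fv (Th F.1) F.2 1)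
    (fv (Th F.1) F.2 2) (P * Q) (integrable_one_ref R).
  by apply: eq_measurable_fun => w _ /=; rewrite mul1r.
- exact: measurable_cst.
- by apply: filterS h => w hw /= Dw; rewrite evM (hw Dw) mul0r.
Qed.

Lemma faceI_pdot_ge0 F p : 0 <= faceI Th F (pdot p p).
Proof. by rewrite /pdot (is_lin_big _ _ _ (faceI_lin F)) sumr_ge0// => i _; exact: faceI_sqr_ge0. Qed.

Lemma faceI_pdot_eq0 F p i : faceI Th F (pdot p p) = 0 -> faceI Th F (p i * p i) = 0.
Proof.
rewrite /pdot (is_lin_big _ _ _ (faceI_lin F)) => /eqP.
rewrite psumr_eq0 => [/allP/(_ i (mem_index_enum _))/eqP//|j _]; exact: faceI_sqr_ge0.
Qed.

Lemma volI_pdot_ge0 K p : 0 <= volI (Th K) (pdot p p).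
Proof. by rewrite /pdot (is_lin_big _ _ _ (volI_lin K)) sumr_ge0// => i _; exact: volI_sqr_ge0. Qed.

Lemma volI_pdot_eq0 K p i : volI (Th K) (pdot p p) = 0 -> p i = 0.
Proof.
rewrite /pdot (is_lin_big _ _ _ (volI_lin K)) => /eqP.
rewrite psumr_eq0 => [/allP/(_ i (mem_index_enum _))/eqP|j _]; last exact: volI_sqr_ge0.
exact: volI_sqr_eq0.
Qed.

Lemma hT_gt0 K : 0 < hT Th K.
Proof.
have [M hM] := tet_bounded (hTh K).
have v01 : row 0 (Th K) != row 1 (Th K).
  apply/eqP => h; have := lam_vertex (hTh K) 0 0.
  by rewrite h lam_vertex//= => /eqP; rewrite eq_sym oner_eq0.
have vT j : tet Th K (row j (Th K)).
  by apply/simplexP => //; split=> i; rewrite ?inE// lam_vertex.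
apply: (@lt_le_trans _ _ (enorm (row 0 (Th K) - row 1 (Th K)))).
  by rewrite enorm_gt0// subr_eq0.
apply: ub_le_sup; last by exists (row 0 (Th K)), (row 1 (Th K)); split=> //; exact: vT.
(* [ub_le_sup] needs the set of distances to be bounded: each coordinate difference is at most
   [M + M]. *)
exists (Num.sqrt (3 * (M + M) ^+ 2)) => _ [x [y [xK yK ->]]].
have key i : (x - y) 0 i * (x - y) 0 i <= (M + M) ^+ 2.
  have h : `|(x - y) 0 i| <= M + M.
    by rewrite addE oppE (le_trans (ler_normB _ _))// lerD// hM.
  rewrite -expr2 -real_normK ?num_real// ler_pXn2r// nnegrE; exact: le_trans h.
rewrite ler_wsqrtr// dotE; have := key 0; have := key 1; have := key 2; lra.
Qed.

Lemma max_hV_ge0 e : 0 <= max_hV Th e.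
Proof.
have h K : 0 <= (hT Th K)^-1 by rewrite invr_ge0 ltW// hT_gt0.
by rewrite /max_hV; case: e.2 => [G|//]; rewrite le_max h.
Qed.

Lemma max_h_gt0 e : 0 < max_h Th e.
Proof.
rewrite /max_h; case: e.2 => [G|]; last exact: hT_gt0.
by rewrite lt_max hT_gt0.
Qed.

Hypotheses (hc11 : 0 < c11) (ha11 : 0 < a11) (hd11 : 0 < d11).

Lemma pform_j_ge0 (U : vpieces) : 0 <= pform_j Th Gam Sig nu c11 a11 U U.
Proof.
apply: addr_ge0; last first.
  apply: sumr_ge0 => e _; rewrite (is_linZ _ _ (faceI_lin _)) mulr_ge0 ?faceI_sqr_ge0//.
  by rewrite mulr_ge0 ?max_hV_ge0// ltW.
apply: mulr_ge0; first exact: sqrtr_ge0.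
apply: sumr_ge0 => e _; rewrite (is_linZ _ _ (faceI_lin _)) mulr_ge0 ?faceI_pdot_ge0//.
by rewrite mulr_ge0 ?max_hV_ge0// ltW.
Qed.

Lemma pform_e_ge0 (P : pieces) : 0 <= pform_e Th Sig d11 P P.
Proof.
apply: sumr_ge0 => e _; rewrite (is_linZ _ _ (faceI_lin _)) mulr_ge0 ?faceI_pdot_ge0//.
by rewrite mulr_ge0 ?ltW ?max_h_gt0.
Qed.

Lemma pform_e_eq0 (P : pieces) e i : pform_e Th Sig d11 P P = 0 ->
  internal Th e || face_on Th Sig e -> faceI Th e.1 (pjump Th P e i * pjump Th P e i) = 0.
Proof.
move=> /eqP; rewrite psumr_eq0 => [/allP/(_ e (mem_index_enum _))|e' _]; last first.
  rewrite (is_linZ _ _ (faceI_lin _)) mulr_ge0 ?faceI_pdot_ge0//.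
  by rewrite mulr_ge0 ?ltW ?max_h_gt0.
move=> + he; rewrite he /= (is_linZ _ _ (faceI_lin _)) mulf_eq0.
rewrite (gt_eqF (mulr_gt0 hd11 (max_h_gt0 e))) /= => /eqP; exact: faceI_pdot_eq0.
Qed.

Hypotheses (hnu : 0 < nu) (hsigma : 0 < sigma).
Variable b : R.
Hypothesis b0 : 0 <= b.
Hypothesis hb : 2 * b ^+ 2 < nu * sigma.
Hypothesis hbeta : forall K j, (@leb3 R).-integrable (ovol (Th K)) (EFin \o beta j).
Hypothesis beta_le : forall j K, {ae @leb3 R, forall t, ovol (Th K) t -> `|beta j t| <= b}.

(* With [W = 3/4 |w|^2] and [U = sigma/2 |u|^2], [3 b^2 |u|^2 |w|^2 / nu] is at
   most [4 U W <= (U + W)^2]. *)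
Lemma advection_bound (u w bt : vec) : (forall j, `|bt 0 j| <= b) ->
  `|(Num.sqrt nu)^-1 * dot bt (cross u w)| <= 2^-1 * sigma * dot u u + 3 / 4 * dot w w.
Proof.
move=> hbt.
have h0 : 0 <= 2^-1 * sigma * dot u u + 3 / 4 * dot w w.
  by rewrite addr_ge0// mulr_ge0 ?dot_ge0// ?mulr_ge0// ?invr_ge0// ltW.
rewrite -(@ler_pXn2r _ 2)// ?nnegrE// real_normK ?num_real// exprMn exprVn sqr_sqrtr; last exact: ltW.
rewrite ler_pdivrMl//.
(* Lagrange's identity, here and for [h2]: the defect is the squared length of a cross product in
   the first and the square of a dot product in the second. *)
have h1 : dot bt (cross u w) ^+ 2 <= dot bt bt * dot (cross u w) (cross u w).
  have := dot_ge0 (cross bt (cross u w)).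
  move: (cross u w) => c; rewrite !dotE !crossE expr2; nra.
have h2 : dot (cross u w) (cross u w) <= dot u u * dot w w.
  have := sqr_ge0 (dot u w); rewrite !dotE !crossE expr2; nra.
have h3 : dot bt bt <= 3 * b ^+ 2.
  have key j : bt 0 j * bt 0 j <= b ^+ 2.
    by rewrite -expr2 -real_normK ?num_real// ler_pXn2r ?nnegrE.
  by rewrite dotE; have := key 0; have := key 1; have := key 2; lra.
have uw0 : 0 <= dot u u * dot w w by rewrite mulr_ge0 ?dot_ge0.
have h4 : dot bt (cross u w) ^+ 2 <= 3 * b ^+ 2 * (dot u u * dot w w).
  apply: le_trans h1 _; apply: ler_pM => //; exact: dot_ge0.
apply: le_trans h4 _.
have h5 : 3 * b ^+ 2 * (dot u u * dot w w) <= 3 / 2 * (nu * sigma) * (dot u u * dot w w).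
  apply: ler_wpM2r => //; move: (b ^+ 2) (nu * sigma) hb => B M BM; lra.
apply: le_trans h5 _.
have -> : 3 / 2 * (nu * sigma) * (dot u u * dot w w) =
   nu * (4 * (2^-1 * sigma * dot u u) * (3 / 4 * dot w w)) by field.
apply: ler_wpM2l; first exact: ltW.
have amgm (x y : R) : 4 * x * y <= (x + y) ^+ 2 by have := sqr_ge0 (x - y); rewrite !expr2; lra.
exact: amgm.
Qed.

Definition vev (p : pvec) (x : vec) : vec := \row_i ev (p i) x.

Lemma ev_pdot p q x : ev (pdot p q) x = dot (vev p x) (vev q x).
Proof. by rewrite /pdot ev_sum; apply: eq_bigr => i _; rewrite evM !mxE. Qed.

Lemma ev_pcross p q i x : ev (pcross p q i) x = cross (vev p x) (vev q x) 0 i.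
Proof. by elim/ord3P: i; rewrite crossE !mxE /pcross /= evB !evM. Qed.

Lemma volI_energy K p q : volI (Th K) ((2^-1 * sigma) *: pdot p p + (3 / 4) *: pdot q q) =
  2^-1 * sigma * volI (Th K) (pdot p p) + 3 / 4 * volI (Th K) (pdot q q).
Proof. by rewrite (is_linD _ _ (volI_lin K)) !(is_linZ _ _ (volI_lin K)). Qed.

Lemma advection_local K p q : `|(Num.sqrt nu)^-1 *
    \sum_j wint (@leb3 R) (ovol (Th K)) (@pt3 R) (beta j) (pcross p q j)| <=
  2^-1 * sigma * volI (Th K) (pdot p p) + 3 / 4 * volI (Th K) (pdot q q).
Proof.
have mD := measurable_ovol (Th K).
rewrite -volI_energy /wint.
rewrite -(Rintegral_sum (mu := @leb3 R) mD _
  (f := fun j t => beta j t * ev (pcross p q j) (pt3 t))); last first.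
  by move=> j; exact: integrable_ovol.
have si : (@leb3 R).-integrable (ovol (Th K))
    (EFin \o (fun t => \sum_j beta j t * ev (pcross p q j) (pt3 t))).
  apply: (eq_integrable mD (fun t => \sum_j (beta j t * ev (pcross p q j) (pt3 t))%:E)%E).
    by move=> t _; rewrite /= sumEFin.
  by apply: (@integrable_sum _ _ _ _ _ mD _ _ xpredT (fun j t => (beta j t * ev (pcross p q j) (pt3 t))%:E)) => j _; exact: integrable_ovol.
rewrite -RintegralZl// /volI /wint.
apply: ae_le_normr_Rintegral => //.
- exact: (integrableZl mD ((Num.sqrt nu)^-1) si).
- by apply: integrable_ovol => //; exact: integrable_one_ovol.
- move=> t _; rewrite mul1r evD !evZ !ev_pdot addr_ge0// mulr_ge0 ?dot_ge0//.
  by rewrite mulr_ge0 ?invr_ge0// ltW.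
- have h : {ae @leb3 R, forall t, forall j, ovol (Th K) t -> `|beta j t| <= b}.
    by apply: filter_forall => j; exact: beta_le.
  apply: filterS h => t ht Dt; rewrite mul1r evD !evZ !ev_pdot.
  have := @advection_bound (vev p (pt3 t)) (vev q (pt3 t)) (\row_j beta j t).
  rewrite /dot; under [X in _ * X]eq_bigr do rewrite mxE -ev_pcross.
  by apply=> j; rewrite mxE; exact: ht.
Qed.

(** The convective term takes [sigma / 2] of the velocity energy and 3/4 of the vorticity energy;
    the left side is what remains. *)
Lemma energy_bound (U W : vpieces) :
  \sum_K (2^-1 * sigma * volI (Th K) (pdot (piece U K) (piece U K)) +
          4^-1 * volI (Th K) (pdot (piece W K) (piece W K))) <=
  pform_a Th sigma U U + pform_c Th nu beta W U + pform_d Th W W.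
Proof.
rewrite /pform_a /pform_c /pform_d !mulr_sumr -!big_split; apply: ler_sum => K _ /=.
have := advection_local K (piece U K) (piece W K); rewrite ler_norml => /andP[+ _].
by move: (_ * \sum_j _) => r; lra.
Qed.

End Energy.

(** * The two sides of a face, and integration by parts *)

Section FaceSums.
Context (R : realType) (N : nat) (Th : 'I_N -> 'M[R]_(4, 3)) (Om Gam Sig : set 'rV[R]_3).
Local Notation poly := (mpoly 3 R).
Local Notation pvec := ('I_3 -> poly).
Local Notation vpieces := {ffun 'I_N * 'I_3 -> poly}.
Local Notation pieces := {ffun 'I_N -> poly}.
Implicit Types (P D : poly) (K : 'I_N) (F G : half_face N) (e : mface N).
Hypothesis hmesh : is_mesh_of Th Om.
Hypothesis hcomp : compatible Th Gam Sig.
Let hTh := mesh_nondeg hmesh.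

Lemma sum_option (I : finType) (c : pred (option I)) (g : option I -> R) :
  \sum_(o | c o) g o = (if c None then g None else 0) + \sum_(i | c (Some i)) g (Some i).
Proof.
rewrite (bigID (fun o => o == None)) /=; congr (_ + _).
  by rewrite big_mkcondl (big_pred1 None).
rewrite (reindex_omap Some id) => [|o /andP[_]]; last by case: o.
by apply: eq_bigl => i; rewrite eqxx !andbT.
Qed.

(** [internal] without the order of the element indices, hence symmetric. *)
Definition matched F G : bool := (F.1 != G.1) && `[< hface Th F = hface Th G >].

Lemma matched_uniq F G G' : matched F G -> matched F G' -> G' = G.
Proof.
move: G G' => [K i] [K' i'] /andP[/= FG /asboolP e1] /andP[/= FG' /asboolP e2].
have [KK|KK] := eqVneq K K'.
  rewrite -KK in e2 *; congr (_, _); apply: (face_inj (hTh K)).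
  by rewrite -[LHS]e2 e1.
by have [] := face_partner_uniq (hTh _) (hTh _) (hTh _) e1 e2 (mesh_disjoint hmesh FG)
  (mesh_disjoint hmesh FG') (mesh_disjoint hmesh KK).
Qed.

(** A half-face with a partner has exactly one and is counted once, in one internal face. Without a
    partner it is on the boundary: on [Gam], where it is counted, or on [Sig], where [h]
    vanishes. *)
Lemma sum_half_faces (h : half_face N -> R) :
  (forall F, face_on Th Sig (F, None) -> h F = 0) ->
  \sum_(e : mface N | internal Th e || face_on Th Gam e)
    (if e.2 is Some G then h e.1 + h G else h e.1) = \sum_F h F.
Proof.
move=> hS.
pose m F G := internal Th (F, Some G).
have mE F G : matched F G = m F G || m G F.
  rewrite /m /internal /matched /= neq_ltn.
  by case: (ltngtP F.1 G.1) => //= _; rewrite ?orbF//; apply/asboolP/asboolP.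
have mN F G : m F G -> m G F = false.
  by rewrite /m /internal /= => /andP[+ _]; case: ltngtP.
transitivity (\sum_F ((if face_on Th Gam (F, None) then h F else 0) +
    \sum_(G | m F G) (h F + h G))).
  rewrite -(pair_big_dep xpredT (fun F o => internal Th (F, o) || face_on Th Gam (F, o))
    (fun F o => if o is Some G then h F + h G else h F)) /=.
  apply: eq_bigr => F _; rewrite sum_option /=; congr (_ + _).
  by apply: eq_bigl => G; rewrite /face_on /= orbF.
rewrite big_split /=.
(* Exchanging the two sums assigns each term of [h F + h G] to its own half-face. *)
have -> : \sum_F \sum_(G | m F G) (h F + h G) = \sum_F \sum_(G | matched F G) h F.
  under eq_bigr do rewrite big_split /=.
  rewrite big_split /= [X in _ + X](exchange_big_dep xpredT)//= -big_split /=.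
  apply: eq_bigr => F _; rewrite [RHS](bigID (m F)) /=; congr (_ + _); apply: eq_bigl => G.
    by rewrite mE; case: (m F G); rewrite ?andbF.
  by rewrite mE; case: (boolP (m F G)) => [/mN ->//|_]; rewrite andbT.
rewrite -big_split /=; apply: eq_bigr => F _.
have [/existsP[G FG]|/existsPn hn] := boolP [exists G, matched F G].
  rewrite ifF; last first.
    apply/negP => /andP[_ /andP[/forallP/(_ G) + _]].
    move: FG => /andP[FG /asboolP hE]; rewrite eq_sym FG /= => /asboolPn; apply.
    exact/esym.
  rewrite (big_pred1 G) ?add0r// => G'; apply/idP/eqP => [|-> //]; exact: matched_uniq.
rewrite big_pred0 ?addr0 => [|G]; last exact/negbTE.
case: ifPn => // Fg.
have Fb : on_boundary Th F.
  apply/forallP => G; apply/implyP => GF; apply/asboolPn => hE.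
  have := hn G; rewrite /matched eq_sym GF /= => /asboolPn; apply; exact/esym.
symmetry; apply: hS; rewrite /face_on /= Fb /=; apply/asboolP.
have [h1|//] := hcomp Fb.
by move: Fg; rewrite /face_on /= Fb /= => /asboolPn[].
Qed.

Lemma enorm_onormal (V : 'M[R]_(4, 3)) i : nondegenerate V -> enorm (onormal V i) = enorm (fa V i).
Proof.
move=> hV; rewrite /onormal enorm_scale normrN normr_sg (fa_height_neq0 hV).
by rewrite mul1r.
Qed.

Lemma face_normalE F : face_normal Th F = (enorm (farea_vec Th F))^-1 *: onormal (Th F.1) F.2.
Proof. by rewrite /onormal scalerA mulrC. Qed.

Lemma onormal_face_normal F : onormal (Th F.1) F.2 = enorm (farea_vec Th F) *: face_normal Th F.
Proof. by rewrite face_normalE scalerA mulfV ?scale1r// gt_eqF// farea_gt0. Qed.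

Lemma face_normal_unit F : dot (face_normal Th F) (face_normal Th F) = 1.
Proof.
have h : enorm (face_normal Th F) = 1.
  rewrite face_normalE enorm_scale enorm_onormal// ger0_norm ?invr_ge0 ?sqrtr_ge0//.
  by rewrite mulVf// gt_eqF// farea_gt0.
by rewrite -(sqr_sqrtr (dot_ge0 _)) -/(enorm _) h expr1n.
Qed.

Lemma matched_onormal F G : matched F G -> onormal (Th G.1) G.2 = - onormal (Th F.1) F.2.
Proof.
move=> /andP[FG /asboolP hE].
exact: face_opposite (hTh _) (hTh _) hE (mesh_disjoint hmesh FG).
Qed.

Lemma matched_area F G : matched F G -> enorm (farea_vec Th G) = enorm (farea_vec Th F).
Proof.
move=> FG; rewrite -[LHS](enorm_onormal G.2 (hTh G.1)) -[RHS](enorm_onormal F.2 (hTh F.1)).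
by rewrite (matched_onormal FG) -scaleN1r enorm_scale normrN1 mul1r.
Qed.

Lemma matched_normal F G : matched F G -> face_normal Th G = - face_normal Th F.
Proof.
by move=> FG; rewrite !face_normalE (matched_area FG) (matched_onormal FG) scalerN.
Qed.

Lemma matched_faceI F G P : matched F G -> faceI Th G P = faceI Th F P.
Proof.
move=> FG; rewrite /faceI (matched_area FG); have [_ /asboolP hE] := andP FG.
have tE := etrans (esym (faceE (Th G.1) G.2)) (etrans (esym hE) (faceE (Th F.1) F.2)).
by rewrite (triI_eq P (fa_neq0 (hTh G.1) G.2) (fa_neq0 (hTh F.1) F.2) tE).
Qed.

Let faceI_lin F : is_lin (V := R^o) (faceI Th F).
Proof. exact: (@is_lin_faceI R N Th poly id F). Qed.
Let volI_lin K : is_lin (V := R^o) (volI (Th K)).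
Proof. exact: (is_lin_volI (f := id) hTh). Qed.

(** The normal is a unit vector, so [D * D] is the sum of the squares of the components of [D] times
    the normal. *)
Lemma face_normal_component F D :
  (forall i, faceI Th F ((D * pnormal Th F i) * (D * pnormal Th F i)) = 0) -> faceI Th F (D * D) = 0.
Proof.
move=> h; have -> : D * D = \sum_i (D * pnormal Th F i) * (D * pnormal Th F i).
  under eq_bigr do rewrite mulrACA -[pnormal Th F _ * _]mpolyCM.
  rewrite -mulr_sumr -(raddf_sum (mpolyC 3 (R := R))).
  by have := face_normal_unit F; rewrite {1}/dot => ->; rewrite mulr1.
by rewrite (is_lin_big _ _ _ (faceI_lin F)) big1.
Qed.

Variable d11 : R.
Hypothesis hd11 : 0 < d11.

(** The two normals are opposite, so the jump is the difference of the two pieces times one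
    normal. *)
Lemma jump_internal (P : pieces) F G : pform_e Th Sig d11 P P = 0 -> internal Th (F, Some G) ->
  faceI Th F ((P F.1 - P G.1) * (P F.1 - P G.1)) = 0.
Proof.
move=> he hi; have FG : matched F G.
  by move: hi; rewrite /internal /matched /= neq_ltn => /andP[-> ->].
apply: face_normal_component => i.
have := @pform_e_eq0 _ _ _ _ _ hTh hd11 P (F, Some G) i he.
have -> : pjump Th P (F, Some G) i = (P F.1 - P G.1) * pnormal Th F i.
  by rewrite /pjump /two_sided /= [pnormal Th G i]/cst_vec (matched_normal FG) oppE mpolyCN
    mulrN -mulrBl.
by move=> h; apply: h; rewrite hi.
Qed.

Lemma jump_boundary (P : pieces) F : pform_e Th Sig d11 P P = 0 -> face_on Th Sig (F, None) ->
  faceI Th F (P F.1 * P F.1) = 0.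
Proof.
move=> he hi; apply: face_normal_component => i.
have := @pform_e_eq0 _ _ _ _ _ hTh hd11 P (F, None) i he.
rewrite hi orbT => /(_ isT).
by rewrite /pjump /two_sided /= addr0.
Qed.

Lemma divergence_piece (V : vpieces) (P : pieces) K :
  volI (Th K) (P K * pdiv (piece V K)) =
  \sum_(j < 4) faceI Th (K, j) (P K * pdot (piece V K) (pnormal Th (K, j))) -
  volI (Th K) (pdot (fun i => mderiv i (P K)) (piece V K)).
Proof.
apply/eqP; rewrite -subr_eq opprK -(is_linD _ _ (volI_lin K)); apply/eqP.
have -> : P K * pdiv (piece V K) + pdot (fun i => mderiv i (P K)) (piece V K) =
    \sum_i mderiv i (P K * piece V K i).
  rewrite /pdiv /pdot mulr_sumr -big_split; apply: eq_bigr => i _ /=.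
  by rewrite mderivM addrC.
rewrite (is_lin_big _ _ _ (volI_lin K)).
under eq_bigr do rewrite (divergence_coord (hTh K)).
rewrite exchange_big; apply: eq_bigr => j _ /=.
have tl : is_lin (V := R^o) (triI (fv (Th K) j 0) (fv (Th K) j 1) (fv (Th K) j 2)).
  exact: (is_lin_triI (f := id)).
rewrite /faceI /= /pdot mulr_sumr (is_lin_big _ _ _ tl) mulr_sumr; apply: eq_bigr => i _.
rewrite [onormal _ _](onormal_face_normal (K, j)) scaE -mulrA; congr (_ * _).
have -> : P K * (piece V K i * pnormal Th (K, j) i) =
    face_normal Th (K, j) 0 i *: (P K * piece V K i) by rewrite mulrA mulrC mul_mpolyC.
by rewrite (is_linZ _ _ tl).
Qed.

Lemma b2_by_parts (V : vpieces) (P : pieces) : pform_e Th Sig d11 P P = 0 ->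
  pform_b2 Th Gam V P = \sum_K volI (Th K) (pdot (fun i => mderiv i (P K)) (piece V K)).
Proof.
move=> he; pose h F := faceI Th F (P F.1 * pdot (piece V F.1) (pnormal Th F)).
rewrite /pform_b2.
have -> : \sum_K volI (Th K) (P K * pdiv (piece V K)) = \sum_F h F -
    \sum_K volI (Th K) (pdot (fun i => mderiv i (P K)) (piece V K)).
  have -> : \sum_F h F = \sum_K \sum_j h (K, j).
    by rewrite pair_bigA; apply: eq_bigr => -[].
  by rewrite -sumrB; apply: eq_bigr => K _; exact: divergence_piece.
rewrite -(@sum_half_faces h) => [|F hF]; last exact: faceI_sqr_eq0 (jump_boundary he hF).
rewrite opprB -[RHS](subrK (\sum_(e : mface N | internal Th e || face_on Th Gam e)
    (if e.2 is Some G then h e.1 + h G else h e.1))); congr (_ + _).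
apply: eq_bigr => -[F [G|]] /= hi; last by rewrite /h /pavg /pjumpN /average /two_sided /= addr0.
have {}hi : internal Th (F, Some G) by move: hi; rewrite /face_on /= orbF.
have FG : matched F G.
  by move: (hi); rewrite /internal /matched /= neq_ltn => /andP[-> ->].
rewrite /h (matched_faceI _ FG) /=.
have D0 Q := faceI_sqr_eq0 hTh Q (jump_internal he hi).
have nG i : pnormal Th G i = - pnormal Th F i.
  by rewrite /pnormal /cst_vec (matched_normal FG) oppE mpolyCN.
(* The average times the jump differs from the sum of the two one-sided products by a multiple of
   the jump of [P], which is orthogonal to every polynomial on the face. *)
have -> : faceI Th F (pavg P (F, Some G) * pjumpN Th V (F, Some G)) =
    faceI Th F (P F.1 * pdot (piece V F.1) (pnormal Th F)) +
    faceI Th F (P G.1 * pdot (piece V G.1) (pnormal Th G)) -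
    faceI Th F ((P F.1 - P G.1) * (2^-1 *: (pdot (piece V F.1) (pnormal Th F) -
       pdot (piece V G.1) (pnormal Th G)))).
  rewrite -(is_linD _ _ (faceI_lin F)) -(is_linN _ (faceI_lin F)) -(is_linD _ _ (faceI_lin F)).
  congr (faceI _ _ _); rewrite /pavg /average /pjumpN /two_sided /=.
  move: (pdot _ _) (pdot _ _) => b a; rewrite -!mul_mpolyC.
  have h2 : mpolyC 3 (2^-1 : R) * 2 = 1.
    by rewrite mulr_natr -mpolyCMn (_ : 2^-1 *+ 2 = 1 :> R)//; field.
  move: (P F.1) (P G.1) (mpolyC 3 2^-1) h2 => x y c h2.
  apply/eqP; rewrite -subr_eq0; apply/eqP.
  have -> : c * (x + y) * (a + b) - (x * a + y * b + - ((x - y) * (c * (a - b)))) =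
     (c * 2 - 1) * (x * a + y * b) by ring.
  by rewrite h2 subrr mul0r.
by rewrite D0 subr0.
Qed.

End FaceSums.

(** * Triviality of the kernel and of the transposed kernel *)

Section Kernel.
Context (R : realType) (N : nat) (Th : 'I_N -> 'M[R]_(4, 3)) (Om Gam Sig : set 'rV[R]_3).
Local Notation mR := (measurableTypeR R).
Local Notation R3 := (mR * mR * mR)%type.
Local Notation R2 := (mR * mR)%type.
Local Notation poly := (mpoly 3 R).
Local Notation vpieces := {ffun 'I_N * 'I_3 -> poly}.
Local Notation pieces := {ffun 'I_N -> poly}.
Implicit Types (P : poly) (K : 'I_N) (F : half_face N).
Hypothesis hOm : bounded_lipschitz_domain Om.
Hypothesis hmesh : is_mesh_of Th Om.
Hypothesis hcomp : compatible Th Gam Sig.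
Hypothesis hdisj : Gam `&` Sig = set0.
Let hTh := mesh_nondeg hmesh.
Variables (nu sigma c11 a11 d11 : R) (beta : 'I_3 -> R3 -> R) (b : R).
Hypotheses (hc11 : 0 < c11) (ha11 : 0 < a11) (hd11 : 0 < d11).
Hypotheses (hnu : 0 < nu) (hsigma : 0 < sigma).
Hypothesis b0 : 0 <= b.
Hypothesis hb : 2 * b ^+ 2 < nu * sigma.
Hypothesis hbeta : forall K j, (@leb3 R).-integrable (ovol (Th K)) (EFin \o beta j).
Hypothesis beta_le : forall j K, {ae @leb3 R, forall t, ovol (Th K) t -> `|beta j t| <= b}.

Let faceI_lin F : is_lin (V := R^o) (faceI Th F).
Proof. exact: (@is_lin_faceI R N Th poly id F). Qed.
Let volI_lin K : is_lin (V := R^o) (volI (Th K)).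
Proof. exact: (is_lin_volI (f := id) hTh). Qed.

Lemma ref_not_negligible : ~ (@leb2 R).-negligible (@ref_tri R).
Proof.
move=> /(measure_negligible (@measurable_ref R)) h.
have h' : (@leb2 R (@ref_tri R) = 0)%E by exact: h.
by have := leb2_ref_gt0 R; rewrite h' ltxx.
Qed.

Lemma faceI_const_eq0 F (d : R) : faceI Th F (mpolyC 3 d * mpolyC 3 d) = 0 -> d = 0.
Proof.
move=> /(faceI_sqr_ae hTh) h; apply: contrapT => d0; apply: ref_not_negligible.
by apply: negligibleS h => w rw /= /(_ rw); rewrite evC.
Qed.

Lemma volI_one_gt0 K : 0 < volI (Th K) (mpolyC 3 1).
Proof.
have -> : mpolyC 3 (1 : R) = mpolyC 3 1 * mpolyC 3 1 by rewrite -mpolyCM mulr1.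
rewrite lt_neqAle volI_sqr_ge0 andbT eq_sym; apply/eqP => /(volI_sqr_eq0 hTh) /eqP.
by rewrite mpolyC_eq0 oner_eq0.
Qed.

Lemma face_relint_param F (w : R2) : 0 < (w.1 : R) -> 0 < (w.2 : R) -> (w.1 : R) + w.2 < 1 ->
  hface_relint Th F (fparam Th F w).
Proof.
case: w => s t /= h1 h2 h3; case: F => K i.
have [w [wi wl w1 wE]] := face_weights (Th K) i s t; exists w; split=> //.
- move=> k; case: (unliftP i k) => [j|] ->; rewrite ?inE ?eqxx// => _.
  by rewrite wl; case: j => [[|[|[|//]]] j3] /=; lra.
- by move=> k; rewrite !inE negbK => /eqP ->.
Qed.

(** The relative interior contains only points of [Gam], so [Sig] can meet the face only along its
    edges, three lines in the reference triangle. *)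
Lemma boundary_face_null F : hface_relint Th F `<=` Gam ->
  (@leb2 R).-negligible (@ref_tri R `&` fparam Th F @^-1` Sig).
Proof.
move=> hF.
have null (c p q : R) : (p != 0) || (q != 0) ->
    (@leb2 R).-negligible [set w : R2 | p * w.1 + q * w.2 + c = 0].
  move=> pq; exists [set w : R2 | p * w.1 + q * w.2 + c = 0]; split=> //; last exact: leb2_line_null.
  have m : measurable_fun setT (fun w : R2 => p * (w.1 : R) + q * (w.2 : R) + c : mR).
    apply: measurable_funD; last exact: measurable_cst.
    by apply: measurable_funD; apply: measurable_funM => //; exact: measurable_cst.
  by have := m measurableT [set 0] (measurable_set1 0); rewrite setTI.
apply: (@negligibleS _ _ _ _ ([set w : R2 | 1 * w.1 + 0 * w.2 + 0 = 0] `|`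
   ([set w : R2 | 0 * w.1 + 1 * w.2 + 0 = 0] `|` [set w : R2 | 1 * w.1 + 1 * w.2 + (-1) = 0]))).
  move=> w [[/= h1 h2 h3] wS]; apply: contrapT => /not_orP[n1 /not_orP[n2 n3]].
  suff : (Gam `&` Sig) (fparam Th F w) by rewrite hdisj.
  split=> //; apply: hF; apply: face_relint_param.
  - rewrite lt_neqAle h1 andbT eq_sym; apply/eqP => w0; apply: n1 => /=; lra.
  - rewrite lt_neqAle h2 andbT eq_sym; apply/eqP => w0; apply: n2 => /=; lra.
  - rewrite lt_neqAle h3 andbT; apply/eqP => w0; apply: n3 => /=; lra.
by apply: negligibleU; [|apply: negligibleU]; apply: null; rewrite ?oner_eq0 ?orbT.
Qed.

Lemma constant_pressure (P : pieces) (k : nat) :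
  (forall K, (mmeasure mdeg (P K) <= k.+1)%N) ->
  pform_e Th Sig d11 P P = 0 ->
  (forall V : vpieces, (forall i, (mmeasure mdeg (V i) <= k.+2)%N) -> pform_b2 Th Gam V P = 0) ->
  exists a : R, forall K, P K = mpolyC 3 a.
Proof.
move=> hdeg he hb2.
pose V : vpieces := [ffun i => mderiv i.2 (P i.1)].
have := hb2 V; rewrite (b2_by_parts hmesh hcomp hd11 V he) => h.
have {h} /eqP : \sum_K volI (Th K) (pdot (fun i => mderiv i (P K)) (piece V K)) = 0.
  apply: h => -[K i]; rewrite ffunE /=; apply: leq_trans (mmeasure_mderiv i (P K)) _.
  by apply: leq_trans (leq_pred _) _; apply: leq_trans (hdeg K) _.
have VE K : piece V K = fun i => mderiv i (P K) by apply/funext => i; rewrite /piece ffunE.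
rewrite psumr_eq0 => [/allP h|K _]; last by rewrite VE; exact: volI_pdot_ge0.
have Pc K : P K = mpolyC 3 (mcoeff mnm0 (P K)).
  apply: mderiv_eq0_const => i.
  have /eqP := h K (mem_index_enum _); rewrite VE; exact: volI_pdot_eq0.
have [Om0 _ _ _ _] := hOm; have [x xO] := Om0; have [L _] := mesh_cover hmesh xO.
exists (mcoeff mnm0 (P L)) => K; rewrite Pc; congr mpolyC.
apply: (mesh_const hOm hmesh (c := fun K => mcoeff mnm0 (P K))).
(* [internal] stores a face with the smaller element index first. *)
move=> F G; wlog: F G / (F.1 < G.1)%N => [hw|FG _ hE].
  rewrite neq_ltn => /orP[FG hE|GF hE]; first by apply: hw => //; rewrite neq_ltn FG.
  by symmetry; apply: hw => //; rewrite neq_ltn GF.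
have hi : internal Th (F, Some G) by rewrite /internal /= FG; exact/asboolP.
have := jump_internal hmesh hd11 he hi.
have -> : P F.1 - P G.1 = mpolyC 3 (mcoeff mnm0 (P F.1) - mcoeff mnm0 (P G.1)).
  by rewrite mpolyCB -!Pc.
by move=> /faceI_const_eq0/eqP; rewrite subr_eq0 => /eqP.
Qed.

Lemma pressure_eq0 (P : pieces) (k : nat) :
  (forall K, (mmeasure mdeg (P K) <= k.+1)%N) ->
  pform_e Th Sig d11 P P = 0 ->
  (forall V : vpieces, (forall i, (mmeasure mdeg (V i) <= k.+2)%N) -> pform_b2 Th Gam V P = 0) ->
  (surface_null Th Sig -> \sum_K volI (Th K) (P K) = 0) -> P = 0.
Proof.
move=> hdeg he hb2 hmean; have [a Pa] := constant_pressure hdeg he hb2.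
suff a0 : a = 0 by apply/ffunP => K; rewrite Pa a0 ffunE mpolyC0.
have [/hmean|] := pselect (surface_null Th Sig).
  have [[x xO] _ _ _ _] := hOm; have [L _] := mesh_cover hmesh xO.
  have E K : volI (Th K) (P K) = a * volI (Th K) (mpolyC 3 1).
    rewrite Pa -[mpolyC 3 a]mulr1 -[1 in LHS](mpolyC1 3 R) mul_mpolyC.
    exact: (is_linZ _ _ (volI_lin K)).
  under eq_bigr do rewrite E; rewrite -mulr_sumr => /eqP; rewrite mulf_eq0 => /orP[/eqP//|].
  rewrite psumr_eq0 => [/allP/(_ L (mem_index_enum _))/=|K _]; last exact/ltW/volI_one_gt0.
  by rewrite (gt_eqF (volI_one_gt0 L)).
(* If [Sig] is not null, it is non-negligible on some boundary face. That face is not contained in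
   [Gam], so by compatibility it is contained in [Sig]. *)
move=> /existsNP[F /not_implyP[Fb hF]].
have FS : hface_relint Th F `<=` Sig.
  by have [/boundary_face_null|//] := hcomp Fb.
have hi : face_on Th Sig (F, None) by rewrite /face_on /= Fb; exact/asboolP.
have := jump_boundary hmesh hd11 he hi; rewrite Pa; exact: faceI_const_eq0.
Qed.

(** In terms of degrees: at most [k + 1] for the velocity, at most [k] for the vorticity and the
    pressure. The last clause is the zero mean built into [Qh]. *)
Definition admissible (k : nat) (y : dofs R N) : Prop :=
  ((forall i, (mmeasure mdeg (y.1.1 i) <= k.+2)%N) /\
   (forall i, (mmeasure mdeg (y.1.2 i) <= k.+1)%N)) /\
  ((forall K, (mmeasure mdeg (y.2 K) <= k.+1)%N) /\
   (surface_null Th Sig -> \sum_K volI (Th K) (y.2 K) = 0)).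

(** The left alternative is the transposed kernel, for existence; the right one is the kernel, for
    uniqueness. Both give [B y y = 0]; tested with [(V, 0, 0)] they then differ only in the sign of
    [pform_b2 V P]. *)
Lemma pform_kernel (k : nat) (y : dofs R N) :
  let B := pform Th Gam Sig nu sigma c11 a11 d11 beta in
  admissible k y ->
  (forall z, admissible k z -> B z y = 0) \/ (forall z, admissible k z -> B y z = 0) -> y = 0.
Proof.
case: y => -[U W] P B hy hker; have [[/= hU hW] [hP hmean]] := hy.
have : B (U, W, P) (U, W, P) = 0 by case: hker => h; exact: h.
rewrite /B /pform /= => hyy.
have e1 := energy_bound hTh hnu hsigma b0 hb hbeta beta_le U W.
have j0 := pform_j_ge0 Gam Sig nu hTh hc11 ha11 U.
have p0 := pform_e_ge0 Sig hTh hd11 P.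
have hs : \sum_K (2^-1 * sigma * volI (Th K) (pdot (piece U K) (piece U K)) +
          4^-1 * volI (Th K) (pdot (piece W K) (piece W K))) <= - pform_e Th Sig d11 P P.
  by move: hyy e1 j0 p0; lra.
have t0 K : 0 <= 2^-1 * sigma * volI (Th K) (pdot (piece U K) (piece U K)).
  by rewrite mulr_ge0 ?volI_pdot_ge0// mulr_ge0 ?invr_ge0// ltW.
have t1 K : 0 <= 4^-1 * volI (Th K) (pdot (piece W K) (piece W K)).
  by rewrite mulr_ge0 ?volI_pdot_ge0// invr_ge0.
have s0 : 0 <= \sum_K (2^-1 * sigma * volI (Th K) (pdot (piece U K) (piece U K)) +
          4^-1 * volI (Th K) (pdot (piece W K) (piece W K))).
  by apply: sumr_ge0 => K _; rewrite addr_ge0.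
have P0 : pform_e Th Sig d11 P P = 0 by move: hs s0 p0; lra.
have : \sum_K (2^-1 * sigma * volI (Th K) (pdot (piece U K) (piece U K)) +
          4^-1 * volI (Th K) (pdot (piece W K) (piece W K))) == 0.
  by apply/eqP; move: hs s0 p0; lra.
rewrite psumr_eq0 => [/allP hz|K _]; last exact: addr_ge0.
have UW0 K : volI (Th K) (pdot (piece U K) (piece U K)) = 0 /\
   volI (Th K) (pdot (piece W K) (piece W K)) = 0.
  have /= := hz K (mem_index_enum _); rewrite paddr_eq0// => /andP[].
  rewrite mulf_eq0 mulf_eq0 !invr_eq0 !pnatr_eq0 (gt_eqF hsigma)/= => /eqP ->.
  by rewrite mulf_eq0 invr_eq0 pnatr_eq0/= => /eqP.
have U0 : U = 0.
  by apply/ffunP => -[K i]; rewrite ffunE; exact: volI_pdot_eq0 (proj1 (UW0 K)).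
have W0 : W = 0.
  by apply/ffunP => -[K i]; rewrite ffunE; exact: volI_pdot_eq0 (proj2 (UW0 K)).
suff PP : P = 0 by rewrite U0 W0 PP.
apply: pressure_eq0 P0 _ hmean => // V hV.
have d0 m : (mmeasure mdeg (0 : poly) <= m)%N by rewrite mmeasure0.
have Vadm : admissible k (V, 0, 0).
  split; split=> //= ?; rewrite ?ffunE//.
  by rewrite big1// => K _; rewrite ffunE (lin0 (volI_lin K)).
have [[a1 a2 a3 a4] [a5 a6 a7 a8] [a9 a10] [a11' a12] [a13 a14]] :=
  pform_zero Gam Sig nu sigma c11 a11 d11 hTh hbeta V P.
have [[z1 z2 z3 z4] [z5 z6 z7 z8] [z9 z10] [z11 z12] [z13 z14]] :=
  pform_zero Gam Sig nu sigma c11 a11 d11 hTh hbeta (0 : vpieces) P.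
case: hker => /(_ _ Vadm); rewrite U0 W0 /B /pform /=.
  rewrite a1 z5 z7 z9 a4 z2 a5 a12 ?(add0r, subr0, oppr0, addr0).
  by move=> /eqP; rewrite oppr_eq0 => /eqP.
by rewrite a13 a5 a10 a14 z2 z5 a11' z7 ?(add0r, subr0, oppr0, addr0).
Qed.

End Kernel.

(** * From functions to polynomial pieces *)

Section Lebesgue.
Context d (T : measurableType d) (R : realType) (mu : {measure set T -> \bar R}) (D : set T).
Hypothesis mD : measurable D.

Lemma Lfun_measurable p (g : T -> R) : (g \_ D) \in Lfun mu p -> measurable_fun D g.
Proof.
move=> /sub_Lfun_mfun; rewrite inE => h.
exact/(measurable_restrictT g mD).
Qed.

(** On a set of finite measure, from [|g| <= 1 + g ^+ 2]. *)
Lemma Lfun2_integrable (E : set T) (g : T -> R) : measurable E -> E `<=` D -> (mu E < +oo)%E ->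
  (g \_ D) \in Lfun mu 2%:E -> mu.-integrable E (EFin \o g).
Proof.
move=> mE ED fE hg; have mg := measurable_funS mD ED (Lfun_measurable hg).
have := integrableS measurableT mE (@subsetT _ E) (Lfun2_integrable_sqr hg).
have i1 : mu.-integrable E (EFin \o cst 1).
  apply: measurable_bounded_integrable => //; exact: bounded_cst.
move=> i2; apply: (le_integrable mE _ _ (integrableD mE i1 i2)); first exact/measurable_EFinP.
move=> t Et /=; rewrite lee_fin patchE mem_set; last exact: ED.
rewrite (@ger0_norm _ (1 + _)); last by rewrite addr_ge0 ?sqr_ge0.
have := sqr_ge0 (`|g t| - 2^-1); rewrite -[g t ^+ 2]real_normK ?num_real//; nra.
Qed.

(** The norm unfolds to the essential supremum under the condition [0 < mu setT]. *)
Lemma Lfunoo_bound (g : T -> R) : (0 < mu setT)%E -> (g \_ D) \in Lfun mu +oo%E ->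
  {ae mu, forall t, D t -> `|g t| <= fine ('N[mu]_+oo[EFin \o (g \_ D)])%E}.
Proof.
move=> mu0 /sub_Lfun_finLfun; rewrite inE /= /finite_norm => fin.
have Lf : ('N[mu]_+oo[EFin \o (g \_ D)] \is a fin_num)%E.
  by rewrite ge0_fin_numE ?Lnorm_ge0.
have : ('N[mu]_+oo[EFin \o (g \_ D)] <= (fine 'N[mu]_+oo[EFin \o (g \_ D)])%:E)%E by rewrite fineK.
rewrite {1}unlock mu0 => /ess_supP; apply: filterS => t + Dt.
by rewrite /= lee_fin patchE mem_set.
Qed.

Lemma bounded_ae_integrable (E : set T) (g : T -> R) (M : R) : measurable E -> (mu E < +oo)%E ->
  measurable_fun E g -> {ae mu, forall t, E t -> `|g t| <= M} -> mu.-integrable E (EFin \o g).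
Proof.
move=> mE fE mg gM; apply/integrableP; split; first exact/measurable_EFinP.
apply: (@le_lt_trans _ _ (\int[mu]_(t in E) (`|M|)%:E)%E); last first.
  by rewrite integral_cst// lte_mul_pinfty.
apply: ae_ge0_le_integral => //.
- by apply/measurable_EFinP; exact: measurableT_comp.
- by apply: filterS gM => t h Et; rewrite lee_fin (le_trans (h Et))// ler_norm.
Qed.

Lemma bounded_Lfun2 (E : set T) (g : T -> R) (M : R) : measurable E -> (mu E < +oo)%E ->
  measurable_fun setT g -> (forall t, `|g t| <= M) -> (forall t, ~ E t -> g t = 0) ->
  g \in Lfun mu 2%:E.
Proof.
move=> mE fE mg gM gE; rewrite inE; apply/andP; split; rewrite inE//=.
rewrite /finite_norm unlock poweR_lty//.
have -> : (\int[mu]_x `|(EFin \o g) x| `^ 2)%E = (\int[mu]_(x in E) (`|g x| ^+ 2)%:E)%E.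
  rewrite [RHS]integral_mkcond; apply: eq_integral => t _.
  rewrite /= patchE; case: ifPn => [_|]; first by rewrite powR_mulrn.
  by rewrite notin_setE => /gE ->; rewrite normr0 powR0// pnatr_eq0.
apply: (@le_lt_trans _ _ (\int[mu]_(t in E) (M ^+ 2)%:E)%E); last first.
  by rewrite integral_cst// lte_mul_pinfty// lee_fin sqr_ge0.
apply: ge0_le_integral => //.
- by apply/measurable_EFinP; apply: measurable_funX; apply: measurableT_comp => //; exact: measurable_funTS.
- by move=> t _; rewrite lee_fin lerXn2r// nnegrE (le_trans (normr_ge0 _) (gM t)).
Qed.

(** Integrability on [D] is derived: [g] is integrable on the finite union of the pieces, and the
    rest of [D] is null. *)
Lemma integral_pieces (I : finType) (F : I -> set T) (g : T -> R) :
  (forall i, measurable (F i)) -> (forall i, F i `<=` D) ->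
  (forall i j, i != j -> F i `&` F j = set0) ->
  mu (D `\` \bigcup_(i in [set: I]) F i) = 0%E ->
  measurable_fun D g -> (forall i, mu.-integrable (F i) (EFin \o g)) ->
  \int[mu]_(t in D) g t = \sum_i \int[mu]_(t in F i) g t.
Proof.
move=> mF FD dF nF mg gi; pose U := \big[setU/set0]_(i <- index_enum I) F i.
have UE : \bigcup_(i in [set: I]) F i = U.
  rewrite /U -bigcup_seq; apply/seteqP; split=> x [i _ xi]; exists i => //=.
  exact: mem_index_enum.
have UD : U `<=` D by rewrite -UE => x [i _ xi]; exact: FD xi.
have mU : measurable U by apply: bigsetU_measurable => i _; exact: mF.
have tF : trivIset [set` index_enum I] F.
  by move=> i j _ _ [x Fx]; apply: contrapT => /eqP /dF h; move: Fx; rewrite h.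
have mgU : measurable_fun U (EFin \o g) by apply/measurable_EFinP; exact: measurable_funS mg.
have Ui : mu.-integrable U (EFin \o g).
  apply/integrableP; split=> //.
  rewrite (ge0_integral_bigsetU mu mF (index_enum_uniq _) tF)//; last exact: measurableT_comp.
  by apply/lte_sum_pinfty => i _; have /integrableP[] := gi i.
rewrite UE in nF; have mN := measurableD mD mU.
have UDE : D `\` (D `\` U) = U by rewrite setDD setIidr.
have Di : mu.-integrable D (EFin \o g).
  apply/(negligible_integrable mN mD _ nF); last by rewrite UDE.
  exact/measurable_EFinP.
rewrite /Rintegral (negligible_integral mN mD Di nF) UDE.
rewrite (integral_bigsetU_EFin mu mF (index_enum_uniq _) tF)// sum_fine//.
by move=> i _; exact: (integrable_fin_num (mF i) (gi i)).
Qed.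

End Lebesgue.

(** * Traces, derivatives and integrals of discrete functions *)

Section Representation.
Context (R : realType) (N : nat) (Th : 'I_N -> 'M[R]_(4, 3)) (Om Gam Sig : set 'rV[R]_3).
Local Notation vec := 'rV[R]_3.
Local Notation mR := (measurableTypeR R).
Local Notation R2 := (mR * mR)%type.
Local Notation poly := (mpoly 3 R).
Local Notation vpieces := {ffun 'I_N * 'I_3 -> poly}.
Local Notation pieces := {ffun 'I_N -> poly}.
Implicit Types (P : poly) (K : 'I_N) (F G : half_face N) (e : mface N) (x : vec).
Implicit Types (u v w : vec -> vec) (q : vec -> R).
Hypothesis hOm : bounded_lipschitz_domain Om.
Hypothesis hmesh : is_mesh_of Th Om.
Let hTh := mesh_nondeg hmesh.

Definition rep v (U : vpieces) : Prop :=
  forall K x, otet (Th K) x -> v x = vev (piece U K) x.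
Definition reps q (P : pieces) : Prop := forall K x, otet (Th K) x -> q x = ev (P K) x.

(** By [tet_closure] the open element accumulates at [x], so the filter of the trace is proper and
    the limit is unique. *)
Lemma trace_eq (V : ptopologicalType) (v h : vec -> V) K x : hausdorff_space V ->
  tet Th K x -> h @ x --> h x -> (forall y, otet (Th K) y -> v y = h y) ->
  trace Th v K x = h x.
Proof.
move=> hV xK hc hv; rewrite /trace (tet_int hmesh).
have pf : ProperFilter (within (otet (Th K)) (nbhs x)).
  by apply: within_nbhs_proper; exact: tet_closure.
apply: cvg_lim => //; apply: (@cvg_trans _ (h @ within (otet (Th K)) (nbhs x))).
  apply: near_eq_cvg; rewrite near_withinE.
  by apply: (@filterS _ _ (nbhs_filter x) setT) => [y _ yo|]; [rewrite hv|exact: filterT].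
by apply: cvg_trans hc; apply: cvg_app; exact: cvg_within.
Qed.

Lemma trace_reps q (P : pieces) K x : reps q P -> tet Th K x -> trace Th q K x = ev (P K) x.
Proof.
move=> hq xK; apply: (@trace_eq R q (ev (P K)) K x) => //; last exact: hq.
exact: ev_continuous.
Qed.

Lemma trace_rep v (U : vpieces) K x : rep v U -> tet Th K x -> trace Th v K x = vev (piece U K) x.
Proof.
move=> hv xK; apply: (@trace_eq _ v (vev (piece U K)) K x) => //; last exact: hv.
apply: (cvg_rV (nbhs_filter x)) => j; rewrite !mxE.
under eq_fun do rewrite mxE.
exact: ev_continuous.
Qed.

Lemma face_param_tet F (w : R2) : ref_tri w -> tet Th F.1 (fparam Th F w).
Proof.
move=> rw; apply: (@face_tet R (Th F.1) F.2); rewrite faceE.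
by exists w.
Qed.

Lemma internal_param_tet F G (w : R2) : internal Th (F, Some G) -> ref_tri w ->
  tet Th G.1 (fparam Th F w).
Proof.
move=> /andP[_ /asboolP hE] rw; apply: (@face_tet R (Th G.1) G.2).
rewrite -/(hface Th G) -hE /hface faceE; by exists w.
Qed.

Lemma vev_cst (n x : vec) : vev (cst_vec n) x = n.
Proof. by apply/rowP => i; rewrite mxE evC. Qed.

Section FaceTraces.
Variables (e : mface N) (w : R2).
Hypothesis he : (e.2 != None) ==> internal Th e.
Hypothesis rw : ref_tri w.
Let x := fparam Th e.1 w.

(** [x] comes from the parametrisation of the first side, but an internal face is the same set from
    both sides, so [x] lies in both closed elements. *)
Let tr2 (V : zmodType) (g h : half_face N -> V) :
  (forall F, tet Th F.1 x -> g F = h F) -> two_sided g e = two_sided h e.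
Proof.
have h1 := face_param_tet e.1 rw.
rewrite /two_sided; case: e he h1 @x => F [G|] /= hi h1 gh.
  by rewrite !gh//; exact: internal_param_tet hi rw.
by rewrite gh.
Qed.

Let av2 (V : lmodType R) (g h : half_face N -> V) :
  (forall F, tet Th F.1 x -> g F = h F) -> average g e = average h e.
Proof.
have h1 := face_param_tet e.1 rw.
rewrite /average; case: e he h1 @x => F [G|] /= hi h1 gh; last exact: gh.
by rewrite !gh//; exact: internal_param_tet hi rw.
Qed.

Lemma jumpT_rep u (U : vpieces) : rep u U -> jumpT Th u e x = vev (pjumpT Th U e) x.
Proof.
move=> hu; rewrite /jumpT (tr2 (h := fun F => cross (vev (piece U F.1) x) (face_normal Th F))).
  apply/rowP => i; rewrite [RHS]mxE /pjumpT /two_sided; case: e.2 => [G|];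
  by rewrite ?addr0 ?evD !ev_pcross !vev_cst ?addE.
by move=> F xF; rewrite (trace_rep hu xF).
Qed.

Lemma jumpN_rep u (U : vpieces) : rep u U -> jumpN Th u e x = ev (pjumpN Th U e) x.
Proof.
move=> hu; rewrite /jumpN (tr2 (h := fun F => dot (vev (piece U F.1) x) (face_normal Th F))).
  rewrite /pjumpN /two_sided; case: e.2 => [G|];
  by rewrite ?addr0 ?evD !ev_pdot !vev_cst ?addE.
by move=> F xF; rewrite (trace_rep hu xF).
Qed.

Lemma jump_rep q (P : pieces) : reps q P -> jump Th q e x = vev (pjump Th P e) x.
Proof.
move=> hq; rewrite /jump (tr2 (h := fun F => ev (P F.1) x *: face_normal Th F)).
  apply/rowP => i; rewrite [RHS]mxE /pjump /two_sided; case: e.2 => [G|];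
  by rewrite ?addr0 ?evD !evM !evC ?addE !scaE.
by move=> F xF; rewrite (trace_reps hq xF).
Qed.

Lemma avg_vec_rep u (U : vpieces) : rep u U -> avg_vec Th u e x = vev (pavg_vec U e) x.
Proof.
move=> hu; rewrite /avg_vec (av2 (h := fun F => vev (piece U F.1) x)).
  apply/rowP => i; rewrite [RHS]mxE /pavg_vec /average; case: e.2 => [G|];
  by rewrite ?evZ ?evD ?scaE ?addE !mxE.
by move=> F xF; rewrite (trace_rep hu xF).
Qed.

Lemma avg_rep q (P : pieces) : reps q P -> avg Th q e x = ev (pavg P e) x.
Proof.
move=> hq; rewrite /avg (av2 (V := R^o) (h := fun F => ev (P F.1) x)).
  by rewrite /pavg /average; case: e.2 => [G|]; rewrite ?evZ ?evD.
by move=> F xF; rewrite (trace_reps hq xF).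
Qed.

End FaceTraces.

Lemma fint_rep F q P : (forall w : R2, ref_tri w -> q (fparam Th F w) = ev P (fparam Th F w)) ->
  fint Th F q = faceI Th F P.
Proof.
move=> h; rewrite /fint /faceI triIE; congr (_ * _).
by apply: eq_Rintegral => w; rewrite inE => rw; exact: h.
Qed.

Lemma pderiv_local q P K x i : (forall y, otet (Th K) y -> q y = ev P y) -> otet (Th K) x ->
  pderiv i q x = ev (mderiv i P) x.
Proof.
move=> hq xo; rewrite -pderiv_ev; apply: near_eq_derive.
have : nbhs x (otet (Th K)) by apply: open_nbhs_nbhs; split => //; exact: otet_open.
by apply: filterS => y; exact: hq.
Qed.

Lemma vcoord_rep u (U : vpieces) K i : rep u U ->
  forall y, otet (Th K) y -> vcoord u i y = ev (U (K, i)) y.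
Proof. by move=> hu y yo; rewrite /vcoord (hu K y yo) mxE. Qed.

Lemma curl_rep u (U : vpieces) K x : rep u U -> otet (Th K) x ->
  curl u x = vev (pcurl (piece U K)) x.
Proof.
move=> hu xo; have pd i j : pderiv i (vcoord u j) x = ev (mderiv i (U (K, j))) x.
  by apply: pderiv_local xo; exact: vcoord_rep.
by apply: vec3P; rewrite !mxE /= !pd /pcurl /= evB.
Qed.

Lemma div_rep u (U : vpieces) K x : rep u U -> otet (Th K) x ->
  div u x = ev (pdiv (piece U K)) x.
Proof.
move=> hu xo; rewrite /div /pdiv ev_sum; apply: eq_bigr => i _.
by apply: pderiv_local xo; exact: vcoord_rep.
Qed.

Lemma vint_tet K q P : (forall x, otet (Th K) x -> q x = ev P x) ->
  vint (tet Th K)° q = volI (Th K) P.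
Proof.
move=> h; rewrite /vint (tet_int hmesh) /volI /wint.
by apply: eq_Rintegral => t; rewrite inE mul1r => to; exact: h.
Qed.

(** The weights [g j] take the factors that are not polynomial, the components of [beta] or [f]. The
    skeleton is null, so the integral splits over the open elements. *)
Lemma vint_weighted (g : 'I_3 -> vec -> R) q (P : 'I_N -> 'I_3 -> poly) :
  measurable_fun (@pt3 R @^-1` Om) (q \o @pt3 R : _ -> mR) ->
  (forall K j, (@leb3 R).-integrable (ovol (Th K)) (EFin \o (g j \o @pt3 R))) ->
  (forall K x, otet (Th K) x -> q x = \sum_j g j x * ev (P K j) x) ->
  vint Om q = \sum_K \sum_j wint (@leb3 R) (ovol (Th K)) (@pt3 R) (g j \o @pt3 R) (P K j).
Proof.
move=> mq gi qE; have [_ Oo _ _ _] := hOm.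
have sE K : \sum_j wint (@leb3 R) (ovol (Th K)) (@pt3 R) (g j \o @pt3 R) (P K j) =
    \int[@leb3 R]_(t in ovol (Th K)) (\sum_j g j (pt3 t) * ev (P K j) (pt3 t)).
  rewrite (Rintegral_sum (mu := @leb3 R) (measurable_ovol (Th K)) _
    (f := fun j t => g j (pt3 t) * ev (P K j) (pt3 t)))//.
  by move=> j; exact: (integrable_ovol (hTh K) (P K j) (gi K j)).
rewrite /vint (integral_pieces (mu := @leb3 R) (measurable_open Oo) (F := fun K => ovol (Th K))).
- apply: eq_bigr => K _; rewrite sE; apply: eq_Rintegral => t; rewrite inE => to; exact: qE.
- by move=> K; exact: measurable_ovol.
- by move=> K t; exact: (otet_sub_domain hOm hmesh).
- move=> K L KL; rewrite /ovol -preimage_setI (mesh_disjoint hmesh KL); exact: preimage_set0.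
- exact: (domain_null hOm hmesh).
- exact: mq.
move=> K; apply: (eq_integrable (measurable_ovol (Th K))
   (fun t => \sum_j (g j (pt3 t) * ev (P K j) (pt3 t))%:E)%E).
  by move=> t; rewrite inE sumEFin /= => to; rewrite -qE.
apply: (@integrable_sum _ _ _ _ _ (measurable_ovol (Th K)) _ _ xpredT
   (fun j t => (g j (pt3 t) * ev (P K j) (pt3 t))%:E)) => j _.
exact: (integrable_ovol (hTh K) (P K j) (gi K j)).
Qed.

Lemma vint_rep q (P : 'I_N -> poly) :
  measurable_fun (@pt3 R @^-1` Om) (q \o @pt3 R : _ -> mR) ->
  (forall K x, otet (Th K) x -> q x = ev (P K) x) ->
  vint Om q = \sum_K volI (Th K) (P K).
Proof.
move=> mq qE.
(* Weight 1, with the whole polynomial in component 0. *)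
rewrite (@vint_weighted (fun=> cst 1) q (fun K j => if j == 0 then P K else 0))//.
- apply: eq_bigr => K _; rewrite sum3 /=.
  by rewrite wint0 ?addr0//; exact: measurable_ovol.
- by move=> K j; exact: integrable_one_ovol.
- by move=> K x xo; rewrite sum3 /= !ev0 !mul1r !addr0; exact: qE.
Qed.

End Representation.

(** * Discrete functions and their polynomial pieces *)

Section BrokenSpaces.
Context (R : realType) (N : nat) (Th : 'I_N -> 'M[R]_(4, 3)) (Om Gam Sig : set 'rV[R]_3).
Local Notation vec := 'rV[R]_3.
Local Notation mR := (measurableTypeR R).
Local Notation R3 := (mR * mR * mR)%type.
Local Notation poly := (mpoly 3 R).
Local Notation vpieces := {ffun 'I_N * 'I_3 -> poly}.
Local Notation pieces := {ffun 'I_N -> poly}.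
Implicit Types (K : 'I_N) (x : vec) (m : nat).
Implicit Types (v : vec -> vec) (q : vec -> R).
Hypothesis hOm : bounded_lipschitz_domain Om.
Hypothesis hmesh : is_mesh_of Th Om.
Let hTh := mesh_nondeg hmesh.
Local Notation Omt := (@pt3 R @^-1` Om).

Lemma measurable_domain : measurable Omt.
Proof. by have [_ Oo _ _ _] := hOm; exact: measurable_open. Qed.

Lemma broken_pieces m q : broken Th m Om q -> exists2 P : pieces,
  (forall K, (mmeasure mdeg (P K) <= m.+1)%N) & reps Th q P.
Proof.
move=> [_ hq]; have /choice[P hP] : forall K, exists p : poly,
    (mmeasure mdeg p <= m.+1)%N /\ forall x, otet (Th K) x -> q x = ev p x.
  by move=> K; have [p hp qp] := hq K; exists p; split=> // x; rewrite -(tet_int hmesh); exact: qp.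
exists [ffun K => P K] => [K|K x]; rewrite ffunE; first exact: (hP K).1.
exact: (hP K).2.
Qed.

Lemma broken_vec_pieces m v : broken_vec Th m Om v -> exists2 U : vpieces,
  (forall i, (mmeasure mdeg (U i) <= m.+1)%N) & rep Th v U.
Proof.
move=> hv; have /choice[P hP] : forall i, exists P : pieces,
    (forall K, (mmeasure mdeg (P K) <= m.+1)%N) /\ reps Th (vcoord v i) P.
  by move=> i; have [P h1 h2] := broken_pieces (hv i); exists P.
exists [ffun Ki => P Ki.2 Ki.1] => [[K i]|K x xo]; first by rewrite ffunE; exact: (hP i).1.
by apply/rowP => i; rewrite mxE /piece ffunE -(hP i).2.
Qed.

(** At most one indicator is nonzero, and off the open elements the value is 0. These
    representatives serve as the solution and as test functions. *)
Definition assemble (P : 'I_N -> poly) x : R :=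
  \sum_K (`[< otet (Th K) x >])%:R * ev (P K) x.

Definition assemble_vec (U : vpieces) x : vec := \row_i assemble (fun K => U (K, i)) x.

Lemma reps_assemble P K x : otet (Th K) x -> assemble P x = ev (P K) x.
Proof.
move=> xo; rewrite /assemble (bigD1 K)//= asboolT// mul1r big1 ?addr0// => L LK.
rewrite asboolF ?mul0r// => xL.
suff : (otet (Th L) `&` otet (Th K)) x by rewrite (mesh_disjoint hmesh LK).
by [].
Qed.

Lemma rep_assemble U : rep Th (assemble_vec U) U.
Proof. by move=> K x xo; apply/rowP => i; rewrite !mxE; exact: reps_assemble. Qed.

Lemma assemble_inL2 P : inLp 2%:E Om (assemble P).
Proof.
have [_ Oo _ Ob _] := hOm.
have hC K : exists C, forall t : R3, ovol (Th K) t -> `|ev (P K) (pt3 t)| <= C.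
  by apply: bounded_evX; exact: ovol_bounded.
have [C CP] := choice hC.
rewrite /inLp.
apply: (@bounded_Lfun2 _ _ _ _ Omt _ (\sum_K `|C K|)).
- exact: measurable_domain.
- exact: bounded_leb3_lty measurable_domain Ob.
- apply/(measurable_restrictT _ measurable_domain); apply: measurable_funTS.
  rewrite [X in measurable_fun _ X](_ : _ =
     fun t : R3 => \sum_K \1_(ovol (Th K)) t * ev (P K) (pt3 t) : mR).
    apply: measurable_sum => K; apply: measurable_funM; last exact: measurable_ev.
    by apply: measurable_indic; exact: measurable_ovol.
  apply/funext => t; apply: eq_bigr => K _; congr (_%:R * _).
- move=> t; rewrite patchE; case: ifPn => [_|_]; last by rewrite normr0 sumr_ge0.
  rewrite /= /assemble (le_trans (ler_norm_sum _ _ _))//; apply: ler_sum => K _.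
  case: asboolP => xo; last by rewrite mul0r normr0.
  by rewrite mul1r (le_trans (CP K t xo))// ler_norm.
- by move=> t nt; rewrite patchE memNset.
Qed.

Lemma assemble_broken m (P : 'I_N -> poly) : (forall K, (mmeasure mdeg (P K) <= m.+1)%N) ->
  broken Th m Om (assemble P).
Proof.
move=> hP; split; first exact: assemble_inL2.
by move=> K; exists (P K) => // x; rewrite (tet_int hmesh); exact: reps_assemble.
Qed.

Lemma assemble_vec_broken m (U : vpieces) : (forall i, (mmeasure mdeg (U i) <= m.+1)%N) ->
  broken_vec Th m Om (assemble_vec U).
Proof.
move=> hU i; have -> : vcoord (assemble_vec U) i = assemble (fun K => U (K, i)).
  by apply/funext => x; rewrite /vcoord mxE.
by apply: assemble_broken => K; exact: hU.
Qed.

Lemma inLp_measurable p q : inLp p Om q -> measurable_fun Omt (q \o @pt3 R : _ -> mR).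
Proof. exact: (Lfun_measurable (mu := @leb3 R) measurable_domain (p := p) (g := q \o @pt3 R)). Qed.

Lemma inL2_integrable q K : inLp 2%:E Om q ->
  (@leb3 R).-integrable (ovol (Th K)) (EFin \o (q \o @pt3 R)).
Proof.
move=> h; apply: (Lfun2_integrable measurable_domain _ _ _ h).
- exact: measurable_ovol.
- by move=> t; exact: (otet_sub_domain hOm hmesh).
- exact: ovol_finite.
Qed.

Lemma inLoo_bound v j : inLp_vec +oo%E Om v ->
  {ae @leb3 R, forall t, Omt t -> `|v (pt3 t) 0 j| <= Linf_norm Om v}.
Proof.
move=> hv; have mu0 : (0 < @leb3 R setT)%E.
  by rewrite -(preimage_setT (@pt3 R)); apply: open_leb3_gt0; [exact: openT|exists 0].
have := Lfunoo_bound mu0 (hv j); apply: filterS => t h Dt.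
apply: le_trans (h Dt) _; rewrite /Linf_norm.
exact: (le_bigmax _ (fun i => fine ('N[@leb3 R]_+oo[EFin \o ((vcoord v i \o @pt3 R) \_ Omt)])%E) j).
Qed.

Lemma inLoo_integrable v j K : inLp_vec +oo%E Om v ->
  (@leb3 R).-integrable (ovol (Th K)) (EFin \o (fun t => v (pt3 t) 0 j)).
Proof.
move=> hv; apply: (bounded_ae_integrable (M := Linf_norm Om v)).
- exact: measurable_ovol.
- exact: ovol_finite.
- apply: measurable_funS (inLp_measurable (hv j)); first exact: measurable_domain.
  by move=> t; exact: (otet_sub_domain hOm hmesh).
- apply: filterS (inLoo_bound j hv) => t h /(otet_sub_domain hOm hmesh); exact: h.
Qed.

Lemma pieces_ae_eq (V : Type) (g g' : vec -> V) (h : 'I_N -> vec -> V) :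
  (forall K x, otet (Th K) x -> g x = h K x) -> (forall K x, otet (Th K) x -> g' x = h K x) ->
  ae_eq_in Om g g'.
Proof.
move=> hg hg'; exists (Omt `\` \bigcup_(K in [set: 'I_N]) ovol (Th K)); split.
- apply: measurableD; first exact: measurable_domain.
  by apply: fin_bigcup_measurable; [exact: finite_finset|move=> K _; exact: measurable_ovol].
- exact: domain_null hOm hmesh.
- move=> t /= /not_implyP[Ot ne]; split=> // -[K _ to]; apply: ne.
  by rewrite (hg K _ to) (hg' K _ to).
Qed.

End BrokenSpaces.

(** * Forms and loads in terms of the pieces *)

Section FormRepresentation.
Context (R : realType) (N : nat) (Th : 'I_N -> 'M[R]_(4, 3)) (Om Gam Sig : set 'rV[R]_3).
Local Notation vec := 'rV[R]_3.
Local Notation mR := (measurableTypeR R).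
Local Notation R3 := (mR * mR * mR)%type.
Local Notation R2 := (mR * mR)%type.
Local Notation poly := (mpoly 3 R).
Local Notation vpieces := {ffun 'I_N * 'I_3 -> poly}.
Local Notation pieces := {ffun 'I_N -> poly}.
Implicit Types (K : 'I_N) (F : half_face N) (e : mface N) (x : vec).
Implicit Types (u v w th : vec -> vec) (p q : vec -> R) (U V W T : vpieces) (P Q : pieces).
Hypothesis hOm : bounded_lipschitz_domain Om.
Hypothesis hmesh : is_mesh_of Th Om.
Let hTh := mesh_nondeg hmesh.
Local Notation Omt := (@pt3 R @^-1` Om).
Variables (nu sigma c11 a11 d11 : R) (beta f uSig : vec -> vec) (pSig : vec -> R).

Definition comp_measurable v :=
  forall i, measurable_fun Omt (fun t : R3 => v (pt3 t) 0 i : mR).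

Lemma measurable_dot u v : comp_measurable u -> comp_measurable v ->
  measurable_fun Omt ((fun x => dot (u x) (v x)) \o @pt3 R : _ -> mR).
Proof.
move=> mu mv; apply: measurable_sum => i.
by apply: measurable_funM; [exact: mu|exact: mv].
Qed.

Lemma measurable_cross u v : comp_measurable u -> comp_measurable v ->
  comp_measurable (fun x => cross (u x) (v x)).
Proof.
move=> mu mv; have mm i j : measurable_fun Omt (fun t : R3 => u (pt3 t) 0 i * v (pt3 t) 0 j : mR).
  by apply: measurable_funM; [exact: mu|exact: mv].
by elim/ord3P; under eq_fun do rewrite crossE; apply: measurable_funB; exact: mm.
Qed.

Lemma form_a_rep u v U V : comp_measurable u -> comp_measurable v -> rep Th u U -> rep Th v V ->
  form_a Om sigma u v = pform_a Th sigma U V.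
Proof.
move=> mu mv hu hv; congr (_ * _).
apply: (vint_rep hOm hmesh (measurable_dot mu mv)) => K x xo.
by rewrite ev_pdot (hu K x xo) (hv K x xo).
Qed.

Lemma form_d_rep u v U V : comp_measurable u -> comp_measurable v -> rep Th u U -> rep Th v V ->
  form_d Om u v = pform_d Th U V.
Proof.
move=> mu mv hu hv.
apply: (vint_rep hOm hmesh (measurable_dot mu mv)) => K x xo.
by rewrite ev_pdot (hu K x xo) (hv K x xo).
Qed.

Lemma form_c_rep w v W V : comp_measurable beta ->
  (forall K j, (@leb3 R).-integrable (ovol (Th K)) (EFin \o (fun t => beta (pt3 t) 0 j))) ->
  comp_measurable w -> comp_measurable v -> rep Th w W -> rep Th v V ->
  form_c Om nu beta w v = pform_c Th nu (fun j t => beta (pt3 t) 0 j) W V.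
Proof.
move=> mb bi mw mv hw hv; congr (_ * _).
apply: (@vint_weighted _ _ Th Om hOm hmesh (fun j x => beta x 0 j)) => //.
  exact: measurable_dot (measurable_cross mw mb) mv.
move=> K x xo; under eq_bigr do rewrite ev_pcross.
by rewrite sum3 (hw K x xo) (hv K x xo) dotE !crossE; ring.
Qed.

Lemma face_cond (S : set vec) e : internal Th e || face_on Th S e -> (e.2 != None) ==> internal Th e.
Proof. by rewrite /face_on; case/orP => [->|/andP[-> _]]; rewrite ?implybT. Qed.

Lemma form_b1_rep u th U T : rep Th u U -> rep Th th T ->
  form_b1 Th Gam nu u th = pform_b1 Th Gam nu U T.
Proof.
move=> hu ht; congr (_ * _ + _ * _); [apply: eq_bigr => K _|apply: eq_bigr => e he].
  apply: (vint_tet hmesh) => x xo; rewrite ev_pdot (curl_rep ht xo).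
  by rewrite (hu K x xo).
apply: fint_rep => z rz; rewrite ev_pdot.
by rewrite (avg_vec_rep hmesh (face_cond he) rz hu) (jumpT_rep hmesh (face_cond he) rz ht).
Qed.

Lemma form_b2_rep v q V Q : rep Th v V -> reps Th q Q ->
  form_b2 Th Gam v q = pform_b2 Th Gam V Q.
Proof.
move=> hv hq; congr (- _ + _); [apply: eq_bigr => K _|apply: eq_bigr => e he].
  apply: (vint_tet hmesh) => x xo; rewrite evM (div_rep hv xo).
  by rewrite (hq K x xo).
apply: fint_rep => z rz; rewrite evM.
by rewrite (avg_rep hmesh (face_cond he) rz hq) (jumpN_rep hmesh (face_cond he) rz hv).
Qed.

Lemma form_j_rep u v U V : rep Th u U -> rep Th v V ->
  form_j Th Gam Sig nu c11 a11 u v = pform_j Th Gam Sig nu c11 a11 U V.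
Proof.
move=> hu hv; congr (_ * _ + _); apply: eq_bigr => e he; apply: fint_rep => z rz.
  rewrite evZ ev_pdot (jumpT_rep hmesh (face_cond he) rz hu).
  by rewrite (jumpT_rep hmesh (face_cond he) rz hv).
rewrite evZ evM (jumpN_rep hmesh (face_cond he) rz hu).
by rewrite (jumpN_rep hmesh (face_cond he) rz hv).
Qed.

Lemma form_e_rep p q P Q : reps Th p P -> reps Th q Q ->
  form_e Th Sig d11 p q = pform_e Th Sig d11 P Q.
Proof.
move=> hp hq; apply: eq_bigr => e he; apply: fint_rep => z rz.
rewrite evZ ev_pdot (jump_rep hmesh (face_cond he) rz hp).
by rewrite (jump_rep hmesh (face_cond he) rz hq).
Qed.

Hypothesis hf : inLp_vec 2%:E Om f.
Hypothesis huSig : forall i, inL2_boundary Th Sig (vcoord uSig i).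
Hypothesis hpSig : inL2_boundary Th Sig pSig.

(** The boundary data are only square integrable, so they enter as weights. *)
Definition faceW F (g : vec -> R) (P : poly) : R :=
  enorm (farea_vec Th F) * wint (@leb2 R) (@ref_tri R) (fparam Th F) (g \o fparam Th F) P.

Definition pload_F V : R :=
  \sum_K \sum_j wint (@leb3 R) (ovol (Th K)) (@pt3 R) (vcoord f j \o @pt3 R) (V (K, j))
  - \sum_(e : mface N | face_on Th Sig e)
     (faceW e.1 pSig (pdot (piece V e.1.1) (pnormal Th e.1)) - Num.sqrt nu *
      \sum_j faceW e.1 (vcoord uSig j)
        (C11 Th c11 e *: pcross (piece V e.1.1) (pnormal Th e.1) j)).

Definition pload_G T : R := - Num.sqrt nu * \sum_(e : mface N | face_on Th Sig e)
  \sum_j faceW e.1 (vcoord uSig j) (T (e.1.1, j)).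

Definition pload_L Q : R := \sum_(e : mface N | face_on Th Sig e)
  faceW e.1 pSig (D11 Th d11 e *:
    pdot (pnormal Th e.1) (fun i => Q e.1.1 * pnormal Th e.1 i)).

Lemma inL2_face_integrable F q : inL2_face Th F q ->
  (@leb2 R).-integrable (@ref_tri R) (EFin \o (q \o fparam Th F)).
Proof.
move=> h; apply: (Lfun2_integrable _ _ _ _ h) => //; [exact: measurable_ref|exact: measurable_ref|].
exact: leb2_ref_lty.
Qed.

Lemma fint_faceW F q (g : vec -> R) (P : poly) :
  (forall z : R2, ref_tri z -> q (fparam Th F z) = g (fparam Th F z) * ev P (fparam Th F z)) ->
  fint Th F q = faceW F g P.
Proof.
move=> h; rewrite /fint /faceW /wint; congr (_ * _).
by apply: eq_Rintegral => z; rewrite inE => rz; exact: h.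
Qed.

Lemma fint_faceW_sum F q (g : 'I_3 -> vec -> R) (P : 'I_3 -> poly) :
  (forall j, inL2_face Th F (g j)) ->
  (forall z : R2, ref_tri z ->
     q (fparam Th F z) = \sum_j g j (fparam Th F z) * ev (P j) (fparam Th F z)) ->
  fint Th F q = \sum_j faceW F (g j) (P j).
Proof.
move=> gi h; rewrite /fint /faceW /wint -mulr_sumr; congr (_ * _).
rewrite -(Rintegral_sum (mu := @leb2 R) (@measurable_ref R) _
  (f := fun j z => g j (fparam Th F z) * ev (P j) (fparam Th F z)))//.
  by apply: eq_Rintegral => z; rewrite inE => rz; exact: h.
move=> j; exact: (integrable_tri _ _ _ (P j) (inL2_face_integrable (gi j))).
Qed.

Lemma rhs_F_rep v V : comp_measurable f -> comp_measurable v -> rep Th v V ->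
  rhs_F Th Om Sig nu c11 f uSig pSig v = pload_F V.
Proof.
move=> mf mv hv; congr (_ - _).
  apply: (@vint_weighted _ _ Th Om hOm hmesh (vcoord f)).
  - exact: measurable_dot.
  - by move=> K j; exact: (inL2_integrable hOm hmesh K (hf j)).
  - by move=> K x xo; rewrite (hv K x xo); apply: eq_bigr => j _; rewrite mxE.
apply: eq_bigr => e he; congr (_ - _ * _).
  apply: fint_faceW => z rz; rewrite (trace_rep hmesh hv (face_param_tet Th e.1 rz)).
  by rewrite ev_pdot vev_cst.
apply: fint_faceW_sum => [j|z rz]; first exact: huSig.
rewrite (trace_rep hmesh hv (face_param_tet Th e.1 rz)) mulr_sumr.
by apply: eq_bigr => j _; rewrite evZ ev_pcross vev_cst mulrCA.
Qed.

Lemma rhs_G_rep th T : rep Th th T -> rhs_G Th Sig nu uSig th = pload_G T.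
Proof.
move=> ht; congr (_ * _); apply: eq_bigr => e he.
apply: fint_faceW_sum => [j|z rz]; first exact: huSig.
rewrite (trace_rep hmesh ht (face_param_tet Th e.1 rz)).
by apply: eq_bigr => j _; rewrite mxE.
Qed.

Lemma rhs_L_rep q Q : reps Th q Q -> rhs_L Th Sig d11 pSig q = pload_L Q.
Proof.
move=> hq; apply: eq_bigr => e he; apply: fint_faceW => z rz.
rewrite (trace_reps hmesh hq (face_param_tet Th e.1 rz)) evZ ev_pdot vev_cst.
have -> : vev (fun i => Q e.1.1 * pnormal Th e.1 i) (fparam Th e.1 z) =
   ev (Q e.1.1) (fparam Th e.1 z) *: face_normal Th e.1.
  by apply/rowP => i; rewrite [LHS]mxE scaE evM evC.
by rewrite dotZl mulrCA.
Qed.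

Lemma is_lin_faceW (M : lmodType R) (g : M -> poly) F (h : vec -> R) :
  inL2_face Th F h -> is_lin g -> is_lin (V := R^o) (fun y => faceW F h (g y)).
Proof.
move=> hi hg; apply: is_lin_mulc => a x y; rewrite hg wintP//.
- exact: measurable_ref.
- by move=> i; apply: measurable_funTS; exact: measurable_tparam.
- exact: tparam_bounded.
- exact: inL2_face_integrable.
Qed.

Lemma is_lin_sum_cond (M : lmodType R) (I : Type) (r : seq I) (c : pred I) (g : I -> M -> R) :
  (forall i, c i -> is_lin (V := R^o) (g i)) ->
  is_lin (V := R^o) (fun y => \sum_(i <- r | c i) g i y).
Proof.
move=> hg a x y; rewrite scaler_sumr -big_split /=.
by apply: eq_bigr => i /hg; exact.
Qed.

Lemma is_lin_pload_F : is_lin (V := R^o) pload_F.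
Proof.
apply: (@is_lin_add _ _ R^o).
  apply: (@is_lin_sum _ _ R^o) => K; apply: (@is_lin_sum _ _ R^o) => j a x y.
  rewrite !ffunE wintP//.
  - exact: measurable_ovol.
  - by move=> i; apply: measurable_funTS; exact: measurable_pt3.
  - exact: ovol_bounded.
  - exact: (inL2_integrable hOm hmesh K (hf j)).
apply: (@is_lin_opp _ _ R^o); apply: is_lin_sum_cond => e he.
apply: (@is_lin_add _ _ R^o).
  apply: is_lin_faceW; first exact: hpSig.
  apply: is_lin_sum => i; apply: is_lin_mulr; apply: is_lin_app; exact: is_lin_id.
apply: (@is_lin_opp _ _ R^o); apply: is_lin_mulc; apply: (@is_lin_sum _ _ R^o) => j.
apply: is_lin_faceW; first exact: huSig.
apply: is_lin_scale; rewrite /pcross.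
by apply: is_lin_nth; (apply: is_lin_add; [|apply: is_lin_opp]); apply: is_lin_mulr;
  apply: is_lin_app; exact: is_lin_id.
Qed.

Lemma is_lin_pload_G : is_lin (V := R^o) pload_G.
Proof.
apply: is_lin_mulc; apply: is_lin_sum_cond => e he; apply: (@is_lin_sum _ _ R^o) => j.
apply: is_lin_faceW; first exact: huSig.
apply: is_lin_app; exact: is_lin_id.
Qed.

Lemma is_lin_pload_L : is_lin (V := R^o) pload_L.
Proof.
apply: is_lin_sum_cond => e he; apply: is_lin_faceW; first exact: hpSig.
apply: is_lin_scale; apply: is_lin_sum => i; apply: is_lin_mull; apply: is_lin_mulr.
apply: is_lin_app; exact: is_lin_id.
Qed.

End FormRepresentation.

Section Admissible.
Context (R : realType) (N : nat) (Th : 'I_N -> 'M[R]_(4, 3)) (Om Gam Sig : set 'rV[R]_3).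
Hypothesis hmesh : is_mesh_of Th Om.
Let hTh := mesh_nondeg hmesh.

(** Polynomials of bounded degree on each element; if [Sig] is null, the pressures are further
    restricted to the kernel of the mean value. *)
Lemma spans_admissible (k : nat) :
  exists (J : finType) (e : J -> dofs R N), spans e (admissible Th Sig k).
Proof.
have hV m := spans_ffun ('I_N * 'I_3)%type (spans_mpoly R m).
have hP := spans_ffun 'I_N (spans_mpoly R k).
have [J [e [he1 he2]]] : exists (J : finType) (e : J -> {ffun 'I_N -> mpoly 3 R}),
    spans e (fun P => (forall K, (mmeasure mdeg (P K) <= k.+1)%N) /\
      (surface_null Th Sig -> \sum_K volI (Th K) (P K) = 0)).
  have [h|h] := pselect (surface_null Th Sig); last first.
    eexists; eexists; have [h1 h2] := hP; split=> [c|y [yS _]]; [|exact: h2 yS].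
    by split=> [|//]; exact: h1.
  have hm : is_lin (V := R^o) (fun P : {ffun 'I_N -> mpoly 3 R} => \sum_K volI (Th K) (P K)).
    apply: (@is_lin_sum _ _ R^o) => K; apply: (is_lin_volI hTh).
    by apply: is_lin_app; exact: is_lin_id.
  have [J [e [h1 h2]]] := spans_ker hm hP; exists J, e; split=> [c|y [yS y0]].
    by have [? ?] := h1 c.
  by apply: h2; split=> //; exact: y0.
eexists; eexists; exact: spans_prod (spans_prod (hV k.+1) (hV k)) (conj he1 he2).
Qed.

End Admissible.

(** * Existence and uniqueness of the discrete solution *)

Theorem proposition1 (R : realType)
  (* domain and boundary partition *)
  (Om Gam Sig : set 'rV[R]_3)
  (hOm : bounded_lipschitz_domain Om)
  (hpart : Gam `|` Sig = bdry Om) (hdisj : Gam `&` Sig = set0)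
  (* a member of a shape-regular family of meshes *)
  (N : nat) (Th : 'I_N -> 'M[R]_(4, 3)) (kappa : R)
  (hmesh : is_mesh_of Th Om) (hshape : shape_regular Th kappa)
  (hcomp : compatible Th Gam Sig)
  (* coefficients, data and stabilisation constants *)
  (nu sigma : R) (hnu : 0 < nu) (hsigma : 0 < sigma)
  (beta f uSig : 'rV[R]_3 -> 'rV[R]_3) (pSig : 'rV[R]_3 -> R)
  (hbeta : inLp_vec +oo%E Om beta) (hf : inLp_vec 2%:E Om f)
  (huSig : forall i, inL2_boundary Th Sig (vcoord uSig i))
  (hpSig : inL2_boundary Th Sig pSig)
  (c11 a11 d11 : R) (hc11 : 0 < c11) (ha11 : 0 < a11) (hd11 : 0 < d11)
  (k : nat)
  (hsmall : 2 * Linf_norm Om beta ^+ 2 / (nu * sigma) < 1) :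
  let solution u w p :=
    [/\ Hh Th k Om u, Zh Th k Om w, Qh Th k Om Sig p &
      [/\ forall v, Hh Th k Om v ->
            form_a Om sigma u v + form_b1 Th Gam nu v w + form_b2 Th Gam v p
            + form_c Om nu beta w v + form_j Th Gam Sig nu c11 a11 u v
            = rhs_F Th Om Sig nu c11 f uSig pSig v,
          forall th, Zh Th k Om th ->
            form_d Om w th - form_b1 Th Gam nu u th
            = rhs_G Th Sig nu uSig th &
          forall q, Qh Th k Om Sig q ->
            form_e Th Sig d11 p q - form_b2 Th Gam u q
            = rhs_L Th Sig d11 pSig q]] in
  (exists u w p, solution u w p) /\
  (forall u w p u' w' p', solution u w p -> solution u' w' p' ->
    [/\ ae_eq_in Om u u', ae_eq_in Om w w' & ae_eq_in Om p p']).
Proof.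
move=> solution.
have hTh := mesh_nondeg hmesh.
pose bt j (t : measurableTypeR R * measurableTypeR R * measurableTypeR R) := beta (pt3 t) 0 j.
have bi K j : (@leb3 R).-integrable (ovol (Th K)) (EFin \o bt j).
  exact: (inLoo_integrable hOm hmesh j K hbeta).
have b0 : 0 <= Linf_norm Om beta by exact: bigmax_ge_id.
have hb : 2 * Linf_norm Om beta ^+ 2 < nu * sigma.
  by move: hsmall; rewrite ltr_pdivrMr ?mulr_gt0// mul1r.
have bt_le j K : {ae @leb3 R, forall t, ovol (Th K) t -> `|bt j t| <= Linf_norm Om beta}.
  have := inLoo_bound j hbeta; apply: filterS => t h /(otet_sub_domain hOm hmesh); exact: h.
pose B := pform Th Gam Sig nu sigma c11 a11 d11 bt.
pose l (z : dofs R N) : R := pload_F Th Sig nu c11 f uSig pSig z.1.1 +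
  pload_G Th Sig nu uSig z.1.2 + pload_L Th Sig d11 pSig z.2.
have ker y : admissible Th Sig k y ->
    (forall z, admissible Th Sig k z -> B z y = 0) \/
    (forall z, admissible Th Sig k z -> B y z = 0) -> y = 0.
  exact: (pform_kernel hOm hmesh hcomp hdisj hc11 ha11 hd11 hnu hsigma b0 hb bi bt_le).
have FL := is_lin_pload_F hOm hmesh nu c11 hf huSig hpSig.
have GL := is_lin_pload_G nu huSig.
have LL := is_lin_pload_L d11 hpSig.
have lL : is_lin (V := R^o) l.
  move=> a x y; rewrite /l /= FL GL LL !scalerDr; ring.
have BL z : is_lin (V := R^o) (B^~ z) by exact: pform_linl.
have BR y : is_lin (V := R^o) (B y) by exact: pform_linr.
have mL v m : broken_vec Th m Om v -> comp_measurable Om v.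
  by move=> hv i; exact: (inLp_measurable hOm (hv i).1).
have mf : comp_measurable Om f by move=> i; exact: (inLp_measurable hOm (hf i)).
have mb : comp_measurable Om beta by move=> i; exact: (inLp_measurable hOm (hbeta i)).
have m0 m : (mmeasure mdeg (0 : mpoly 3 R) <= m)%N by rewrite mmeasure0.
have mean0 : surface_null Th Sig -> \sum_K volI (Th K) ((0 : {ffun 'I_N -> mpoly 3 R}) K) = 0.
  by move=> _; rewrite big1// => K _; rewrite ffunE /volI wint0//; exact: measurable_ovol.
have Q_pieces q : Qh Th k Om Sig q -> exists Q : {ffun 'I_N -> mpoly 3 R},
    [/\ forall K, (mmeasure mdeg (Q K) <= k.+1)%N,
        surface_null Th Sig -> \sum_K volI (Th K) (Q K) = 0 & reps Th q Q].
  move=> [hq hn]; have [Q hQ qQ] := broken_pieces hmesh hq; exists Q; split=> // hS.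
  by rewrite -(vint_rep hOm hmesh (inLp_measurable hOm hq.1) qQ); exact: hn.
have Q_assemble (Q : {ffun 'I_N -> mpoly 3 R}) : (forall K, (mmeasure mdeg (Q K) <= k.+1)%N) ->
    (surface_null Th Sig -> \sum_K volI (Th K) (Q K) = 0) -> Qh Th k Om Sig (assemble Th Q).
  move=> hQ hn; have hb' := assemble_broken hOm hmesh hQ; split=> // /hn <-.
  apply: (vint_rep hOm hmesh (inLp_measurable hOm hb'.1)) => K x; exact: (reps_assemble hmesh).
have qrep (Q : {ffun 'I_N -> mpoly 3 R}) : reps Th (assemble Th Q) Q.
  by move=> K x; exact: (reps_assemble hmesh).
have vrep U := rep_assemble hmesh U.
have vH m (U : {ffun 'I_N * 'I_3 -> mpoly 3 R}) := @assemble_vec_broken _ _ _ _ hOm hmesh m U.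
(* Assembled polynomials are legitimate test functions, so the pieces of any solution solve the
   coefficient system. *)
have to_poly u w p (y : dofs R N) : rep Th u y.1.1 -> rep Th w y.1.2 -> reps Th p y.2 ->
    solution u w p -> forall z, admissible Th Sig k z -> B y z = l z.
  move=> hu hw hp [uH wH pH [e1 e2 e3]] [[V T] Q] [[/= hV hT] [hQ hn]].
  have {}e1 := e1 _ (vH k.+1 V hV).
  have {}e2 := e2 _ (vH k T hT).
  have {}e3 := e3 _ (Q_assemble Q hQ hn).
  have mu := mL _ _ uH; have mw := mL _ _ wH.
  have mv := mL _ _ (vH k.+1 V hV); have mt := mL _ _ (vH k T hT).
  rewrite (form_a_rep hOm hmesh sigma mu mv hu (vrep V)) (form_b1_rep Gam hmesh nu (vrep V) hw)
    (form_b2_rep Gam hmesh (vrep V) hp) (form_c_rep hOm hmesh nu mb bi mw mv hw (vrep V))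
    (form_j_rep Gam Sig hmesh nu c11 a11 hu (vrep V))
    (rhs_F_rep hOm hmesh nu c11 pSig hf huSig mf mv (vrep V)) in e1.
  rewrite (form_d_rep hOm hmesh mw mt hw (vrep T)) (form_b1_rep Gam hmesh nu hu (vrep T))
    (rhs_G_rep hmesh nu huSig (vrep T)) in e2.
  rewrite (form_e_rep Sig hmesh d11 hp (qrep Q)) (form_b2_rep Gam hmesh hu (qrep Q))
    (rhs_L_rep Sig hmesh d11 pSig (qrep Q)) in e3.
  by rewrite /B /l /pform /= -e1 -e2 -e3.
(* Conversely, testing with one nonzero component at a time recovers the three equations. *)
have from_poly (y : dofs R N) : admissible Th Sig k y ->
    (forall z, admissible Th Sig k z -> B y z = l z) ->
    solution (assemble_vec Th y.1.1) (assemble_vec Th y.1.2) (assemble Th y.2).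
  case: y => -[U W] P [[/= hU hW] [hP hPn]] hl.
  have uH := vH k.+1 U hU; have wH := vH k W hW.
  have mu := mL _ _ uH; have mw := mL _ _ wH.
  have zr := fun V Q => pform_zero Gam Sig nu sigma c11 a11 d11 hTh bi V Q.
  split=> //; first exact: Q_assemble.
  split.
  - move=> v vHh; have mv := mL _ _ vHh; have [V hV hv] := broken_vec_pieces hmesh vHh.
    rewrite (form_a_rep hOm hmesh sigma mu mv (vrep U) hv) (form_b1_rep Gam hmesh nu hv (vrep W))
      (form_b2_rep Gam hmesh hv (qrep P)) (form_c_rep hOm hmesh nu mb bi mw mv (vrep W) hv)
      (form_j_rep Gam Sig hmesh nu c11 a11 (vrep U) hv)
      (rhs_F_rep hOm hmesh nu c11 pSig hf huSig mf mv hv).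
    have := hl (V, 0, 0); rewrite /B /l /pform /= (lin0 GL) (lin0 LL).
    have [[_ d0 _ _] [b0' _ b2' _] _ [e0 _] _] := zr W P.
    have [_ [b1' _ b2'' _] _ _ _] := zr U P.
    rewrite d0 b1' b2'' e0 subrr !addr0; apply.
    by split; split=> //= ?; rewrite ffunE.
  - move=> v vHh; have mv := mL _ _ vHh; have [V hV hv] := broken_vec_pieces hmesh vHh.
    rewrite (form_d_rep hOm hmesh mw mv (vrep W) hv) (form_b1_rep Gam hmesh nu (vrep U) hv)
      (rhs_G_rep hmesh nu huSig hv).
    have := hl (0, V, 0); rewrite /B /l /pform /= (lin0 FL) (lin0 LL).
    have [[a0 _ _ j0] [_ _ b2' _] _ [e0 _] _] := zr U P.
    have [_ [_ b1' _ b2''] [c0 _] _ _] := zr W P.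
    rewrite a0 b1' b2'' c0 j0 e0 b2' subrr !addr0 !add0r; apply.
    by split; split=> //= ?; rewrite ffunE.
  - move=> q qHh; have [Q [hQ hQn hq]] := Q_pieces _ qHh.
    rewrite (form_e_rep Sig hmesh d11 (qrep P) hq) (form_b2_rep Gam hmesh (vrep U) hq)
      (rhs_L_rep Sig hmesh d11 pSig hq).
    have := hl (0, 0, Q); rewrite /B /l /pform /= (lin0 FL) (lin0 GL).
    have [[a0 _ _ j0] [b1'' _ b2' _] _ [e0 _] _] := zr U P.
    have [[_ d0 _ _] [_ b1' _ b2''] [c0 _] _ _] := zr W P.
    rewrite a0 b1' b2'' c0 j0 d0 b1'' subrr !addr0 !add0r; apply.
    by split; split=> //= ?; rewrite ffunE.
split.
  have [J [e he]] := spans_admissible Sig hmesh k.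
  (* An element of the transposed kernel is zero, so the load vanishes on it. *)
  have [|y yadm hy] := fredholm he BL BR lL.
    by move=> y yadm hz; rewrite (ker y yadm (or_introl hz)) (lin0 lL).
  by eexists; eexists; eexists; exact: from_poly yadm hy.
move=> u w p u' w' p' s s'.
have [uH wH pH _] := s; have [uH' wH' pH' _] := s'.
have [U hU uU] := broken_vec_pieces hmesh uH; have [U' hU' uU'] := broken_vec_pieces hmesh uH'.
have [W hW wW] := broken_vec_pieces hmesh wH; have [W' hW' wW'] := broken_vec_pieces hmesh wH'.
have [P [hP nP pP]] := Q_pieces _ pH; have [P' [hP' nP' pP']] := Q_pieces _ pH'.
have yl := to_poly u w p (U, W, P) uU wW pP s.
have yl' := to_poly u' w' p' (U', W', P') uU' wW' pP' s'.
(* The difference of two solutions solves the homogeneous system, and it is admissible since a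
   spanned set is closed under linear combinations. *)
have : -1 *: ((U', W', P') : dofs R N) + (U, W, P) = 0.
  apply: ker; last by right=> z zadm; rewrite (BL z) yl// yl'// scaleN1r addNr.
  have [J [e he]] := spans_admissible Sig hmesh k.
  by apply: spans_lincomb he _ _; split; split.
rewrite scaleN1r addrC => /eqP; rewrite subr_eq0 => /eqP [EU EW EP].
split; [apply: (pieces_ae_eq hOm hmesh uU)|apply: (pieces_ae_eq hOm hmesh wW)|
  apply: (pieces_ae_eq hOm hmesh pP)] => K x xo; rewrite ?EU ?EW ?EP;
  [exact: uU'|exact: wW'|exact: pP'].
Qed.
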